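(* Let $\mathbb{K}$ be a field of characteristic $0$. The category $\mathsf{conil.\ coLie}$ of conilpotent dg Lie coalgebras over $\mathbb{K}$ and the category $\mathsf{ind}(\mathsf{fd\ conil.\ coLie})$ of ind-objects in finite dimensional conilpotent dg Lie coalgebras are equivalent. The equivalence is given by the functor $$\mathrm{colim}:\mathsf{ind}(\mathsf{fd\ conil.\ coLie})\longrightarrow\mathsf{conil.\ coLie}$$ given by taking a functorial choice of colimit of diagrams, and the functor $$\delta:\mathsf{conil.\ coLie}\longrightarrow\mathsf{ind}(\mathsf{fd\ conil.\ coLie})$$ associating to a conilpotent Lie coalgebra the diagram of all its finite dimensional sub-coalgebras with the relative inclusions.
   Context: A conilpotent Lie coalgebra is a (dg) conilpotent coalgebra over the cooperad $\mathsf{coLie}=\mathsf{Lie}^\vee$, the linear dual of the operad $\mathsf{Lie}$; $\mathsf{fd\ conil.\ coLie}$ is the full subcategory of those of finite total dimension. For a category $\mathcal{C}$, $\mathsf{ind}(\mathcal{C})$ has as objects the diagrams $F:\mathcal{D}\to\mathcal{C}$ with $\mathcal{D}$ a small filtered category, and morphisms $\hom_{\mathsf{ind}(\mathcal{C})}(F,G)=\lim_{d\in\mathcal{D}}\mathrm{colim}_{e\in\mathcal{E}}\hom_{\mathcal{C}}(F(d),G(e))$ for $F:\mathcal{D}\to\mathcal{C}$, $G:\mathcal{E}\to\mathcal{C}$. ''Filtered'' has its usual meaning (non-empty, any two objects map to a common object, any two parallel arrows are coequalized by some arrow). *)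

(* Defs.v *)
From HB Require Import structures.
From mathcomp Require Import all_boot all_order all_fingroup all_algebra.
From mathcomp Require Import boolp.
From Stdlib Require Import Relation_Operators.

Set Implicit Arguments.
Unset Strict Implicit.
Unset Printing Implicit Defensive.

Import GRing.Theory.
Local Open Scope ring_scope.
Local Open Scope quotient_scope.

Lemma linear_comb (K : fieldType) (U W : lmodType K) (f : U -> W) I (s : seq I)
    (c : I -> K) (u : I -> U) : linear f ->
  f (\sum_(i <- s) c i *: u i) = \sum_(i <- s) c i *: f (u i).
Proof.
move=> fl; elim: s => [|i s IH]; last by rewrite !big_cons fl IH.
rewrite !big_nil; have := fl (-1) 0 0.
by rewrite scaler0 addr0 /= => ->; rewrite scaleN1r addNr.
Qed.

(** * Modules presented by generators and relations *)

(* A formal sum [s : seq (K * X)] stands for the element [\sum_(p <- s) p.1 x_p.2]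
   of the free module on X; [coef s] is that element as a function X -> K. *)
Section FormalSums.
Variables (K : fieldType) (X : choiceType).
Implicit Types s t : seq (K * X).

Definition coef s (x : X) : K := \sum_(p <- s | p.2 == x) p.1.

Definition scale_fs (c : K) s : seq (K * X) := [seq (c * p.1, p.2) | p <- s].

Lemma coef_cat s t x : coef (s ++ t) x = coef s x + coef t x.
Proof. by rewrite /coef big_cat. Qed.

Lemma coef_scale c s x : coef (scale_fs c s) x = c * coef s x.
Proof. by rewrite /coef big_map mulr_sumr. Qed.

(* The submodule of the free module spanned by the relations R. *)
Definition in_span (R : seq (K * X) -> Prop) s : Prop :=
  exists2 l : seq (K * seq (K * X)),
    forall a, a \in l -> R a.2 &
    forall x, coef s x = \sum_(a <- l) a.1 * coef a.2 x.

Lemma in_span_lin R c s t :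
  in_span R s -> in_span R t -> in_span R (scale_fs c s ++ t).
Proof.
move=> [l Rl sE] [m Rm tE].
exists ([seq (c * a.1, a.2) | a <- l] ++ m).
  move=> a; rewrite mem_cat => /orP[/mapP[b bl ->]|]; [exact: (Rl b)|exact: (Rm a)].
move=> x; rewrite coef_cat coef_scale sE tE big_cat big_map /= mulr_sumr.
by congr (_ + _); apply: eq_bigr => a _; rewrite mulrA.
Qed.

Lemma in_span_ext R s t : coef s =1 coef t -> in_span R s -> in_span R t.
Proof. by move=> st [l Rl sE]; exists l => // x; rewrite -st sE. Qed.

Lemma in_span0 R s : coef s =1 (fun=> 0) -> in_span R s.
Proof. by move=> s0; exists [::] => // x; rewrite big_nil s0. Qed.

Lemma in_span_rel R s : R s -> in_span R s.
Proof.
move=> Rs; exists [:: (1, s)]; first by move=> a; rewrite inE => /eqP->.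
by move=> x; rewrite big_seq1 mul1r.
Qed.

Definition fs_eqv R s t : bool := `[< in_span R (s ++ scale_fs (-1) t) >].

Lemma fs_eqv_refl R : reflexive (fs_eqv R).
Proof.
move=> s; apply/asboolP/in_span0 => x.
by rewrite coef_cat coef_scale mulN1r subrr.
Qed.

Lemma fs_eqv_sym R : symmetric (fs_eqv R).
Proof.
suff H s t : fs_eqv R s t -> fs_eqv R t s by move=> s t; apply/idP/idP; exact: H.
move=> /asboolP H; apply/asboolP.
have H0 : in_span R [::] by apply: in_span0 => x; rewrite /coef big_nil.
apply: in_span_ext (in_span_lin (-1) H H0) => x.
rewrite cats0 coef_scale !coef_cat !coef_scale !mulN1r.
by rewrite opprD opprK addrC.
Qed.

Lemma fs_eqv_trans R : transitive (fs_eqv R).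
Proof.
move=> t s u /asboolP H1 /asboolP H2; apply/asboolP.
apply: in_span_ext (in_span_lin 1 H1 H2) => x.
rewrite !(coef_cat, coef_scale) mul1r !mulN1r.
by rewrite addrA subrK.
Qed.

End FormalSums.

Section Presented.
Variables (K : fieldType) (X : choiceType) (R : seq (K * X) -> Prop).

Definition fs_equiv :=
  EquivRel (@fs_eqv K X R) (@fs_eqv_refl K X R) (@fs_eqv_sym K X R)
           (@fs_eqv_trans K X R).

Definition pres : Type := {eq_quot fs_equiv}.
HB.instance Definition _ := Choice.on pres.

Definition cls (s : seq (K * X)) : pres := \pi_({eq_quot fs_equiv}) s.
Definition rep (x : pres) : seq (K * X) := generic_quotient.repr (x : {eq_quot fs_equiv}).
Definition gen (x : X) : pres := cls [:: (1, x)].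

Lemma repK x : cls (rep x) = x.
Proof. exact: generic_quotient.reprK. Qed.

Lemma clsP s t : cls s = cls t <-> in_span R (s ++ scale_fs (-1) t).
Proof.
split=> [/eqP|H]; first by rewrite eqmodE => /asboolP.
by apply/eqP; rewrite eqmodE; apply/asboolP.
Qed.

Lemma cls_ext s t : coef s =1 coef t -> cls s = cls t.
Proof.
move=> st; apply/clsP/in_span0 => x.
by rewrite coef_cat coef_scale st mulN1r subrr.
Qed.

Definition pres_add (x y : pres) := cls (rep x ++ rep y).
Definition pres_scale (c : K) (x : pres) := cls (scale_fs c (rep x)).
Definition pres_opp (x : pres) := pres_scale (-1) x.
Definition pres_zero : pres := cls [::].

Lemma rep_cls s : in_span R (rep (cls s) ++ scale_fs (-1) s).
Proof. by apply/clsP; rewrite repK. Qed.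

Lemma pres_addE s t : pres_add (cls s) (cls t) = cls (s ++ t).
Proof.
apply/clsP; apply: in_span_ext (in_span_lin 1 (rep_cls s) (rep_cls t)) => x.
by rewrite !(coef_cat, coef_scale) mul1r mulrDr addrACA.
Qed.

Lemma pres_scaleE c s : pres_scale c (cls s) = cls (scale_fs c s).
Proof.
have H0 : in_span R [::] by apply: in_span0 => x; rewrite /coef big_nil.
apply/clsP; apply: in_span_ext (in_span_lin c (rep_cls s) H0) => x.
by rewrite cats0 !(coef_cat, coef_scale) mulrDr mulrCA.
Qed.

Lemma pres_addA : associative pres_add.
Proof.
move=> x y z; rewrite -(repK x) -(repK y) -(repK z) !pres_addE.
by rewrite catA.
Qed.

Lemma pres_addC : commutative pres_add.
Proof.
move=> x y; rewrite -(repK x) -(repK y) !pres_addE.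
by apply: cls_ext => u; rewrite !coef_cat addrC.
Qed.

Lemma pres_add0 : left_id pres_zero pres_add.
Proof. by move=> x; rewrite -(repK x) pres_addE. Qed.

Lemma pres_addN : left_inverse pres_zero pres_opp pres_add.
Proof.
move=> x; rewrite -(repK x) /pres_opp pres_scaleE pres_addE.
apply: cls_ext => u.
by rewrite coef_cat coef_scale mulN1r addNr /coef big_nil.
Qed.

HB.instance Definition _ :=
  GRing.isZmodule.Build pres pres_addA pres_addC pres_add0 pres_addN.

Lemma pres_scaleA a b x : pres_scale a (pres_scale b x) = pres_scale (a * b) x.
Proof.
rewrite -(repK x) !pres_scaleE.
by apply: cls_ext => u; rewrite !coef_scale mulrA.
Qed.

Lemma pres_scale1 : left_id 1 pres_scale.
Proof.
move=> x; rewrite -(repK x) !pres_scaleE.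
by apply: cls_ext => u; rewrite !coef_scale mul1r.
Qed.

Lemma pres_scaleDr : right_distributive pres_scale +%R.
Proof.
move=> a x y; rewrite -(repK x) -(repK y) [_ + _]pres_addE !pres_scaleE.
rewrite [RHS]pres_addE.
by apply: cls_ext => u; rewrite !(coef_cat, coef_scale) mulrDr.
Qed.

Lemma pres_scaleDl x : {morph pres_scale^~ x : a b / a + b}.
Proof.
move=> a b; rewrite -(repK x) !pres_scaleE [RHS]pres_addE.
by apply: cls_ext => u; rewrite !(coef_cat, coef_scale) mulrDl.
Qed.

HB.instance Definition _ := GRing.Zmodule_isLmodule.Build K pres
  pres_scaleA pres_scale1 pres_scaleDr pres_scaleDl.

Lemma clsD s t : cls (s ++ t) = cls s + cls t.
Proof. by rewrite [RHS]pres_addE. Qed.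

Lemma clsZ c s : cls (scale_fs c s) = c *: cls s.
Proof. by rewrite [RHS]pres_scaleE. Qed.

Lemma clsE s : cls s = \sum_(p <- s) p.1 *: gen p.2.
Proof.
elim: s => [|[c x] s IH]; first by rewrite big_nil.
rewrite big_cons -IH /gen -clsZ -clsD /=.
by congr cls; rewrite mulr1.
Qed.

Lemma cls_rel r : R r -> cls r = 0.
Proof.
move=> Rr; apply/clsP; apply: in_span_ext (in_span_rel Rr) => x.
by rewrite /= cats0.
Qed.

(* The linear extension of [f : X -> W]; it is meaningful when f satisfies
   the relations R (see [linext_linear] and [linext_gen]). *)
Definition linext (W : lmodType K) (f : X -> W) (x : pres) : W :=
  \sum_(p <- rep x) p.1 *: f p.2.

Section Lift.
Variables (W : lmodType K) (f : X -> W).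

Lemma fs_sumE s (u : seq X) : uniq u -> {subset [seq p.2 | p <- s] <= u} ->
  \sum_(p <- s) p.1 *: f p.2 = \sum_(x <- u) coef s x *: f x.
Proof.
move=> uu su; rewrite /coef.
under [RHS]eq_bigr do rewrite scaler_suml.
rewrite (exchange_big_dep predT) //=; apply: eq_big_seq => p ps.
have pu : p.2 \in u by apply/su/map_f.
rewrite big_mkcond (bigD1_seq p.2) //= eqxx big1 ?addr0 // => x xp.
by rewrite eq_sym (negPf xp).
Qed.

Hypothesis fR : forall r, R r -> \sum_(p <- r) p.1 *: f p.2 = 0.

Lemma linext_cls s : linext f (cls s) = \sum_(p <- s) p.1 *: f p.2.
Proof.
have [l Rl sE] := rep_cls s; rewrite /linext; set t := rep _ in sE *.
pose u := undup ([seq p.2 | p <- t ++ s] ++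
                 flatten [seq [seq p.2 | p <- a.2] | a <- l]).
have uu : uniq u by exact: undup_uniq.
have su r : {subset r <= t ++ s} -> {subset [seq p.2 | p <- r] <= u}.
  move=> rs x /mapP[p /rs ps ->]; rewrite mem_undup mem_cat.
  by rewrite (map_f (fun p => p.2)).
rewrite (fs_sumE uu (su t _)); last by move=> x; rewrite mem_cat => ->.
rewrite (fs_sumE uu (su s _)); last by move=> x; rewrite mem_cat orbC => ->.
apply/eqP; rewrite -subr_eq0 -sumrB; apply/eqP.
under eq_bigr => x _.
  have := sE x; rewrite coef_cat coef_scale mulN1r -scalerBl => ->.
  rewrite scaler_suml; over.
rewrite exchange_big /= big1_seq // => a /andP[_ al].
under eq_bigr do rewrite -scalerA.
rewrite -scaler_sumr -fs_sumE ?fR ?scaler0 //; first exact: Rl.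
move=> x xa; rewrite mem_undup mem_cat; apply/orP; right.
by apply/flattenP; exists [seq p.2 | p <- a.2] => //; apply/mapP; exists a.
Qed.

Lemma linext_linear : linear (linext f).
Proof.
move=> c x y; rewrite -(repK x) -(repK y) -clsZ -clsD !linext_cls.
rewrite big_cat big_map /= scaler_sumr.
by congr (_ + _); apply: eq_bigr => p _; rewrite scalerA.
Qed.

Lemma linext_gen x : linext f (gen x) = f x.
Proof. by rewrite linext_cls big_seq1 scale1r. Qed.

End Lift.

Lemma pres_ext (W : lmodType K) (g h : pres -> W) : linear g -> linear h ->
  (forall x, g (gen x) = h (gen x)) -> g =1 h.
Proof.
move=> gl hl gh y; rewrite -(repK y); elim: (rep y) => [|[c x] s IH].
  have l0 f : linear f -> f (cls [::] : pres) = 0 :> W.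
    move=> fl; have := fl (-1) 0 0; rewrite scaler0 addr0 => E.
    by move: E => /= ->; rewrite scaleN1r addNr.
  by rewrite !l0.
have -> : cls ((c, x) :: s) = c *: gen x + cls s by rewrite !clsE big_cons.
by rewrite gl hl gh IH.
Qed.

End Presented.

Arguments gen {K X R} x.
Arguments cls {K X R} s.
Arguments linext {K X R W} f x.

(** * Linear duals and tensor products *)

Section Dual.
Variables (K : fieldType) (V : lmodType K).

Definition dual : Type := {linear V -> K^o}.
HB.instance Definition _ := gen_eqMixin dual.
HB.instance Definition _ := gen_choiceMixin dual.

Implicit Types f g h : dual.

Definition dual_eval f (x : V) : K := (f : {linear V -> K^o}) x.

Lemma dual_ext f g : (forall x, dual_eval f x = dual_eval g x) -> f = g.
Proof.
rewrite /dual_eval; case: f g => [f cf] [g cg] /= fg.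
have {fg} E : f = g by apply: funext.
rewrite E in cf *; congr GRing.Linear.Pack.
case: cf cg => [[a] [b]] [[a'] [b']].
by rewrite (Prop_irrelevance a a') (Prop_irrelevance b b').
Qed.

Definition dual_zero : dual := \0%R.
Definition dual_add f g : dual := f \+ g.
Definition dual_opp f : dual := \- f.
Definition dual_scale (c : K) f : dual := c \*: f.

Lemma dual_addA : associative dual_add.
Proof. by move=> f g h; apply: dual_ext => x /=; rewrite addrA. Qed.
Lemma dual_addC : commutative dual_add.
Proof. by move=> f g; apply: dual_ext => x /=; rewrite addrC. Qed.
Lemma dual_add0 : left_id dual_zero dual_add.
Proof. by move=> f; apply: dual_ext => x /=; rewrite add0r. Qed.
Lemma dual_addN : left_inverse dual_zero dual_opp dual_add.
Proof. by move=> f; apply: dual_ext => x /=; rewrite addNr. Qed.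
HB.instance Definition _ :=
  GRing.isZmodule.Build dual dual_addA dual_addC dual_add0 dual_addN.

Lemma dual_scaleA a b f : dual_scale a (dual_scale b f) = dual_scale (a * b) f.
Proof. by apply: dual_ext => x /=; rewrite scalerA. Qed.
Lemma dual_scale1 : left_id 1 dual_scale.
Proof. by move=> f; apply: dual_ext => x /=; rewrite scale1r. Qed.
Lemma dual_scaleDr : right_distributive dual_scale +%R.
Proof. by move=> a f g; apply: dual_ext => x /=; rewrite scalerDr. Qed.
Lemma dual_scaleDl f : {morph dual_scale^~ f : a b / a + b}.
Proof. by move=> a b; apply: dual_ext => x /=; rewrite scalerDl. Qed.
HB.instance Definition _ := GRing.Zmodule_isLmodule.Build K dual
  dual_scaleA dual_scale1 dual_scaleDr dual_scaleDl.

End Dual.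

Section Tensor.
Variable K : fieldType.

Inductive tens_rel (A B : lmodType K) : seq (K * (A * B)) -> Prop :=
| TensRelL c a a' b :
    tens_rel [:: (1, (c *: a + a', b)); (- c, (a, b)); (-1, (a', b))]
| TensRelR c a b b' :
    tens_rel [:: (1, (a, c *: b + b')); (- c, (a, b)); (-1, (a, b'))].

(* A (x) B *)
Definition tens (A B : lmodType K) : lmodType K := pres (@tens_rel A B).

Definition pure (A B : lmodType K) (a : A) (b : B) : tens A B := gen (a, b).

Definition tens_map (A A' B B' : lmodType K) (f : A -> A') (g : B -> B') :
    tens A B -> tens A' B' :=
  linext (fun p => pure (f p.1) (g p.2)).

Section TensorTheory.
Variables A B : lmodType K.

Lemma pure_l c (a a' : A) (b : B) :
  pure (c *: a + a') b = c *: pure a b + pure a' b.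
Proof.
have := cls_rel (TensRelL c a a' b).
rewrite clsE !big_cons big_nil /= scale1r scaleN1r scaleNr addr0 -opprD.
by move/eqP; rewrite subr_eq0 => /eqP.
Qed.

Lemma pure_r c (a : A) (b b' : B) :
  pure a (c *: b + b') = c *: pure a b + pure a b'.
Proof.
have := cls_rel (TensRelR c a b b').
rewrite clsE !big_cons big_nil /= scale1r scaleN1r scaleNr addr0 -opprD.
by move/eqP; rewrite subr_eq0 => /eqP.
Qed.

(* The universal property of A (x) B. *)
Section Bilinear.
Variables (W : lmodType K) (f : A * B -> W).
Hypothesis fl : forall c a a' b, f (c *: a + a', b) = c *: f (a, b) + f (a', b).
Hypothesis fr : forall c a b b', f (a, c *: b + b') = c *: f (a, b) + f (a, b').

Lemma tens_rel0 r : tens_rel r -> \sum_(p <- r) p.1 *: f p.2 = 0.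
Proof.
case=> *; rewrite !big_cons big_nil /= ?fl ?fr scale1r scaleN1r scaleNr addr0.
  by rewrite -opprD subrr.
by rewrite -opprD subrr.
Qed.

Lemma tens_linear : linear (linext f : tens A B -> W).
Proof. exact/linext_linear/tens_rel0. Qed.

Lemma tens_pure a b : (linext f : tens A B -> W) (pure a b) = f (a, b).
Proof. exact/linext_gen/tens_rel0. Qed.
End Bilinear.

End TensorTheory.

Section TensorMap.
Variables (A A' B B' : lmodType K) (f : A -> A') (g : B -> B').
Hypotheses (fl : linear f) (gl : linear g).

Lemma tens_map_linear : linear (tens_map f g).
Proof. by apply: tens_linear => * /=; rewrite ?fl ?gl ?pure_l ?pure_r. Qed.

Lemma tens_map_pure a b : tens_map f g (pure a b) = pure (f a) (g b).
Proof. by rewrite /tens_map tens_pure //= => *; rewrite ?fl ?gl ?pure_l ?pure_r. Qed.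
End TensorMap.

Lemma tens_map_id (A B : lmodType K) (f : A -> A) (g : B -> B) :
  f =1 id -> g =1 id -> tens_map f g =1 id.
Proof.
move=> /funext-> /funext->.
by apply: pres_ext => [||[a b]]; [exact: tens_map_linear|..|exact: tens_map_pure].
Qed.

Lemma tens_map_comp (A A' A'' B B' B'' : lmodType K)
    (f : A -> A') (f' : A' -> A'') (g : B -> B') (g' : B' -> B'') :
  linear f -> linear f' -> linear g -> linear g' ->
  tens_map f' g' \o tens_map f g =1 tens_map (f' \o f) (g' \o g).
Proof.
move=> fl fl' gl gl'.
have fl2 : linear (f' \o f) by move=> c x y /=; rewrite fl fl'.
have gl2 : linear (g' \o g) by move=> c x y /=; rewrite gl gl'.
apply: pres_ext => [c x y||[a b]]; [|exact: tens_map_linear|].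
  by rewrite /= !(tens_map_linear _ _).
by rewrite /= -/(pure a b) !tens_map_pure.
Qed.

End Tensor.

(** * Tensor powers of graded modules *)

Section TensorPower.
Variable K : fieldType.

(* A graded module is a family [V : int -> lmodType K]; [hel V] is the type of
   its homogeneous elements, each packed with its degree. *)
Definition hel (V : int -> lmodType K) : choiceType := {k : int & V k}.

Definition deg (V : int -> lmodType K) (x : hel V) : int := tag x.

Definition helem (V : int -> lmodType K) k (v : V k) : hel V := Tagged V v.

Section Power.
Variables (V : int -> lmodType K) (n : nat).

Definition upd (t : n.-tuple (hel V)) (i : 'I_n) (x : hel V) : n.-tuple (hel V) :=
  [tuple if j == i then x else tnth t j | j < n].

Inductive tpow_rel : seq (K * n.-tuple (hel V)) -> Prop :=
| TpowRel (t : n.-tuple (hel V)) (i : 'I_n) k (c : K) (u v : V k) :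
    tpow_rel [:: (1, upd t i (helem (c *: u + v)));
                 (- c, upd t i (helem u)); (-1, upd t i (helem v))].

(* The total space of the graded module V^(x)n: it is spanned by the
   x_1 (x) ... (x) x_n with the x_i homogeneous. *)
Definition tpow : lmodType K := pres tpow_rel.

Definition tprod (t : n.-tuple (hel V)) : tpow := gen t.

Definition tdeg (t : n.-tuple (hel V)) : int := \sum_(j < n) deg (tnth t j).

Definition tpow_deg (k : int) (x : tpow) : Prop :=
  exists2 s : seq (K * n.-tuple (hel V)),
    x = cls s & forall p, p \in s -> tdeg p.2 = k.

Definition sign (k : int) : K := (-1) ^+ `|k|%N.

(* d (x_1 (x) ... (x) x_n) =
   \sum_i (-1)^(|x_1| + ... + |x_(i-1)|) x_1 (x) ... (x) d x_i (x) ... (x) x_n *)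
Definition tpow_d (d : forall k, V k -> V (k - 1)) : tpow -> tpow :=
  linext (fun t => \sum_(i < n)
    sign (\sum_(j < n | (j < i)%N) deg (tnth t j)) *:
      tprod (upd t i (helem (d _ (tagged (tnth t i)))))).

Definition koszul (s : 'S_n) (t : n.-tuple (hel V)) : K :=
  \prod_(i < n) \prod_(j < n | (i < j)%N && (s j < s i)%N)
     sign (deg (tnth t (s i)) * deg (tnth t (s j))).

(* The left action of the symmetric group, with Koszul signs, for the product
   of 'S_n in which [(s * s') j = s' (s j)]. *)
Definition tpow_perm (s : 'S_n) : tpow -> tpow :=
  linext (fun t => koszul s t *: tprod [tuple tnth t (s j) | j < n]).

End Power.

Definition tpow_map (V W : int -> lmodType K) (f : forall k, V k -> W k) n :
    tpow V n -> tpow W n :=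
  linext (fun t : n.-tuple (hel V) => tprod (map_tuple (fun x => helem (f _ (tagged x))) t)).
Arguments tpow_map {V W} f n x.

Lemma tprod_upd (V : int -> lmodType K) n (t : n.-tuple (hel V)) i k c (u v : V k) :
  tprod (upd t i (helem (c *: u + v))) =
  c *: tprod (upd t i (helem u)) + tprod (upd t i (helem v)).
Proof.
have := cls_rel (TpowRel t i c u v).
rewrite clsE !big_cons big_nil /= scale1r scaleN1r scaleNr addr0 -opprD.
by move/eqP; rewrite subr_eq0 => /eqP.
Qed.

(* The universal property of V^(x)n. *)
Section Multilinear.
Variables (V : int -> lmodType K) (n : nat) (W : lmodType K).
Variable f : n.-tuple (hel V) -> W.
Hypothesis fl : forall t i k c (u v : V k),
  f (upd t i (helem (c *: u + v))) =
  c *: f (upd t i (helem u)) + f (upd t i (helem v)).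

Lemma tpow_rel0 r : tpow_rel r -> \sum_(p <- r) p.1 *: f p.2 = 0.
Proof.
case=> *; rewrite !big_cons big_nil /= fl scale1r scaleN1r scaleNr addr0.
by rewrite -opprD subrr.
Qed.

Lemma tpow_linear : linear (linext f : tpow V n -> W).
Proof. exact/linext_linear/tpow_rel0. Qed.

Lemma tpow_tprod t : (linext f : tpow V n -> W) (tprod t) = f t.
Proof. exact/linext_gen/tpow_rel0. Qed.
End Multilinear.

Section TpowMap.
Variables (V W : int -> lmodType K) (f : forall k, V k -> W k) (n : nat).
Hypothesis fl : forall k, linear (@f k).

Let F (t : n.-tuple (hel V)) := map_tuple (fun x => helem (f (tagged x))) t.

Lemma map_upd t i k (u : V k) : F (upd t i (helem u)) = upd (F t) i (helem (f u)).
Proof.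
by apply: eq_from_tnth => j; rewrite !(tnth_map, tnth_mktuple); case: ifP.
Qed.

Lemma tpow_map_mult t i k c (u v : V k) :
  tprod (F (upd t i (helem (c *: u + v)))) =
  c *: tprod (F (upd t i (helem u))) + tprod (F (upd t i (helem v))).
Proof. by rewrite !map_upd fl tprod_upd. Qed.

Lemma tpow_map_linear : linear (tpow_map f n).
Proof. exact/tpow_linear/tpow_map_mult. Qed.

Lemma tpow_map_tprod t : tpow_map f n (tprod t) = tprod (F t).
Proof. exact/tpow_tprod/tpow_map_mult. Qed.
End TpowMap.

Lemma tpow_map_id (V : int -> lmodType K) n :
  tpow_map (fun k (v : V k) => v) n =1 id.
Proof.
apply: pres_ext => [||t]; [exact: tpow_map_linear|by []|].
rewrite [LHS]tpow_map_tprod //; congr tprod.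
by apply: eq_from_tnth => j; rewrite tnth_map; case: (tnth t j).
Qed.

Lemma tpow_map_comp (U V W : int -> lmodType K) (f : forall k, U k -> V k)
    (g : forall k, V k -> W k) n :
  (forall k, linear (@f k)) -> (forall k, linear (@g k)) ->
  tpow_map g n \o tpow_map f n =1
  tpow_map (fun k => @g k \o @f k) n.
Proof.
move=> fl gl.
have gfl k : linear (@g k \o @f k) by move=> c x y /=; rewrite fl gl.
apply: pres_ext => [c x y||t]; [|exact: tpow_map_linear|].
  by rewrite /= !(tpow_map_linear _).
rewrite /= -/(tprod t) !tpow_map_tprod //; congr tprod.
by apply: eq_from_tnth => j; rewrite !tnth_map.
Qed.

Lemma tins_subproof (V : int -> lmodType K) n m (i : 'I_n.+1)
    (t : n.+1.-tuple (hel V)) (w : m.-tuple (hel V)) :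
  size (take i t ++ w ++ drop i.+1 t) == (n + m)%N.
Proof.
have le_in : (i <= n)%N by rewrite -ltnS.
rewrite !size_cat size_take size_drop !size_tuple ltn_ord subSS.
by rewrite addnCA subnKC // addnC.
Qed.

(* Replaces the i-th entry of t by the word w. *)
Definition tins (V : int -> lmodType K) n m (i : 'I_n.+1)
    (t : n.+1.-tuple (hel V)) (w : m.-tuple (hel V)) : (n + m).-tuple (hel V) :=
  Tuple (tins_subproof i t w).

End TensorPower.
Arguments tpow_map {K V W} f n x.

(** * The operad Lie *)

Section LieTrees.
Local Open Scope nat_scope.

(* Bracket monomials with leaves labelled by natural numbers. *)
Inductive ltree := Leaf of nat | Br of ltree & ltree.

Fixpoint ltree_code (t : ltree) : GenTree.tree nat :=
  match t with
  | Leaf j => GenTree.Leaf j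
  | Br a b => GenTree.Node 0 [:: ltree_code a; ltree_code b]
  end.

Fixpoint ltree_decode (t : GenTree.tree nat) : option ltree :=
  match t with
  | GenTree.Leaf j => Some (Leaf j)
  | GenTree.Node _ [:: a; b] =>
      if ltree_decode a is Some a' then
        if ltree_decode b is Some b' then Some (Br a' b') else None
      else None
  | _ => None
  end.

Lemma ltree_codeK : pcancel ltree_code ltree_decode.
Proof. by elim=> //= a -> b ->. Qed.

HB.instance Definition _ := Countable.copy ltree (pcan_type ltree_codeK).

Fixpoint leaves (t : ltree) : seq nat :=
  match t with Leaf j => [:: j] | Br a b => leaves a ++ leaves b end.

Fixpoint ltree_bind (f : nat -> ltree) (t : ltree) : ltree :=
  match t with Leaf j => f j | Br a b => Br (ltree_bind f a) (ltree_bind f b) end.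

Lemma leaves_bind f t :
  leaves (ltree_bind f t) = flatten [seq leaves (f j) | j <- leaves t].
Proof. by elim: t => [j|a IHa b IHb] /=; rewrite ?cats0 // map_cat flatten_cat IHa IHb. Qed.

(* Multilinear bracket monomials in n variables x_0, ..., x_(n-1): each label
   0, ..., n-1 occurs exactly once. *)
Definition is_mon (n : nat) (t : ltree) : bool := perm_eq (leaves t) (iota 0 n).
Definition mon (n : nat) : choiceType := {t : ltree | is_mon n t}.

Definition mon_id : mon 1 := exist (is_mon 1) (Leaf 0) (perm_refl [:: 0%N]).

Definition perm_label n (s : 'S_n) (j : nat) : nat :=
  if insub j is Some j' then val (s j') else j.

Lemma mon_perm_subproof n (s : 'S_n) (t : mon n) :
  perm_eq (leaves (ltree_bind (fun j => Leaf (perm_label s j)) (val t))) (iota 0 n).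
Proof.
rewrite leaves_bind /= flatten_map1.
apply: (perm_trans (perm_map _ (valP t))).
rewrite -val_enum_ord -map_comp.
have -> : [seq (perm_label s \o val) j | j <- enum 'I_n] =
          [seq val j | j <- [seq s j | j <- enum 'I_n]].
  by rewrite -[RHS]map_comp; apply: eq_map => j; rewrite /perm_label /= valK.
apply: perm_map; apply: uniq_perm.
- by rewrite map_inj_uniq ?enum_uniq //; exact: perm_inj.
- exact: enum_uniq.
move=> j; rewrite mem_enum; apply/mapP; exists (s^-1%g j); rewrite ?mem_enum //.
by rewrite permKV.
Qed.

(* Renames each variable x_j to x_(s j). *)
Definition mon_perm n (s : 'S_n) (t : mon n) : mon n :=
  exist (is_mon n) _ (mon_perm_subproof s t).

(* Partial composition at the i-th input, of a monomial in n + 1 variables with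
   one in m variables: x_i is replaced by u(x_i, ..., x_(i+m-1)) and x_j by
   x_(j+m-1) for j > i. *)
Definition ltree_comp (i m : nat) (t u : ltree) : ltree :=
  ltree_bind (fun j =>
    if (j < i)%N then Leaf j
    else if j == i then ltree_bind (fun l => Leaf (i + l)) u
    else Leaf (j + m).-1) t.

Lemma mon_comp_subproof n m (i : 'I_n.+1) (t : mon n.+1) (u : mon m) :
  perm_eq (leaves (ltree_comp i m (val t) (val u))) (iota 0 (n + m)).
Proof.
rewrite leaves_bind.
pose B j := if (j < i)%N then [:: j] else
  if j == i then [seq (i + l)%N | l <- iota 0 m] else [:: (j + m).-1].
apply: (@perm_trans _ (flatten [seq B j | j <- leaves (val t)])).
  elim: (leaves (val t)) => //= j s IH; apply: perm_cat IH.
  rewrite /B; case: ifP => // _; case: ifP => // _.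
  by rewrite leaves_bind /= flatten_map1; apply: perm_map; exact: (valP u).
apply: perm_trans (perm_flatten (perm_map B (valP t))) _.
have le_in : (i <= n)%N by rewrite -ltnS.
have -> : iota 0 n.+1 = iota 0 i ++ val i :: iota i.+1 (n - i).
  by rewrite -[in LHS](subnKC le_in) -addnS iotaD.
have B1 : [seq B j | j <- iota 0 i] = [seq [:: j] | j <- iota 0 i].
  by apply/eq_in_map => j; rewrite mem_iota /B => /andP[_ ->].
have B2 : [seq B j | j <- iota i.+1 (n - i)] =
          [seq [:: (j + m).-1] | j <- iota i.+1 (n - i)].
  apply/eq_in_map => j; rewrite mem_iota /B => /andP[ij _].
  by rewrite ltnNge ltnW //= gtn_eqF.
rewrite map_cat flatten_cat B1 flatten_map1 map_id map_cons /= B2 flatten_map1.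
rewrite {1}/B ltnn eqxx -iotaDl addn0.
have -> : [seq (j + m).-1 | j <- iota i.+1 (n - i)] = iota (i + m) (n - i).
  rewrite -(addn0 i.+1) -(addn0 (i + m)) !iotaDl -map_comp.
  by apply: eq_map => j /=; rewrite addnAC.
suff -> : iota 0 i ++ iota i m ++ iota (i + m) (n - i) = iota 0 (n + m).
  exact: perm_refl.
by rewrite -iotaD -{2}(add0n (val i)) -iotaD addnCA subnKC // addnC.
Qed.

Definition mon_comp n m (i : 'I_n.+1) (t : mon n.+1) (u : mon m) : mon (n + m) :=
  exist (is_mon (n + m)) _ (mon_comp_subproof i t u).

End LieTrees.

Section Lie.
Variable K : fieldType.

(* The ideal of relations of Lie: antisymmetry and the Jacobi identity,
   in every context. *)
Inductive lie_rel : seq (K * ltree) -> Prop :=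
| LieAnti a b : lie_rel [:: (1, Br a b); (1, Br b a)]
| LieJacobi a b c : lie_rel
    [:: (1, Br (Br a b) c); (1, Br (Br b c) a); (1, Br (Br c a) b)]
| LieBrL r t : lie_rel r -> lie_rel [seq (p.1, Br p.2 t) | p <- r]
| LieBrR r t : lie_rel r -> lie_rel [seq (p.1, Br t p.2) | p <- r].

Lemma lie_rel_bind f r :
  lie_rel r -> lie_rel [seq (p.1, ltree_bind f p.2) | p <- r].
Proof.
elim=> {r} [a b|a b c|r t _ IH|r t _ IH]; rewrite -?map_comp /=.
- exact: LieAnti.
- exact: LieJacobi.
- by move: (LieBrL (ltree_bind f t) IH); rewrite -map_comp.
- by move: (LieBrR (ltree_bind f t) IH); rewrite -map_comp.
Qed.

Lemma ltree_comp_notin i m t u u' :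
  i \notin leaves t -> ltree_comp i m t u = ltree_comp i m t u'.
Proof.
elim: t => [j|a IHa b IHb] /=.
  by rewrite inE eq_sym /ltree_comp /= => /negPf->.
rewrite mem_cat negb_or => /andP[/IHa Ea /IHb Eb].
by congr Br; [exact: Ea | exact: Eb].
Qed.

Lemma lie_rel_comp i m t r : count_mem i (leaves t) = 1%N ->
  lie_rel r -> lie_rel [seq (p.1, ltree_comp i m t p.2) | p <- r].
Proof.
move=> + rr; elim: t => [j|a IHa b IHb] /=.
  rewrite addn0; have [->|//] := eqVneq j i => _.
  rewrite /ltree_comp /= ltnn eqxx; exact: lie_rel_bind.
have cN s : count_mem i s = 0%N -> i \notin s.
  by move=> s0; rewrite -has_pred1 has_count s0.
rewrite count_cat; case ca: (count_mem i (leaves a)) => [|[|na]] //= cb.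
  have ia := cN _ ca.
  move: (LieBrR (ltree_comp i m a (Leaf 0)) (IHb cb)); rewrite -map_comp.
  congr lie_rel; apply: eq_map => p /=.
  by rewrite (ltree_comp_notin m (Leaf 0) p.2 ia).
have ib : i \notin leaves b by apply: cN; case: cb.
move: (LieBrL (ltree_comp i m b (Leaf 0)) (IHa ca)); rewrite -map_comp.
congr lie_rel; apply: eq_map => p /=.
by rewrite (ltree_comp_notin m (Leaf 0) p.2 ib).
Qed.

Definition mon_rel n (r : seq (K * mon n)) : Prop :=
  lie_rel [seq (p.1, val p.2) | p <- r].

(* Lie(n) *)
Definition lie (n : nat) : lmodType K := pres (@mon_rel n).

Definition lie_id : lie 1 := gen mon_id.

Definition lie_perm n (s : 'S_n) : lie n -> lie n :=
  linext (fun t => gen (mon_perm s t)).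

Definition lie_comp n m (i : 'I_n.+1) (x : lie n.+1) (y : lie m) : lie (n + m) :=
  linext (fun t => linext (fun u => gen (mon_comp i t u)) y) x.

Lemma mon_rel_map n n' (f : mon n -> mon n') r :
  mon_rel [seq (p.1, f p.2) | p <- r] ->
  \sum_(p <- r) p.1 *: (gen (f p.2) : lie n') = 0.
Proof. by move/cls_rel; rewrite clsE big_map. Qed.

Lemma lie_perm_linear n (s : 'S_n) : linear (lie_perm s).
Proof.
apply: linext_linear => r rr; apply: mon_rel_map.
rewrite /mon_rel -map_comp.
by have := lie_rel_bind (fun j => Leaf (perm_label s j)) rr; rewrite -map_comp.
Qed.
HB.instance Definition _ n (s : 'S_n) :=
  GRing.isLinear.Build K (lie n) (lie n) *:%R (lie_perm s) (lie_perm_linear s).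

Lemma lie_comp_linearl n m (i : 'I_n.+1) (y : lie m) :
  linear (fun x => lie_comp i x y).
Proof.
apply: linext_linear => r rr; rewrite /linext.
under eq_bigr do rewrite scaler_sumr.
rewrite exchange_big /= big1 // => q _.
under eq_bigr => p _ do rewrite scalerA mulrC -scalerA.
rewrite -scaler_sumr (@mon_rel_map _ _ (fun t => mon_comp i t q.2)) ?scaler0 //.
rewrite /mon_rel -map_comp.
pose f j := if (j < i)%N then Leaf j
  else if j == i then ltree_bind (fun l => Leaf (i + l)%N) (val q.2)
  else Leaf (j + m)%N.-1.
by have := lie_rel_bind f rr; rewrite -map_comp.
Qed.

Lemma lie_comp_linearr n m (i : 'I_n.+1) (x : lie n.+1) :
  linear (lie_comp i x : lie m -> lie (n + m)).
Proof.
pose g t : lie m -> lie (n + m) := linext (fun u => gen (mon_comp i t u)).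
have L t : linear (g t).
  apply: linext_linear => r rr.
  rewrite (@mon_rel_map _ _ (mon_comp i t)) // /mon_rel -map_comp.
  have ct : count_mem (val i) (leaves (val t)) = 1%N.
    have /seq.permP -> : perm_eq (leaves (val t)) (iota 0 n.+1) := valP t.
    by rewrite count_uniq_mem ?iota_uniq // mem_iota /= ltn_ord.
  by have := lie_rel_comp m ct rr; rewrite -map_comp.
have E y : lie_comp i x y = \sum_(p <- rep x) p.1 *: g p.2 y by [].
move=> c y z; rewrite !E scaler_sumr -big_split /=.
by apply: eq_bigr => p _; rewrite L scalerDr !scalerA mulrC.
Qed.

End Lie.

(** * The cooperad coLie *)

(* A frame of a module: vectors with linear forms that give coordinates. *)
Section Frame.
Variables (K : fieldType) (V : lmodType K).

Definition finitely_spanned : Prop := exists (d : nat) (e : 'I_d -> V),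
  forall x, exists c : 'I_d -> K, x = \sum_(a < d) c a *: e a.

Record frame := Frame {
  fr_dim : nat;
  fr_vec : 'I_fr_dim -> V;
  fr_form : 'I_fr_dim -> dual V;
  frameE : forall x, x = \sum_(a < fr_dim) dual_eval (fr_form a) x *: fr_vec a }.

Arguments fr_vec : clear implicits.
Arguments fr_form : clear implicits.

Lemma frame_ex : finitely_spanned -> inhabited frame.
Proof.
pose P d := `[< exists e : 'I_d -> V,
  forall x, exists c : 'I_d -> K, x = \sum_(a < d) c a *: e a >].
move=> [d0 H0]; have exP : exists d, P d by exists d0; apply/asboolP.
case: (ex_minnP exP) => d /asboolP[e He] dmin {d0 H0 exP}.
have free (c : 'I_d -> K) : \sum_(a < d) c a *: e a = 0 -> forall a, c a = 0.
  move=> c0 a; apply/eqP/negPn/negP => ca.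
  case: d => [|d] in e He dmin c c0 a ca *; first by case: a ca.
  suff : (d.+1 <= d)%N by rewrite ltnn.
  apply: dmin; apply/asboolP; exists (fun b => e (lift a b)) => x.
  have [x_ xE] := He x.
  exists (fun b => x_ (lift a b) - x_ a / c a * c (lift a b)).
  have := c0; rewrite (bigD1_ord a) //= => /eqP; rewrite addr_eq0 => /eqP ea.
  have -> : \sum_(b < d) (x_ (lift a b) - x_ a / c a * c (lift a b)) *: e (lift a b)
    = \sum_(b < d) x_ (lift a b) *: e (lift a b)
      - (x_ a / c a) *: \sum_(b < d) c (lift a b) *: e (lift a b).
    rewrite scaler_sumr -sumrB; apply: eq_bigr => b _.
    by rewrite scalerBl scalerA.
  rewrite -[X in _ - _ *: X]opprK -ea scalerN opprK scalerA divfK //.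
  by rewrite xE (bigD1_ord a) //= addrC.
pose c x := projT1 (cid (He x)).
have cE x : x = \sum_(a < d) c x a *: e a by exact: projT2 (cid (He x)).
have cU x (c' : 'I_d -> K) : x = \sum_(a < d) c' a *: e a -> c x =1 c'.
  move=> xE a; apply/eqP; rewrite -subr_eq0; apply/eqP.
  apply: (free (fun a => c x a - c' a)).
  under eq_bigr do rewrite scalerBl.
  by rewrite sumrB -cE -xE subrr.
have cL a : linear (fun x => c x a : K^o).
  move=> k x y; apply: (cU _ (fun a => k * c x a + c y a)).
  under eq_bigr do rewrite scalerDl -scalerA.
  by rewrite big_split /= -scaler_sumr -!cE.
pose form a : dual V :=
  HB.pack_for {linear V -> K^o} (fun x => c x a : K^o)
    (GRing.isLinear.Build K V K^o *:%R (fun x => c x a : K^o) (cL a)).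
by split; exists d e form => x; rewrite {1}(cE x).
Qed.

End Frame.
Arguments fr_vec {K V} f a.
Arguments fr_form {K V} f a.

Section DualPairing.
Variables (K : fieldType) (A B : lmodType K).

Definition tens_eval (x : A) (y : B) : tens (dual A) (dual B) -> K^o :=
  linext (fun p => dual_eval p.1 x * dual_eval p.2 y : K^o).

Lemma tens_eval_bil x y :
  (forall c (f f' : dual A) (g : dual B), dual_eval (c *: f + f') x * dual_eval g y =
     c * (dual_eval f x * dual_eval g y) + dual_eval f' x * dual_eval g y) *
  (forall c (f : dual A) (g g' : dual B), dual_eval f x * dual_eval (c *: g + g') y =
     c * (dual_eval f x * dual_eval g y) + dual_eval f x * dual_eval g' y).
Proof.
by split=> * ; [rewrite mulrDl mulrA | rewrite mulrDr mulrCA].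
Qed.

Lemma tens_eval_linear x y : linear (tens_eval x y).
Proof. by apply: tens_linear => * /=; rewrite tens_eval_bil. Qed.

Lemma tens_eval_pure x y f g :
  tens_eval x y (pure f g) = dual_eval f x * dual_eval g y.
Proof. by rewrite /tens_eval tens_pure //= => *; rewrite tens_eval_bil. Qed.

Lemma tens_eval_inj (b : frame A) (b' : frame B) (z z' : tens (dual A) (dual B)) :
  (forall x y, tens_eval x y z = tens_eval x y z') -> z = z'.
Proof.
have dualE (V : lmodType K) (e : frame V) (f : dual V) :
    f = \sum_(a < fr_dim e) dual_eval f (fr_vec e a) *: fr_form e a.
  apply: dual_ext => x.
  have dl : linear (fun h : dual V => dual_eval h x : K^o) by [].
  have fl : linear (dual_eval f : _ -> K^o) by move=> c u v; rewrite /dual_eval linearP.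
  rewrite [RHS](linear_comb _ _ _ dl) {1}(frameE e x) (linear_comb _ _ _ fl).
  by apply: eq_bigr => a _; rewrite [LHS]mulrC.
have E w : w = \sum_(a < fr_dim b) \sum_(a' < fr_dim b')
    tens_eval (fr_vec b a) (fr_vec b' a') w *: pure (fr_form b a) (fr_form b' a').
  move: w; apply: pres_ext => [//|c w w'|[f g]].
    rewrite scaler_sumr -big_split; apply: eq_bigr => a _.
    rewrite scaler_sumr -big_split; apply: eq_bigr => a' _ /=.
    by rewrite tens_eval_linear scalerDl scalerA.
  rewrite -/(pure f g) {1}(dualE _ b f) {1}(dualE _ b' g).
  rewrite (@linear_comb _ _ _ (fun a => pure a _)) => [|? ? ?]; last exact: pure_l.
  apply: eq_bigr => a _.
  rewrite linear_comb => [|? ? ?]; last exact: pure_r.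
  rewrite scaler_sumr; apply: eq_bigr => a' _.
  by rewrite tens_eval_pure scalerA.
by move=> zz'; rewrite (E z) (E z'); do 2!apply: eq_bigr => ? _; rewrite zz'.
Qed.

End DualPairing.

Section LieFrame.
Variable K : fieldType.

Lemma ltree_finite (N n : nat) : exists s : seq ltree, forall t,
  (size (leaves t) <= n)%N -> all (fun j => j < N)%N (leaves t) -> t \in s.
Proof.
have leaves_gt0 t : (0 < size (leaves t))%N.
  by elim: t => //= a IHa b _; rewrite size_cat addn_gt0 IHa.
elim: n => [|n [s IH]].
  by exists [::] => t; rewrite leqNgt leaves_gt0.
exists ([seq Leaf j | j <- iota 0 N] ++ [seq Br a b | a <- s, b <- s]).
move=> [j|a b] /=; rewrite mem_cat.
  by move=> _; rewrite andbT => jN; rewrite map_f // mem_iota.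
rewrite size_cat all_cat => ab /andP[aN bN]; apply/orP; right.
apply/allpairsP; exists (a, b); split=> //=; apply: IH => //.
  by rewrite -ltnS (leq_trans _ ab) // -[ltnLHS]addn0 ltn_add2l.
by rewrite -ltnS (leq_trans _ ab) // -[ltnLHS]add0n ltn_add2r.
Qed.

Lemma lie_finitely_spanned n : finitely_spanned (lie K n).
Proof.
have [s sP] := ltree_finite n n.
pose l : seq (mon n) := pmap insub s.
have lP t : t \in l.
  rewrite mem_pmap_sub; apply: sP.
    by rewrite (perm_size (valP t)) size_iota.
  rewrite (perm_all _ (valP t)); apply/allP => j.
  by rewrite mem_iota.
exists (size l), (fun a => gen (tnth (in_tuple l) a)) => x.
exists (fun a : 'I_(size l) => \sum_(p <- rep x | index p.2 l == a :> nat) p.1).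
under eq_bigr do rewrite scaler_suml.
rewrite (exchange_big_dep predT) //= -{1}(repK x) clsE; apply: eq_bigr => p _.
have pl : (index p.2 l < size l)%N by rewrite index_mem.
rewrite (big_pred1 (Ordinal pl)) => [|a]; last by rewrite /= -val_eqE /= eq_sym.
by rewrite (tnth_nth p.2) /= nth_index.
Qed.

Definition lie_frame n : frame (lie K n) :=
  inhabited_witness (frame_ex (lie_finitely_spanned n)).

(* coLie(n), the linear dual of Lie(n) *)
Definition colie (n : nat) : lmodType K := dual (lie K n).

(* The transpose of the action of 'S_n on Lie(n). *)
Definition colie_perm n (s : 'S_n) (f : colie n) : colie n :=
  (f : {linear lie K n -> K^o}) \o lie_perm s.

Lemma colie_perm_linear n (s : 'S_n) : linear (@colie_perm n s).
Proof. by move=> c f g; apply: dual_ext. Qed.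
HB.instance Definition _ n (s : 'S_n) :=
  GRing.isLinear.Build K (colie n) (colie n) *:%R (@colie_perm n s)
    (@colie_perm_linear n s).

(* Evaluation at the unit of Lie. *)
Definition colie_counit (f : colie 1) : K^o := dual_eval f (lie_id K).

Lemma colie_counit_linear : linear colie_counit.
Proof. by []. Qed.
HB.instance Definition _ :=
  GRing.isLinear.Build K (colie 1) K^o *:%R colie_counit colie_counit_linear.

(* The transpose of the partial composition of Lie, followed by the inverse of
   the canonical map coLie(n+1) (x) coLie(m) -> (Lie(n+1) (x) Lie(m))^*, which
   is invertible because Lie is finite dimensional in each arity. The result
   does not depend on the frames, see [colie_decE] and [tens_eval_inj]. *)
Definition colie_dec n m (i : 'I_n.+1) (f : colie (n + m)) :
    tens (colie n.+1) (colie m) :=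
  let b := lie_frame n.+1 in let b' := lie_frame m in
  \sum_(a < fr_dim b) \sum_(a' < fr_dim b')
    dual_eval f (lie_comp i (fr_vec b a) (fr_vec b' a')) *:
      pure (fr_form b a) (fr_form b' a').

Lemma colie_dec_linear n m (i : 'I_n.+1) : linear (@colie_dec n m i).
Proof.
move=> c f g; rewrite /colie_dec scaler_sumr -big_split; apply: eq_bigr => a _.
rewrite scaler_sumr -big_split; apply: eq_bigr => a' _ /=.
by rewrite scalerA -scalerDl.
Qed.
HB.instance Definition _ n m (i : 'I_n.+1) :=
  GRing.isLinear.Build K (colie (n + m)) (tens (colie n.+1) (colie m)) *:%R
    (@colie_dec n m i) (@colie_dec_linear n m i).

Lemma colie_decE n m (i : 'I_n.+1) (f : colie (n + m)) x y :
  tens_eval x y (colie_dec i f) = dual_eval f (lie_comp i x y).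
Proof.
rewrite /colie_dec; set b := lie_frame n.+1; set b' := lie_frame m.
have fl : linear (dual_eval f : _ -> K^o) by move=> c u v; rewrite /dual_eval linearP.
rewrite {2}(frameE b x) (linear_comb _ _ _ (lie_comp_linearl i y)) (linear_comb _ _ _ fl).
under eq_bigr do rewrite -[\sum__ _]scale1r.
rewrite (linear_comb _ _ _ (tens_eval_linear x y)); apply: eq_bigr => a _.
rewrite scale1r (linear_comb _ _ _ (tens_eval_linear x y)).
rewrite {2}(frameE b' y) (linear_comb _ _ _ (lie_comp_linearr i _)) (linear_comb _ _ _ fl).
rewrite scaler_sumr; apply: eq_bigr => a' _.
by rewrite tens_eval_pure scalerA [LHS]mulrC.
Qed.

End LieFrame.

(* The structure maps of a symmetric cooperad: the action of the symmetric
   groups, the counit, and the infinitesimal decompositions, dual to the partial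
   compositions of an operad. *)
Record cooperad_maps (K : fieldType) := CooperadMaps {
  co_mod :> nat -> lmodType K;
  co_perm : forall n, 'S_n -> {linear co_mod n -> co_mod n};
  co_counit : {linear co_mod 1 -> K^o};
  co_dec : forall n m, 'I_n.+1 ->
    {linear co_mod (n + m) -> tens (co_mod n.+1) (co_mod m)} }.

Definition coLie (K : fieldType) : cooperad_maps K :=
  @CooperadMaps K (colie K) (fun n s => @colie_perm K n s) (@colie_counit K)
    (fun n m i => @colie_dec K n m i).

(** * Conilpotent dg coalgebras over a cooperad *)

Section Coalgebra.
Variables (K : fieldType) (C : cooperad_maps K).

(* C(n+1) (x) V^(x)(n+1) -> C(n+1) (x) C(m) (x) V^(x)(n+m): applies D to the
   i-th tensor factor of V^(x)(n+1). No sign occurs as D has degree 0 and C is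
   concentrated in degree 0. *)
Definition cop_at (V : int -> lmodType K) n m (i : 'I_n.+1)
    (D : forall k, V k -> tens (C m) (tpow V m)) :
    tens (C n.+1) (tpow V n.+1) -> tens (tens (C n.+1) (C m)) (tpow V (n + m)) :=
  linext (fun p : C n.+1 * tpow V n.+1 =>
    linext (fun t : n.+1.-tuple (hel V) =>
      linext (fun q : C m * tpow V m =>
        linext (fun w : m.-tuple (hel V) =>
          pure (pure p.1 q.1) (tprod (tins i t w))) q.2)
        (D _ (tagged (tnth t i)))) p.2).

(* A structure of conilpotent dg C-coalgebra on V, i.e., of coalgebra over the
   comonad V |-> \bigoplus_n (C(n) (x) V^(x)n)^('S_n): the components
   cop n : V -> (C(n) (x) V^(x)n)^('S_n) of a map into the direct sum. *)
Record coalg_on (V : int -> lmodType K) := CoalgOn {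
  cd : forall k, {linear V k -> V (k - 1)};
  cop : forall n k, {linear V k -> tens (C n) (tpow V n)};
  cd_cd : forall k (v : V k), cd (k - 1) (cd k v) = 0;
  cop_deg : forall n k (v : V k),
    exists2 s : seq (K * (C n * tpow V n)),
      cop n k v = cls s & forall p, p \in s -> tpow_deg k p.2.2;
  cop_cd : forall n k (v : V k),
    cop n (k - 1) (cd k v) = tens_map id (tpow_d cd) (cop n k v);
  cop_inv : forall n (s : 'S_n) k (v : V k),
    tens_map (co_perm C s) (tpow_perm s) (cop n k v) = cop n k v;
  cop_fin : forall k (v : V k), exists N, forall n, (N <= n)%N -> cop n k v = 0;
  cop_counit : forall k (v : V k),
    linext (fun p : C 1 * tpow V 1 => (co_counit C p.1 : K) *: p.2) (cop 1 k v) =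
    tprod [tuple helem v];
  cop_coassoc : forall n m (i : 'I_n.+1) k (v : V k),
    tens_map (co_dec C m i) id (cop (n + m) k v) =
    cop_at i (cop m) (cop n.+1 k v) }.

Record coalg := Coalg {
  car :> int -> lmodType K;
  car_coalg : coalg_on car }.

Definition coalg_d (V : coalg) := cd (car_coalg V).
Definition coalg_cop (V : coalg) := cop (car_coalg V).

Record coalg_hom (V W : coalg) := CoalgHom {
  hfun :> forall k, V k -> W k;
  hfun_linear : forall k, linear (@hfun k);
  hfun_cd : forall k (v : V k), hfun (coalg_d V k v) = coalg_d W k (hfun v);
  hfun_cop : forall n k (v : V k),
    coalg_cop W n k (hfun v) = tens_map id (tpow_map hfun n) (coalg_cop V n k v) }.
Arguments hfun {V W} f k v : rename.

Lemma coalg_hom_ext (V W : coalg) (f g : coalg_hom V W) :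
  (forall k (v : V k), f k v = g k v) -> f = g.
Proof.
case: f g => [f fl fd fc] [g gl gd gc] /= fg.
have {fg} E : f = g.
  by apply: functional_extensionality_dep => k; apply: funext => v.
by case: _ / E in gl gd gc *; congr CoalgHom; exact: Prop_irrelevance.
Qed.

Lemma coalg_id_cop (V : coalg) n k (v : V k) :
  coalg_cop V n k v = tens_map id (tpow_map (fun k (v : V k) => v) n) (coalg_cop V n k v).
Proof. by rewrite tens_map_id //; exact: tpow_map_id. Qed.

Definition coalg_id (V : coalg) : coalg_hom V V :=
  @CoalgHom V V (fun k v => v) (fun k c x y => erefl) (fun k v => erefl)
    (@coalg_id_cop V).

Section Comp.
Variables (U V W : coalg) (g : coalg_hom V W) (f : coalg_hom U V).

Let gf k (v : U k) : W k := g k (f k v).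

Lemma coalg_comp_linear k : linear (@gf k).
Proof. by move=> c x y; rewrite /gf !hfun_linear. Qed.

Lemma coalg_comp_cd k (v : U k) : gf (coalg_d U k v) = coalg_d W k (gf v).
Proof. by rewrite /gf !hfun_cd. Qed.

Lemma coalg_comp_cop n k (v : U k) :
  coalg_cop W n k (gf v) = tens_map id (tpow_map gf n) (coalg_cop U n k v).
Proof.
rewrite /gf !hfun_cop.
rewrite -[LHS]/((tens_map id (tpow_map g n) \o tens_map id (tpow_map f n)) _).
rewrite tens_map_comp //; try exact/tpow_map_linear/hfun_linear.
congr (tens_map _ _ _); apply: funext.
by apply: tpow_map_comp; exact: hfun_linear.
Qed.

Definition coalg_comp : coalg_hom U W :=
  CoalgHom coalg_comp_linear coalg_comp_cd coalg_comp_cop.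
End Comp.

(* Finite total dimension. *)
Definition finite_dim (V : int -> lmodType K) : Prop :=
  (exists N : nat, forall k, (N < `|k|)%N -> forall v : V k, v = 0) /\
  (forall k, finitely_spanned (V k)).

End Coalgebra.

(** * Categories *)

Record category := Category {
  obj :> Type;
  hom : obj -> obj -> Type;
  idm : forall x, hom x x;
  cmp : forall x y z, hom y z -> hom x y -> hom x z;
  cmp_id_l : forall x y (f : hom x y), cmp (idm y) f = f;
  cmp_id_r : forall x y (f : hom x y), cmp f (idm x) = f;
  cmpA : forall x y z w (h : hom z w) (g : hom y z) (f : hom x y),
    cmp h (cmp g f) = cmp (cmp h g) f }.
Arguments idm {c} x.
Arguments cmp {c x y z} g f.

(* A category whose objects and morphisms form types in a smaller universe,
   that of the carriers of modules. For a small category D, [sobj D] lives in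
   that universe, whereas the type of the objects of D seen as a category is
   typed in the universe of [obj]. *)
Record small_category := SmallCategory {
  sobj : Type;
  shom : sobj -> sobj -> Type;
  sidm : forall x, shom x x;
  scmp : forall x y z, shom y z -> shom x y -> shom x z;
  scmp_id_l : forall x y (f : shom x y), scmp (sidm y) f = f;
  scmp_id_r : forall x y (f : shom x y), scmp f (sidm x) = f;
  scmpA : forall x y z w (h : shom z w) (g : shom y z) (f : shom x y),
    scmp h (scmp g f) = scmp (scmp h g) f }.

Definition cat_of_small (D : small_category) : category :=
  Category (@scmp_id_l D) (@scmp_id_r D) (@scmpA D).
Coercion cat_of_small : small_category >-> category.

Record functor (A B : category) := Functor {
  fobj :> A -> B;
  fmap : forall x y, hom x y -> hom (fobj x) (fobj y);
  fmap_id : forall x, fmap (idm x) = idm (fobj x);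
  fmap_cmp : forall x y z (g : hom y z) (f : hom x y),
    fmap (cmp g f) = cmp (fmap g) (fmap f) }.
Arguments fmap {A B} F {x y} f : rename.

Definition filtered (D : category) : Prop :=
  [/\ inhabited D,
      forall x y : D, exists z : D, inhabited (hom x z) /\ inhabited (hom y z) &
      forall (x y : D) (f g : hom x y), exists (z : D) (h : hom y z),
        cmp h f = cmp h g].

Section FunctorConstructions.
Variables A B C : category.

Definition functor_id : functor A A :=
  @Functor A A id (fun _ _ f => f) (fun _ => erefl) (fun _ _ _ _ _ => erefl).

Variables (G : functor B C) (F : functor A B).

Lemma functor_comp_id x : fmap G (fmap F (idm x)) = idm (G (F x)).
Proof. by rewrite !fmap_id. Qed.
Lemma functor_comp_cmp x y z (g : hom y z) (f : hom x y) :
  fmap G (fmap F (cmp g f)) = cmp (fmap G (fmap F g)) (fmap G (fmap F f)).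
Proof. by rewrite !fmap_cmp. Qed.

Definition functor_comp : functor A C :=
  @Functor A C (fun x => G (F x)) (fun x y f => fmap G (fmap F f))
    functor_comp_id functor_comp_cmp.

End FunctorConstructions.

Definition nat_iso (A B : category) (F G : functor A B) : Prop :=
  exists (a : forall x, hom (F x) (G x)) (b : forall x, hom (G x) (F x)),
    [/\ forall x y (f : hom x y), cmp (a y) (fmap F f) = cmp (fmap G f) (a x),
        forall x, cmp (b x) (a x) = idm (F x) &
        forall x, cmp (a x) (b x) = idm (G x)].

(* F and G are mutually inverse equivalences of categories. *)
Definition cat_equivalence (A B : category) (F : functor A B) (G : functor B A) : Prop :=
  nat_iso (functor_comp G F) (functor_id A) /\
  nat_iso (functor_comp F G) (functor_id B).

(** * Ind-objects *)

Section Ind.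
Variable C : category.

Record ind_obj := IndObj {
  idx : small_category;
  diag : functor idx C;
  idx_filtered : filtered idx }.

(* The colimit of a diagram of sets is the quotient of the disjoint union by the
   equivalence relation generated by the transition maps. The elements of
   [colim_hom x G] = colim_e hom (x, G e) are the equivalence classes. *)
Definition pre_hom (x : C) (G : ind_obj) : Type := {e : idx G & hom x (diag G e)}.

Inductive pre_step (x : C) (G : ind_obj) : pre_hom x G -> pre_hom x G -> Prop :=
| PreStep e e' (u : hom e e') (g : hom x (diag G e)) :
    pre_step (existT _ e g) (existT _ e' (cmp (fmap (diag G) u) g)).

Definition pre_eq (x : C) (G : ind_obj) : pre_hom x G -> pre_hom x G -> Prop :=
  clos_refl_sym_trans _ (@pre_step x G).

Definition colim_hom (x : C) (G : ind_obj) : Type :=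
  {P : pre_hom x G -> Prop | exists p, P = pre_eq p}.

Definition colim_cls (x : C) (G : ind_obj) (e : idx G) (g : hom x (diag G e)) :
    colim_hom x G :=
  exist _ (pre_eq (existT _ e g)) (ex_intro _ _ erefl).

Lemma colim_clsP x G e e' (g : hom x (diag G e)) (g' : hom x (diag G e')) :
  colim_cls g = colim_cls g' <-> pre_eq (existT _ e g) (existT _ e' g').
Proof.
split=> [[]|H].
  by move/(congr1 (fun P => P (existT _ e' g'))) => ->; exact: rst_refl.
apply: eq_exist; apply: funext => p; apply: propext; split=> Hp.
  by apply: rst_trans Hp; exact: rst_sym.
exact: rst_trans Hp.
Qed.

Lemma colim_cls_surj x G (a : colim_hom x G) :
  exists (e : idx G) (g : hom x (diag G e)), a = colim_cls g.
Proof. by case: a => P [[e g] EP]; exists e, g; apply: eq_exist. Qed.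

Lemma colim_cls_step x G e e' (u : hom e e') (g : hom x (diag G e)) :
  colim_cls (cmp (fmap (diag G) u) g) = colim_cls g.
Proof. by apply/colim_clsP; apply: rst_sym; apply: rst_step. Qed.

Lemma colim_cls_precomp x x' G (f : hom x x') e e'
    (g : hom x' (diag G e)) (g' : hom x' (diag G e')) :
  colim_cls g = colim_cls g' -> colim_cls (cmp g f) = colim_cls (cmp g' f).
Proof.
move/colim_clsP; set p := existT _ e g; set p' := existT _ e' g' => pp'.
rewrite -[LHS]/(colim_cls (cmp (projT2 p) f)) -[RHS]/(colim_cls (cmp (projT2 p') f)).
elim: pp' => {p p' e e' g g'} [p p' []|p|p p' _ ->|p q r _ -> _ ->] //=.
by move=> e e' u g; rewrite -cmpA colim_cls_step.
Qed.

(* lim_d colim_e hom (F d, G e) *)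
Record ind_hom (F G : ind_obj) := IndHom {
  ih_comp :> forall d : idx F, colim_hom (diag F d) G;
  ih_compat : forall (d d' : idx F) (u : hom d d') e (g : hom (diag F d') (diag G e)),
    ih_comp d' = colim_cls g -> ih_comp d = colim_cls (cmp g (fmap (diag F) u)) }.


Lemma ind_hom_ext F G (a b : ind_hom F G) : (forall d, a d = b d) -> a = b.
Proof.
case: a b => [a Ha] [b Hb] /= ab.
have {ab} E : a = b by apply: functional_extensionality_dep.
by case: _ / E in Hb *; congr IndHom; exact: Prop_irrelevance.
Qed.

Lemma ind_id_compat F (d d' : idx F) (u : hom d d') e
    (g : hom (diag F d') (diag F e)) :
  colim_cls (idm (diag F d')) = colim_cls g ->
  colim_cls (idm (diag F d)) = colim_cls (cmp g (fmap (diag F) u)).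
Proof.
move/(colim_cls_precomp (fmap (diag F) u)) => <-.
by rewrite cmp_id_l -[fmap _ u]cmp_id_r colim_cls_step.
Qed.

Definition ind_id F : ind_hom F F :=
  @IndHom F F (fun d => colim_cls (idm (diag F d))) (@ind_id_compat F).

Lemma ind_hom_step F G (a : ind_hom F G) d d' (u : hom d d') i i'
    (h : hom (diag F d) (diag G i)) (h' : hom (diag F d') (diag G i')) :
  a d = colim_cls h -> a d' = colim_cls h' ->
  colim_cls h = colim_cls (cmp h' (fmap (diag F) u)).
Proof. by move=> <- /(ih_compat u) <-. Qed.

Lemma colim_post_eq x G H (b : ind_hom G H) (p p' : pre_hom x G) i i'
    (h : hom (diag G (projT1 p)) (diag H i))
    (h' : hom (diag G (projT1 p')) (diag H i')) :
  pre_eq p p' -> b (projT1 p) = colim_cls h -> b (projT1 p') = colim_cls h' ->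
  colim_cls (cmp h (projT2 p)) = colim_cls (cmp h' (projT2 p')).
Proof.
move=> pp'; elim: pp' i i' h h' => {p p'} [p p' []|p|p p' _ IH|p q r _ IH1 _ IH2].
- move=> e e' u g i i' h h' bh bh' /=; rewrite cmpA.
  by apply: colim_cls_precomp; apply: ind_hom_step bh bh'.
- by move=> i i' h h' -> /(colim_cls_precomp (projT2 p)).
- by move=> i i' h h' bh bh'; rewrite (IH _ _ _ _ bh' bh).
move=> i i' h h' bh bh'; have [j [l bl]] := colim_cls_surj (b (projT1 q)).
by rewrite (IH1 _ _ _ _ bh bl) (IH2 _ _ _ _ bl bh').
Qed.

Lemma colim_post_ex x G H (b : ind_hom G H) (a : colim_hom x G) :
  exists y : colim_hom x H, forall e (g : hom x (diag G e)) i
    (h : hom (diag G e) (diag H i)),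
    a = colim_cls g -> b e = colim_cls h -> y = colim_cls (cmp h g).
Proof.
have [e [g ->]] := colim_cls_surj a; have [i [h bh]] := colim_cls_surj (b e).
exists (colim_cls (cmp h g)) => e' g' i' h' /colim_clsP gg' bh'.
exact: (colim_post_eq gg' bh bh').
Qed.

(* The composite of a with b, computed on representatives. *)
Definition colim_post x G H (b : ind_hom G H) (a : colim_hom x G) : colim_hom x H :=
  projT1 (cid (colim_post_ex b a)).

Lemma colim_post_cls x G H (b : ind_hom G H) e (g : hom x (diag G e)) i
    (h : hom (diag G e) (diag H i)) :
  b e = colim_cls h -> colim_post b (colim_cls g) = colim_cls (cmp h g).
Proof. exact: (projT2 (cid (colim_post_ex b (colim_cls g)))). Qed.

Lemma ind_comp_compat F G H (b : ind_hom G H) (a : ind_hom F G) d d'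
    (u : hom d d') i (h : hom (diag F d') (diag H i)) :
  colim_post b (a d') = colim_cls h ->
  colim_post b (a d) = colim_cls (cmp h (fmap (diag F) u)).
Proof.
have [e [g ag]] := colim_cls_surj (a d').
have [j [l bl]] := colim_cls_surj (b e).
rewrite (ih_compat u ag) ag !(colim_post_cls _ bl) cmpA.
exact: colim_cls_precomp.
Qed.

Definition ind_comp F G H (b : ind_hom G H) (a : ind_hom F G) : ind_hom F H :=
  @IndHom F H (fun d => colim_post b (a d)) (@ind_comp_compat F G H b a).

Lemma ind_comp_id_l F G (a : ind_hom F G) : ind_comp (ind_id G) a = a.
Proof.
apply: ind_hom_ext => d /=; have [e [g ->]] := colim_cls_surj (a d).
by rewrite (@colim_post_cls _ _ _ (ind_id G) _ _ _ (idm _)) ?cmp_id_l.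
Qed.

Lemma ind_comp_id_r F G (a : ind_hom F G) : ind_comp a (ind_id F) = a.
Proof.
apply: ind_hom_ext => d /=; have [e [g ag]] := colim_cls_surj (a d).
by rewrite (colim_post_cls _ ag) cmp_id_r.
Qed.

Lemma ind_compA F G H I (c : ind_hom H I) (b : ind_hom G H) (a : ind_hom F G) :
  ind_comp c (ind_comp b a) = ind_comp (ind_comp c b) a.
Proof.
apply: ind_hom_ext => d /=; have [e [g ->]] := colim_cls_surj (a d).
have [i [h bh]] := colim_cls_surj (b e).
have [j [l cl]] := colim_cls_surj (c i).
rewrite (colim_post_cls _ bh) (colim_post_cls _ cl) cmpA.
have cbl : ind_comp c b e = colim_cls (cmp l h) by rewrite /= bh (colim_post_cls _ cl).
by rewrite (colim_post_cls _ cbl).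
Qed.

(* ind(C) *)
Definition ind : category := Category ind_comp_id_l ind_comp_id_r ind_compA.

End Ind.

(** * Colimits *)

Section Colimits.
Variables (A B : category) (J : functor A B).

Definition is_cocone (F : ind_obj A) (X : B) (c : forall d : idx F, hom (J (diag F d)) X) :=
  forall (d d' : idx F) (u : hom d d'), cmp (c d') (fmap J (fmap (diag F) u)) = c d.

Definition is_colimit (F : ind_obj A) (X : B) (c : forall d : idx F, hom (J (diag F d)) X) :=
  is_cocone c /\
  forall (Y : B) (t : forall d : idx F, hom (J (diag F d)) Y), is_cocone t ->
    exists! h : hom X Y, forall d, cmp h (c d) = t d.

(* A functorial choice of colimit in B of the filtered diagrams in A. *)
Record colim_functor := ColimFunctor {
  cf :> functor (ind A) B;
  cf_cocone : forall (F : ind A) (d : idx F), hom (J (diag F d)) (cf F);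
  cf_colimit : forall F : ind A, is_colimit (@cf_cocone F);
  cf_map : forall (F G : ind A) (a : hom F G) (d : idx F) (e : idx G)
    (g : hom (diag F d) (diag G e)),
    ih_comp a d = colim_cls g ->
    cmp (fmap cf a) (cf_cocone d) = cmp (cf_cocone e) (fmap J g) }.

End Colimits.

(** * Conilpotent Lie coalgebras *)

Section Conil.
Variables (K : fieldType) (C : cooperad_maps K).

Lemma coalg_id_l (V W : coalg C) (f : coalg_hom V W) : coalg_comp (coalg_id W) f = f.
Proof. exact: coalg_hom_ext. Qed.
Lemma coalg_id_r (V W : coalg C) (f : coalg_hom V W) : coalg_comp f (coalg_id V) = f.
Proof. exact: coalg_hom_ext. Qed.
Lemma coalg_compA (V W X Y : coalg C) (h : coalg_hom X Y) (g : coalg_hom W X)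
    (f : coalg_hom V W) :
  coalg_comp h (coalg_comp g f) = coalg_comp (coalg_comp h g) f.
Proof. exact: coalg_hom_ext. Qed.

Definition conil_cat : category := Category coalg_id_l coalg_id_r coalg_compA.

(* The full subcategory of the objects of finite total dimension. *)
Record fd_coalg := FdCoalg {
  fd_val :> coalg C;
  fd_valP : finite_dim fd_val }.

Definition fd_conil_cat : category :=
  @Category fd_coalg (fun V W => @coalg_hom K C V W) (fun V => coalg_id V)
    (fun V W X g f => coalg_comp g f) (fun V W f => coalg_id_l f)
    (fun V W f => coalg_id_r f) (fun V W X Y h g f => coalg_compA h g f).

Definition fd_incl : functor fd_conil_cat conil_cat :=
  @Functor fd_conil_cat conil_cat fd_val (fun V W f => f)
    (fun V => erefl) (fun V W X g f => erefl).

Definition subm (V : lmodType K) (S : submodClosed V) : Type := {x : V | x \in S}.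
HB.instance Definition _ (V : lmodType K) (S : submodClosed V) :=
  SubType.copy (subm S) {x : V | x \in S}.
HB.instance Definition _ (V : lmodType K) (S : submodClosed V) :=
  [Choice of subm S by <:].
HB.instance Definition _ (V : lmodType K) (S : submodClosed V) :=
  [SubChoice_isSubLmodule of subm S by <:].

(* A finite dimensional sub-coalgebra of V: a graded subspace with a structure
   of coalgebra for which the inclusion is a morphism. *)
Record fd_sub (V : coalg C) := FdSub {
  fs_sub : forall k, submodClosed (V k);
  fs_on : coalg_on C (fun k => subm (fs_sub k));
  fs_incl : coalg_hom (Coalg fs_on) V;
  fs_inclE : forall k (w : subm (fs_sub k)), fs_incl k w = val w;
  fs_fd : finite_dim (fun k => subm (fs_sub k)) }.

Definition fs_val (V : coalg C) (W : fd_sub V) : fd_coalg :=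
  @FdCoalg (Coalg (fs_on W)) (fs_fd W).

(* The morphisms W -> W' over V; since W and W' are subspaces of V, the only
   possible one is the inclusion of W in W'. *)
Definition fs_hom (V : coalg C) (W W' : fd_sub V) : Type :=
  {j : coalg_hom (fs_val W) (fs_val W') | coalg_comp (fs_incl W') j = fs_incl W}.

Section SubCategory.
Variable V : coalg C.

Lemma fs_hom_ext (W W' : fd_sub V) (f g : fs_hom W W') : sval f = sval g -> f = g.
Proof. by case: f g => [f ?] [g ?] /= fg; apply: eq_exist. Qed.

Definition fs_id (W : fd_sub V) : fs_hom W W :=
  exist _ (coalg_id (fs_val W)) (coalg_id_r (fs_incl W)).

Lemma fs_comp_subproof (W W' W'' : fd_sub V) (g : fs_hom W' W'') (f : fs_hom W W') :
  coalg_comp (fs_incl W'') (coalg_comp (sval g) (sval f)) = fs_incl W.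
Proof. by case: f g => [f Ef] [g Eg] /=; rewrite coalg_compA Eg. Qed.

Definition fs_comp (W W' W'' : fd_sub V) (g : fs_hom W' W'') (f : fs_hom W W') :
    fs_hom W W'' :=
  exist _ (coalg_comp (sval g) (sval f)) (fs_comp_subproof g f).

Lemma fs_id_l (W W' : fd_sub V) (f : fs_hom W W') : fs_comp (fs_id W') f = f.
Proof. exact/fs_hom_ext/coalg_id_l. Qed.
Lemma fs_id_r (W W' : fd_sub V) (f : fs_hom W W') : fs_comp f (fs_id W) = f.
Proof. exact/fs_hom_ext/coalg_id_r. Qed.
Lemma fs_compA (W W' X Y : fd_sub V) (h : fs_hom X Y) (g : fs_hom W' X) (f : fs_hom W W') :
  fs_comp h (fs_comp g f) = fs_comp (fs_comp h g) f.
Proof. exact/fs_hom_ext/coalg_compA. Qed.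

(* The finite dimensional sub-coalgebras of V, ordered by inclusion. *)
Definition fs_cat : small_category := SmallCategory fs_id_l fs_id_r fs_compA.

Definition fs_diag : functor fs_cat fd_conil_cat :=
  @Functor fs_cat fd_conil_cat (@fs_val V) (fun W W' f => sval f)
    (fun W => erefl) (fun W X Y g f => erefl).

End SubCategory.

(* The value of delta at V: the diagram of the finite dimensional sub-coalgebras. *)
Definition delta_obj (Hf : forall V : coalg C, filtered (fs_cat V)) (V : coalg C) :
    ind_obj fd_conil_cat :=
  IndObj (fs_diag V) (Hf V).

(* The functor delta; on a morphism f : V -> V', the component at W is the class of
   the restriction W -> W' of f, for any W' that contains f(W). *)
Record delta_functor := DeltaFunctor {
  df_filtered : forall V : coalg C, filtered (fs_cat V);
  df_map : forall V V' : coalg C, coalg_hom V V' ->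
    ind_hom (delta_obj df_filtered V) (delta_obj df_filtered V');
  df_map_id : forall V, df_map (coalg_id V) = ind_id (delta_obj df_filtered V);
  df_map_comp : forall V V' V'' (g : coalg_hom V' V'') (f : coalg_hom V V'),
    df_map (coalg_comp g f) = ind_comp (df_map g) (df_map f);
  df_mapE : forall V V' (f : coalg_hom V V') (W : fd_sub V) (W' : fd_sub V')
    (g : coalg_hom (fs_val W) (fs_val W')),
    coalg_comp (fs_incl W') g = coalg_comp f (fs_incl W) ->
    df_map f W = colim_cls (G := delta_obj df_filtered V') (e := W') g }.

Definition delta (D : delta_functor) : functor conil_cat (ind fd_conil_cat) :=
  @Functor conil_cat (ind fd_conil_cat) (delta_obj (@df_filtered D)) (@df_map D)
    (df_map_id D) (@df_map_comp D).

End Conil.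

(* Main.v *)
(* The equivalence rests on two facts.

   (1) Every element of a conilpotent coalgebra V lies in a finite dimensional
   sub-coalgebra, so that V is the filtered colimit of these. Let F be a finite
   dimensional graded subspace, stable under d, and let T be the set of the s in F such
   that all the decompositions of s are tensors over F. For v in T, decompose v and then
   its i-th factor: by coassociativity the result is again a tensor over F, so the i-th
   factor of the decomposition of v lies in the common kernel T of the maps s |->
   (decomposition of s modulo tensors over F). Hence the decompositions of v are tensors
   over T, and T is a sub-coalgebra. Taking for F the span of v, of the entries of its
   finitely many non-zero decompositions, and of their differentials, v lies in T.

   (2) A finite dimensional coalgebra W is compact: a morphism h from W to a filtered
   colimit X of finite dimensional coalgebras Y_d factors through some Y_e. Indeed h(W)
   lies in the image of some c_d : Y_d -> X, and some transition map u : Y_d -> Y_e has the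
   same kernel as c_d. A linear map q with c_d q c_d = c_d then gives the factorization
   u q h, which is a morphism because u q c_d = u.

   Colimits of coalgebras are computed on the underlying modules; with (2) the functor
   colim is fully faithful, with (1) colim delta is isomorphic to the identity, and the
   other isomorphism follows formally. *)
From HB Require Import structures.
From mathcomp Require Import all_boot all_order all_fingroup all_algebra.
From mathcomp Require Import boolp zify.
From mathcomp Require classical_sets.
Require Import Defs.

Set Implicit Arguments.
Unset Strict Implicit.
Unset Printing Implicit Defensive.

Import GRing.Theory.
Local Open Scope ring_scope.

(** * Linear algebra *)

Section LinearFunctions.
Variables (K : fieldType) (U V : lmodType K) (f : U -> V).
Hypothesis fl : linear f.

Lemma lin0 : f 0 = 0.
Proof. by have := fl (-1) 0 0; rewrite scaler0 addr0 => {1}->; rewrite scaleN1r addNr. Qed.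
Lemma linD x y : f (x + y) = f x + f y.
Proof. by have := fl 1 x y; rewrite !scale1r. Qed.
Lemma linZ c x : f (c *: x) = c *: f x.
Proof. by have := fl c x 0; rewrite lin0 !addr0. Qed.
Lemma linB x y : f (x - y) = f x - f y.
Proof. by rewrite -scaleN1r addrC fl scaleN1r addrC. Qed.
Lemma lin_sum I (s : seq I) (P : pred I) (F : I -> U) :
  f (\sum_(i <- s | P i) F i) = \sum_(i <- s | P i) f (F i).
Proof. exact: (big_morph f linD lin0). Qed.
End LinearFunctions.

Lemma lin_comp (K : fieldType) (U V W : lmodType K) (g : V -> W) (f : U -> V) :
  linear g -> linear f -> linear (g \o f).
Proof. by move=> gl fl c x y /=; rewrite fl gl. Qed.

Lemma lin_id (K : fieldType) (U : lmodType K) : linear (fun x : U => x).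
Proof. by []. Qed.

(** * Complements and generalized inverses *)

Section PseudoInverse.
Variable K : fieldType.

Definition subspace (V : lmodType K) (P : V -> Prop) : Prop :=
  P 0 /\ forall c x y, P x -> P y -> P (c *: x + y).

Lemma complement_ex (V : lmodType K) (P : V -> Prop) : subspace P ->
  exists Q : V -> Prop, [/\ subspace Q, forall x, P x -> Q x -> x = 0 &
    forall x, exists y, P y /\ Q (x - y)].
Proof.
move=> [P0 Pl].
(* Membership of 0 is not part of [good], so that the union of the empty chain is allowed in Zorn's
   lemma; [Q0] recovers it from maximality. *)
pose good (Q : V -> Prop) := (forall c x y, Q x -> Q y -> Q (c *: x + y)) /\
  forall x, P x -> Q x -> x = 0.
have [|Q [[Ql QP] Qmax]] := @classical_sets.Zorn_bigcup V good.
  move=> F Fg tot; split.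
    move=> c x y [A FA Ax] [B FB By].
    case: (tot A B FA FB) => AB.
      by exists B => //; apply: (Fg B FB).1 => //; apply: AB.
    by exists A => //; apply: (Fg A FA).1 => //; apply: AB.
  by move=> x Px [A FA Ax]; apply: (Fg A FA).2.
have ext (R : V -> Prop) : good R -> (forall x, Q x -> R x) -> forall x, R x -> Q x.
  move=> gR QR x Rx; apply: contrapT => Qx; apply: (Qmax R) => //.
  by split=> [y /QR //|/(_ x Rx)].
have Q0 : Q 0.
  apply: (ext (fun x => x = 0 \/ Q x)); [|by move=> x; right|by left].
  split.
    move=> c x y [->|Qx] [->|Qy]; rewrite ?scaler0 ?add0r ?addr0; [by left|by right| |by right; apply: Ql].
    have [->|c0] := eqVneq c 0; first by left; rewrite scale0r.
    have Qz : Q 0 by have := Ql (-1) x x Qx Qx; rewrite scaleN1r addNr.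
    by right; have := Ql c x 0 Qx Qz; rewrite addr0.
  by move=> x Px [//|Qx]; apply: QP.
exists Q; split=> // x; apply: contrapT => nx.
have nx' y : P y -> ~ Q (x - y) by move=> Py Qy; apply: nx; exists y.
(* [R] is Q + Kx. If x is not in P + Q, then [R] still meets P in 0 only, so maximality puts x into
   Q, which contradicts [nx'] at y = 0. *)
pose R z := exists c : K, Q (z - c *: x).
suff Rx : Q x by apply: (nx' 0) => //; rewrite subr0.
apply: (ext R); last by exists 1; rewrite scale1r subrr.
  split.
    move=> c u v [a Qa] [b Qb]; exists (c * a + b).
    have -> : c *: u + v - (c * a + b) *: x = c *: (u - a *: x) + (v - b *: x).
      by rewrite scalerDl scalerBr scalerA addrACA opprD.
    exact: Ql.
  move=> z Pz [c Qz]; have [c0|c0] := eqVneq c 0.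
    by apply: QP => //; move: Qz; rewrite c0 scale0r subr0.
  exfalso; apply: (nx' (c^-1 *: z)).
    by have := Pl c^-1 z 0 Pz P0; rewrite addr0.
  have := Ql (- c^-1) _ 0 Qz Q0.
  by rewrite addr0 scalerBr !scaleNr scalerA mulVf // scale1r opprK addrC.
by move=> z Qz; exists 0; rewrite scale0r subr0.
Qed.

Lemma subspaceB (V : lmodType K) (P : V -> Prop) x y :
  subspace P -> P x -> P y -> P (x - y).
Proof. by move=> [_ Pl] Px Py; rewrite addrC -scaleN1r; apply: Pl. Qed.

(** With a complement Q of the kernel and a complement R of the image, w goes to the unique v in Q
    such that w - f v lies in R. Such g provide all the retractions, projections and sections used
    below. *)
Lemma linear_pinv (V W : lmodType K) (f : V -> W) : linear f ->
  exists g : W -> V, linear g /\ forall x, f (g (f x)) = f x.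
Proof.
move=> fl.
have [|Q [Qs QP Qe]] := @complement_ex V (fun x => f x = 0).
  by split=> [|c x y fx fy]; [exact: lin0|rewrite fl fx fy scaler0 addr0].
have [|R [Rs RP Re]] := @complement_ex W (fun y => exists x, y = f x).
  split=> [|c _ _ [x ->] [y ->]]; first by exists 0; rewrite lin0.
  by exists (c *: x + y); rewrite fl.
pose S w v := Q v /\ R (w - f v).
have Sex w : exists v, S w v.
  have [_ [[x ->] Rx]] := Re w; have [y [fy Qy]] := Qe x.
  by exists (x - y); split=> //; rewrite linB // fy subr0.
have Suniq w v v' : S w v -> S w v' -> v = v'.
  move=> [Qv Rv] [Qv' Rv'].
  have Qvv' := subspaceB Qs Qv Qv'.
  suff : v - v' = 0 by move/eqP; rewrite subr_eq0 => /eqP.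
  apply: QP => //; rewrite linB //.
  apply: RP; first by exists (v - v'); rewrite linB.
  have := subspaceB Rs Rv' Rv.
  by rewrite opprB addrC addrA subrK.
have [g gS] := choice Sex.
exists g; split.
  move=> c x y; apply: (Suniq (c *: x + y)) => //.
  have [Qx Rx] := gS x; have [Qy Ry] := gS y; split; first exact: Qs.2.
  by rewrite fl opprD addrACA -scalerBr; apply: Rs.2.
move=> x; have [_ Rg] := gS (f x).
suff : f x - f (g (f x)) = 0 by move/eqP; rewrite subr_eq0 => /eqP.
by apply: RP => //; exists (x - g (f x)); rewrite linB.
Qed.

Lemma graded_pinv (V W : int -> lmodType K) (f : forall k, V k -> W k) :
  (forall k, linear (@f k)) ->
  exists g : forall k, W k -> V k,
    (forall k, linear (@g k)) /\ forall k x, f k (g k (f k x)) = f k x.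
Proof.
move=> fl; pose g k := projT1 (cid (linear_pinv (fl k))).
by exists g; split=> k; have [] := projT2 (cid (linear_pinv (fl k))).
Qed.

End PseudoInverse.

(** * Tensor powers *)

Section TensorExt.
Variable K : fieldType.

Lemma tens_tpow_ext (A : lmodType K) (V : int -> lmodType K) n (W : lmodType K)
    (g h : tens A (tpow V n) -> W) : linear g -> linear h ->
  (forall a t, g (pure a (tprod t)) = h (pure a (tprod t))) -> g =1 h.
Proof.
move=> gl hl gh; apply: pres_ext => // -[a x]; rewrite -/(pure a x).
apply: (@pres_ext _ _ _ _ (fun x => g (pure a x)) (fun x => h (pure a x))) => //.
- by move=> c y z; rewrite pure_r gl.
- by move=> c y z; rewrite pure_r hl.
exact: gh.
Qed.

(** * Maps of tensor powers given position by position *)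

Section MixedMaps.
Variables (V W : int -> lmodType K) (n : nat).

(** Coassociativity concerns one letter at a time, hence a separate map for each position. *)
Definition tpow_fam (f : 'I_n -> forall k, V k -> W k) : tpow V n -> tpow W n :=
  linext (fun t : n.-tuple (hel V) =>
    tprod [tuple helem (f j _ (tagged (tnth t j))) | j < n]).

Variable f : 'I_n -> forall k, V k -> W k.
Hypothesis fl : forall j k, linear (@f j k).

Lemma fam_upd t i k (u : V k) :
  [tuple helem (f j (tagged (tnth (upd t i (helem u)) j))) | j < n] =
  upd [tuple helem (f j (tagged (tnth t j))) | j < n] i (helem (f i u)).
Proof.
by apply: eq_from_tnth => j; rewrite !tnth_mktuple; case: eqP => // ->.
Qed.

Lemma tpow_fam_mult t i k c (u v : V k) :
  tprod [tuple helem (f j (tagged (tnth (upd t i (helem (c *: u + v))) j))) | j < n] =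
  c *: tprod [tuple helem (f j (tagged (tnth (upd t i (helem u)) j))) | j < n] +
  tprod [tuple helem (f j (tagged (tnth (upd t i (helem v)) j))) | j < n].
Proof. by rewrite !fam_upd fl tprod_upd. Qed.

Lemma tpow_fam_linear : linear (tpow_fam f).
Proof. exact/tpow_linear/tpow_fam_mult. Qed.

Lemma tpow_fam_tprod t :
  tpow_fam f (tprod t) = tprod [tuple helem (f j (tagged (tnth t j))) | j < n].
Proof. exact/tpow_tprod/tpow_fam_mult. Qed.

End MixedMaps.

Lemma tpow_mapE (V W : int -> lmodType K) n (f : forall k, V k -> W k) :
  (forall k, linear (f k)) -> tpow_map f n =1 tpow_fam (fun _ : 'I_n => f).
Proof.
move=> fl; apply: pres_ext => [||t]; [exact: tpow_map_linear|exact: tpow_fam_linear|].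
rewrite [LHS]tpow_map_tprod // [RHS]tpow_fam_tprod //; congr tprod.
by apply: eq_from_tnth => j; rewrite tnth_map tnth_mktuple.
Qed.

Lemma tpow_fam_comp (U V W : int -> lmodType K) n
    (f : 'I_n -> forall k, U k -> V k) (g : 'I_n -> forall k, V k -> W k) x :
  (forall j k, linear (f j k)) -> (forall j k, linear (g j k)) ->
  tpow_fam g (tpow_fam f x) = tpow_fam (fun j k y => g j k (f j k y)) x.
Proof.
move=> fl gl.
have gfl j k : linear (fun y => g j k (f j k y)) by move=> c y z; rewrite fl gl.
move: x; apply: pres_ext => [c x y||t]; [|exact: tpow_fam_linear|].
  by rewrite !tpow_fam_linear.
rewrite -/(tprod t) !tpow_fam_tprod //; congr tprod.
by apply: eq_from_tnth => j; rewrite !tnth_mktuple.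
Qed.

Lemma eq_tpow_fam (V W : int -> lmodType K) n (f g : 'I_n -> forall k, V k -> W k) :
  (forall j k v, f j k v = g j k v) -> tpow_fam f = tpow_fam g.
Proof.
move=> fg; congr tpow_fam; apply: functional_extensionality_dep => j.
by apply: functional_extensionality_dep => k; apply: funext.
Qed.

Definition at_pos (V : int -> lmodType K) n (i : 'I_n) (f g : forall k, V k -> V k) :
    'I_n -> forall k, V k -> V k :=
  fun j => if j == i then f else g.

Section TensorOnTheLeft.
Variable A : lmodType K.

Definition idt (B B' : lmodType K) (f : B -> B') : tens A B -> tens A B' := tens_map id f.

Lemma idt_linear (B B' : lmodType K) (f : B -> B') : linear f -> linear (idt f).
Proof. exact: tens_map_linear. Qed.

Lemma idt_pure (B B' : lmodType K) (f : B -> B') a b : linear f ->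
  idt f (pure a b) = pure a (f b).
Proof. by move=> fl; rewrite /idt tens_map_pure. Qed.

Lemma idt_comp (B B' B'' : lmodType K) (g : B' -> B'') (f : B -> B') x :
  linear f -> linear g -> idt g (idt f x) = idt (g \o f) x.
Proof. by move=> fl gl; rewrite /idt -[LHS]/((_ \o _) x) tens_map_comp. Qed.

Lemma idt_id (B : lmodType K) (f : B -> B) x : f =1 id -> idt f x = x.
Proof. by move=> fi; rewrite /idt tens_map_id. Qed.
End TensorOnTheLeft.

End TensorExt.

(** * Insertion of a word in place of a letter *)

Section Tuples.
Variables (K : fieldType) (V : int -> lmodType K).

Lemma tnth_upd n (t : n.-tuple (hel V)) i x j :
  tnth (upd t i x) j = if j == i then x else tnth t j.
Proof. by rewrite tnth_mktuple. Qed.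

Lemma upd_upd n (t : n.-tuple (hel V)) i x y : upd (upd t i x) i y = upd t i y.
Proof. by apply: eq_from_tnth => j; rewrite !tnth_upd; case: eqP. Qed.

Lemma upd_comm n (t : n.-tuple (hel V)) i j x y : i != j ->
  upd (upd t i x) j y = upd (upd t j y) i x.
Proof.
move=> ij; apply: eq_from_tnth => l; rewrite !tnth_upd.
by case: eqP => // ->; rewrite eq_sym (negPf ij).
Qed.

Lemma upd_id n (t : n.-tuple (hel V)) i : upd t i (tnth t i) = t.
Proof. by apply: eq_from_tnth => l; rewrite tnth_upd; case: eqP => // ->. Qed.

Lemma nth_upd x0 n (t : n.-tuple (hel V)) (i : 'I_n) x j : (j < n)%N ->
  nth x0 (upd t i x) j = if j == i then x else nth x0 t j.
Proof.
move=> jn; have := tnth_upd t i x (Ordinal jn).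
by rewrite (tnth_nth x0) [in RHS](tnth_nth x0).
Qed.

Lemma deg_upd n (t : n.-tuple (hel V)) i x y j : deg x = deg y ->
  deg (tnth (upd t i x) j) = deg (tnth (upd t i y) j).
Proof. by move=> xy; rewrite !tnth_upd; case: eqP. Qed.

Lemma tdeg_upd n (t : n.-tuple (hel V)) i x y : deg x = deg y ->
  tdeg (upd t i x) = tdeg (upd t i y).
Proof. by move=> xy; apply: eq_bigr => j _; apply: deg_upd. Qed.

Lemma helemK (x : hel V) : helem (tagged x) = x.
Proof. by case: x. Qed.

Local Ltac tins_tac :=
  do ?[case: ifP => /= ?]; rewrite ?nth_upd /=; try lia;
  do ?[case: ifP => /= ?]; try lia; try done; congr nth; lia.

Section Insertion.
Variables (n m : nat) (i : 'I_n.+1).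
Implicit Types (t : n.+1.-tuple (hel V)) (w : m.-tuple (hel V)).

Lemma nth_tins x0 t w j :
  nth x0 (tins i t w) j =
  if (j < i)%N then nth x0 t j
  else if (j < i + m)%N then nth x0 w (j - i) else nth x0 t (j - m).+1.
Proof.
have iin := ltn_ord i.
rewrite /= nth_cat size_take size_tuple iin; case: ifP => ji.
  by rewrite nth_take.
rewrite nth_cat size_tuple; have -> : (j - i < m)%N = (j < i + m)%N by lia.
case: ifP => // jm; rewrite nth_drop; congr nth; lia.
Qed.

Lemma tins_upd t w x : tins i (upd t i x) w = tins i t w.
Proof.
have iin := ltn_ord i.
apply: eq_from_tnth => j; have jnm := ltn_ord j; rewrite !(tnth_nth x) !nth_tins.
by tins_tac.
Qed.

(** A position of the combined word comes either from the inserted word or from a letter of the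
    outer word other than the i-th. This reduces multilinearity in the combined word to that in its
    two parts. *)
Lemma tins_pos (p : 'I_(n + m)) :
  (exists l, forall t w y, upd (tins i t w) p y = tins i t (upd w l y)) \/
  (exists2 l, l != i & forall t w y, upd (tins i t w) p y = tins i (upd t l y) w).
Proof.
have iin := ltn_ord i; have pnm := ltn_ord p.
have [pi|ip] := ltnP p i.
  have pn : (p < n.+1)%N by lia.
  right; exists (Ordinal pn); first by rewrite -val_eqE /=; lia.
  move=> t w y; apply: eq_from_tnth => j; have jnm := ltn_ord j.
  rewrite !(tnth_nth y) nth_upd // !nth_tins.
by tins_tac.
have [pim|imp] := ltnP p (i + m).
  have pm : (p - i < m)%N by lia.
  left; exists (Ordinal pm) => t w y; apply: eq_from_tnth => j; have jnm := ltn_ord j.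
  rewrite !(tnth_nth y) nth_upd // !nth_tins.
by tins_tac.
have pn : ((p - m).+1 < n.+1)%N by lia.
right; exists (Ordinal pn); first by rewrite -val_eqE /=; lia.
move=> t w y; apply: eq_from_tnth => j; have jnm := ltn_ord j.
rewrite !(tnth_nth y) nth_upd // !nth_tins.
by tins_tac.
Qed.

Lemma upd_tins_word w l : exists p, forall t y,
  tins i t (upd w l y) = upd (tins i t w) p y.
Proof.
have iin := ltn_ord i; have lm := ltn_ord l.
have pn : (i + l < n + m)%N by lia.
exists (Ordinal pn) => t y; apply: eq_from_tnth => j; have jnm := ltn_ord j.
rewrite !(tnth_nth y) nth_upd // !nth_tins.
by tins_tac.
Qed.

Lemma upd_tins_out t l : l != i -> exists p, forall w y,
  tins i (upd t l y) w = upd (tins i t w) p y.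
Proof.
rewrite -val_eqE /= => li; have iin := ltn_ord i; have ln := ltn_ord l.
have [p pE] : exists p : 'I_(n + m), p = (if (l < i)%N then (l : nat) else (l + m).-1) :> nat.
  have pn : ((if (l < i)%N then (l : nat) else (l + m).-1) < n + m)%N by case: ifP; lia.
  by exists (Ordinal pn).
exists p => w y; apply: eq_from_tnth => j; have jnm := ltn_ord j.
rewrite !(tnth_nth y) nth_upd // !nth_tins pE.
by case: (ltnP l i) => ?; tins_tac.
Qed.

(* [out_word] and [in_word] recover the two arguments of [tins i], up to the i-th entry
   of the first one, which is lost by [tins i]. *)
Definition out_word (u : (n + m).-tuple (hel V)) (x : hel V) : n.+1.-tuple (hel V) :=
  [tuple if j == i then x else nth x u (if (j < i)%N then j : nat else (j + m).-1) | j < n.+1].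

Definition in_word (u : (n + m).-tuple (hel V)) : m.-tuple (hel V) :=
  [tuple nth (helem (0 : V 0)) u (i + l) | l < m].

Lemma out_word_tins t w x : out_word (tins i t w) x = upd t i x.
Proof.
have iin := ltn_ord i.
apply: eq_from_tnth => j; have jnm := ltn_ord j; rewrite tnth_upd tnth_mktuple.
rewrite -val_eqE; case: eqP => //= ij; rewrite [RHS](tnth_nth x) -/(tins i t w) nth_tins.
have [ji|ij'] := ltnP j i; first by rewrite ji.
do 2?[case: ifP; first by lia]; move=> *; congr nth; lia.
Qed.

Lemma in_word_tins t w : in_word (tins i t w) = w.
Proof.
apply: eq_from_tnth => l; have lm := ltn_ord l; rewrite tnth_mktuple nth_tins.
case: ifP; first by lia.
case: ifP; last by lia.
by rewrite (tnth_nth (helem (0 : V 0))) => *; congr nth; lia.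
Qed.

Lemma tins_surj u x : u = tins i (out_word u x) (in_word u).
Proof.
have iin := ltn_ord i.
apply: eq_from_tnth => j; have jnm := ltn_ord j; rewrite !(tnth_nth x) nth_tins.
case: ifP => [ji|ji].
  have jn : (j < n.+1)%N by lia.
  rewrite -(tnth_nth x (out_word u x) (Ordinal jn)) tnth_mktuple -val_eqE /= ji.
  by case: eqP => //; lia.
case: ifP => [jm|jm].
  have jn : (j - i < m)%N by lia.
  rewrite -(tnth_nth x (in_word u) (Ordinal jn)) tnth_mktuple /=.
  by rewrite subnKC ?(set_nth_default x) ?size_tuple //; lia.
have jn : ((j - m).+1 < n.+1)%N by lia.
rewrite -(tnth_nth x (out_word u x) (Ordinal jn)) tnth_mktuple -val_eqE /=.
case: eqP => [|_]; first by lia.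
case: ifP; first by lia.
by move=> *; congr nth; lia.
Qed.

End Insertion.
End Tuples.

(** * Differential, permutations and counit on tensor powers *)

Section TpowDifferential.
Variables (K : fieldType) (V : int -> lmodType K) (d : forall k, V k -> V (k - 1)).
Hypothesis dl : forall k, linear (@d k).
Variable n : nat.

Lemma tpow_d_mult (t : n.-tuple (hel V)) i k c (u v : V k) :
  let F (t : n.-tuple (hel V)) := \sum_(i < n)
    sign K (\sum_(j < n | (j < i)%N) deg (tnth t j)) *:
      tprod (upd t i (helem (d (tagged (tnth t i))))) in
  F (upd t i (helem (c *: u + v))) = c *: F (upd t i (helem u)) + F (upd t i (helem v)).
Proof.
move=> F; rewrite /F scaler_sumr -big_split /=; apply: eq_bigr => j _.
(* The Koszul sign sees degrees only, and u, v and c u + v have the same degree. *)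
have degE x : deg x = k -> \sum_(l < n | (l < j)%N) deg (tnth (upd t i x) l) =
    \sum_(l < n | (l < j)%N) deg (tnth (upd t i (helem u)) l).
  by move=> xk; apply: eq_bigr => l _; apply: deg_upd.
rewrite !(degE (helem _)) //; set s := sign _ _.
rewrite scalerA [c * s]mulrC -scalerA -scalerDr; congr (_ *: _).
have [->|ij] := eqVneq i j.
  by rewrite !tnth_upd eqxx !upd_upd /= dl tprod_upd.
rewrite !tnth_upd eq_sym (negPf ij) !(upd_comm _ _ _ ij).
exact: tprod_upd.
Qed.

Lemma tpow_d_linear : linear (tpow_d (n := n) d).
Proof. exact/tpow_linear/tpow_d_mult. Qed.

Lemma tpow_d_tprod t : tpow_d d (tprod t) = \sum_(i < n)
    sign K (\sum_(j < n | (j < i)%N) deg (tnth t j)) *: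
      tprod (upd t i (helem (d (tagged (tnth t i))))).
Proof. exact/tpow_tprod/tpow_d_mult. Qed.

End TpowDifferential.

Lemma tpow_d_map (K : fieldType) (V W : int -> lmodType K) n
    (dV : forall k, V k -> V (k - 1)) (dW : forall k, W k -> W (k - 1))
    (f : forall k, V k -> W k) (x : tpow V n) :
  (forall k, linear (dV k)) -> (forall k, linear (dW k)) -> (forall k, linear (f k)) ->
  (forall k v, f (k - 1) (dV k v) = dW k (f k v)) ->
  tpow_d dW (tpow_map f n x) = tpow_map f n (tpow_d dV x).
Proof.
move=> dVl dWl fl fd; move: x; apply: pres_ext => [||t].
- by move=> c y z; rewrite (tpow_map_linear fl) (tpow_d_linear dWl).
- by move=> c y z; rewrite (tpow_d_linear dVl) (tpow_map_linear fl).
rewrite -/(tprod t) tpow_map_tprod // !tpow_d_tprod // lin_sum; last exact: tpow_map_linear.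
apply: eq_bigr => i _; rewrite linZ; last exact: tpow_map_linear.
rewrite tpow_map_tprod //; congr (sign K _ *: tprod _).
  by apply: eq_bigr => j _; rewrite tnth_map.
apply: eq_from_tnth => j; rewrite [RHS]tnth_map !tnth_upd; case: eqP => _.
  by rewrite tnth_map /= fd.
by rewrite tnth_map.
Qed.

(** In each summand of the differential one letter is d (p x) and the others are of the form p x, so
    p fixes them all. *)
Lemma tpow_d_proj (K : fieldType) (V : int -> lmodType K) n
    (d : forall k, V k -> V (k - 1)) (p : forall k, V k -> V k) (x : tpow V n) :
  (forall k, linear (d k)) -> (forall k, linear (p k)) ->
  (forall k v, p k (p k v) = p k v) -> (forall k v, p (k - 1) (d k (p k v)) = d k (p k v)) ->
  tpow_map p n (tpow_d d (tpow_map p n x)) = tpow_d d (tpow_map p n x).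
Proof.
move=> dl pl pp pd; move: x; apply: pres_ext => [||t].
- by move=> c y z; rewrite (tpow_map_linear pl) (tpow_d_linear dl) (tpow_map_linear pl).
- by move=> c y z; rewrite (tpow_map_linear pl) (tpow_d_linear dl).
rewrite -/(tprod t) tpow_map_tprod // !tpow_d_tprod // lin_sum; last exact: tpow_map_linear.
apply: eq_bigr => i _; rewrite linZ; last exact: tpow_map_linear.
rewrite tpow_map_tprod //; congr (_ *: tprod _).
apply: eq_from_tnth => j; rewrite [LHS]tnth_map !tnth_upd; case: eqP => _.
  by rewrite tnth_map /= pd.
by rewrite tnth_map /= pp.
Qed.

Section TpowPermutation.
Variables (K : fieldType) (V : int -> lmodType K) (n : nat) (s : 'S_n).

Lemma tpow_perm_mult (t : n.-tuple (hel V)) i k c (u v : V k) :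
  let F (t : n.-tuple (hel V)) :=
    koszul s t *: tprod [tuple tnth t (s j) | j < n] in
  F (upd t i (helem (c *: u + v))) = c *: F (upd t i (helem u)) + F (upd t i (helem v)).
Proof.
move=> F; rewrite /F.
have kE x : deg x = k -> koszul s (upd t i x) = koszul s (upd t i (helem u)).
  move=> xk; apply: eq_bigr => a _; apply: eq_bigr => b _.
  by rewrite !(@deg_upd _ _ _ t i x (helem u)).
rewrite !(kE (helem _)) //; set z := koszul _ _.
rewrite scalerA [c * z]mulrC -scalerA -scalerDr; congr (_ *: _).
have pE x : [tuple tnth (upd t i x) (s j) | j < n] =
    upd [tuple tnth t (s j) | j < n] (s^-1%g i) x.
  apply: eq_from_tnth => j; rewrite tnth_upd !tnth_mktuple.
  by rewrite -(inj_eq (@perm_inj _ s) j) permKV.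
by rewrite !pE tprod_upd.
Qed.

Lemma tpow_perm_linear : linear (@tpow_perm K V n s).
Proof. exact/tpow_linear/tpow_perm_mult. Qed.

Lemma tpow_perm_tprod (t : n.-tuple (hel V)) :
  tpow_perm s (tprod t) = koszul s t *: tprod [tuple tnth t (s j) | j < n].
Proof. exact/tpow_tprod/tpow_perm_mult. Qed.

End TpowPermutation.

Lemma tpow_perm_map (K : fieldType) (V W : int -> lmodType K) n (s : 'S_n)
    (f : forall k, V k -> W k) (x : tpow V n) : (forall k, linear (f k)) ->
  tpow_perm s (tpow_map f n x) = tpow_map f n (tpow_perm s x).
Proof.
move=> fl; move: x; apply: pres_ext => [||t].
- by move=> c y z; rewrite (tpow_map_linear fl) tpow_perm_linear.
- by move=> c y z; rewrite tpow_perm_linear (tpow_map_linear fl).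
rewrite -/(tprod t) tpow_map_tprod // !tpow_perm_tprod linZ; last exact: tpow_map_linear.
rewrite tpow_map_tprod //; congr (_ *: tprod _).
  by apply: eq_bigr => a _; apply: eq_bigr => b _; rewrite !tnth_map.
by apply: eq_from_tnth => j; rewrite !(tnth_mktuple, tnth_map).
Qed.

Section Counit.
Variables (K : fieldType) (A B : lmodType K) (e : A -> K^o).
Hypothesis el : linear e.

Definition counit_at : tens A B -> B := linext (fun p : A * B => (e p.1 : K) *: p.2).

Lemma counit_at_linear : linear counit_at.
Proof.
apply: tens_linear => /= [c a a' b|c a b b'].
  by rewrite el scalerDl scalerA.
by rewrite scalerDr !scalerA mulrC.
Qed.

Lemma counit_at_pure a b : counit_at (pure a b) = (e a : K) *: b.
Proof.
apply: tens_pure => /= [c a' a'' b'|c a' b' b''].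
  by rewrite el scalerDl scalerA.
by rewrite scalerDr !scalerA mulrC.
Qed.
End Counit.

Lemma counit_at_map (K : fieldType) (A B B' : lmodType K) (e : A -> K^o) (f : B -> B') x :
  linear e -> linear f -> counit_at e (idt f x) = f (counit_at e x).
Proof.
move=> el fl; move: x; apply: pres_ext => [||[a b]].
- by move=> c y z; rewrite (idt_linear fl) (counit_at_linear el).
- by move=> c y z; rewrite (counit_at_linear el) fl.
by rewrite -/(pure a b) idt_pure // !counit_at_pure // linZ.
Qed.

(** * Decomposing one letter of a word *)

Section Decomposition.
Variables (K : fieldType) (C : cooperad_maps K) (n m : nat) (i : 'I_n.+1).

Section Ins.
Variable V : int -> lmodType K.
Variables (a : C n.+1) (t : n.+1.-tuple (hel V)).

(** The value of [cop_at] on a pure tensor, with the decomposition of the i-th letter left as an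
    argument; see [cop_at_pure]. *)
Definition ins : tens (C m) (tpow V m) -> tens (tens (C n.+1) (C m)) (tpow V (n + m)) :=
  linext (fun q : C m * tpow V m =>
    linext (fun w : m.-tuple (hel V) => pure (pure a q.1) (tprod (tins i t w))) q.2).

Let ins1 (b : C m) (w : m.-tuple (hel V)) := pure (pure a b) (tprod (tins i t w)).

Let ins1_mult b (w : m.-tuple (hel V)) l k c (u v : V k) :
  ins1 b (upd w l (helem (c *: u + v))) =
  c *: ins1 b (upd w l (helem u)) + ins1 b (upd w l (helem v)).
Proof.
by rewrite /ins1; have [p pE] := upd_tins_word i w l; rewrite !pE tprod_upd pure_r.
Qed.

Let ins2 b : tpow V m -> _ := linext (ins1 b).

Let ins_bil :
  (forall c b b' y, ins2 (c *: b + b') y = c *: ins2 b y + ins2 b' y) *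
  (forall c b y y', ins2 b (c *: y + y') = c *: ins2 b y + ins2 b y').
Proof.
split=> [c b b' y|c b y y']; last exact/tpow_linear/ins1_mult.
move: y; apply: pres_ext => [||w].
- exact/tpow_linear/ins1_mult.
- have L b0 : linear (ins2 b0) := tpow_linear (ins1_mult b0).
  by move=> c' y z; rewrite !L !scalerDr !scalerA [c * c']mulrC addrACA.
have T b0 w' : ins2 b0 (tprod w') = ins1 b0 w' := tpow_tprod (ins1_mult b0) w'.
by rewrite -/(tprod w) !T /ins1 pure_r pure_l.
Qed.

Lemma ins_linear : linear ins.
Proof. by apply: tens_linear => *; rewrite -/(ins2 _) ins_bil. Qed.

Lemma ins_pure b w : ins (pure b (tprod w)) = pure (pure a b) (tprod (tins i t w)).
Proof.
rewrite [LHS](tens_pure (f := fun q => ins2 q.1 q.2)) => [|*|*]; last 2 first.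
- by rewrite ins_bil.
- by rewrite ins_bil.
exact/tpow_tprod/ins1_mult.
Qed.
End Ins.

Variable V : int -> lmodType K.
Implicit Types t : n.+1.-tuple (hel V).

Lemma ins_l c a a' t q : ins (c *: a + a') t q = c *: ins a t q + ins a' t q.
Proof.
move: q; apply: tens_tpow_ext => [||b w]; first exact: ins_linear.
  by move=> c' y z; rewrite !ins_linear !scalerDr !scalerA [c * c']mulrC addrACA.
by rewrite !ins_pure !pure_l.
Qed.

(** The insertion erases the i-th letter, so the linearity of [cop_at] in that letter rests on D
    alone. *)
Lemma ins_upd a t x q : ins a (upd t i x) q = ins a t q.
Proof.
move: q; apply: tens_tpow_ext => [||b w]; try exact: ins_linear.
by rewrite !ins_pure tins_upd.
Qed.

Lemma ins_mult a t l k c (u v : V k) q : l != i ->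
  ins a (upd t l (helem (c *: u + v))) q =
  c *: ins a (upd t l (helem u)) q + ins a (upd t l (helem v)) q.
Proof.
move=> li; move: q; apply: tens_tpow_ext => [||b w]; first exact: ins_linear.
  by move=> c' y z; rewrite !ins_linear !scalerDr !scalerA [c * c']mulrC addrACA.
by have [p pE] := upd_tins_out m t li; rewrite !ins_pure !pE tprod_upd pure_r.
Qed.

Section CopAt.
Variable D : forall k, V k -> tens (C m) (tpow V m).
Hypothesis Dl : forall k, linear (@D k).

Let cop1 (a : C n.+1) t := ins a t (D (tagged (tnth t i))).

Let cop1_mult a t l k c (u v : V k) :
  cop1 a (upd t l (helem (c *: u + v))) =
  c *: cop1 a (upd t l (helem u)) + cop1 a (upd t l (helem v)).
Proof.
rewrite /cop1 !tnth_upd; have [<-|il] := eqVneq i l.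
  by rewrite !ins_upd Dl ins_linear.
by rewrite ins_mult // eq_sym.
Qed.

Let cop2 b : tpow V n.+1 -> _ := linext (cop1 b).

Let cop_bil :
  (forall c b b' y, cop2 (c *: b + b') y = c *: cop2 b y + cop2 b' y) *
  (forall c b y y', cop2 b (c *: y + y') = c *: cop2 b y + cop2 b y').
Proof.
split=> [c b b' y|c b y y']; last exact/tpow_linear/cop1_mult.
move: y; apply: pres_ext => [||w].
- exact/tpow_linear/cop1_mult.
- have L b0 : linear (cop2 b0) := tpow_linear (cop1_mult b0).
  by move=> c' y z; rewrite !L !scalerDr !scalerA [c * c']mulrC addrACA.
have T b0 w' : cop2 b0 (tprod w') = cop1 b0 w' := tpow_tprod (cop1_mult b0) w'.
by rewrite -/(tprod w) !T /cop1 ins_l.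
Qed.

Lemma cop_at_linear : linear (cop_at i D).
Proof. by apply: tens_linear => *; rewrite -/(cop2 _) cop_bil. Qed.

Lemma cop_at_pure a t : cop_at i D (pure a (tprod t)) = ins a t (D (tagged (tnth t i))).
Proof.
rewrite [LHS](tens_pure (f := fun q => cop2 q.1 q.2)) => [|*|*]; last 2 first.
- by rewrite cop_bil.
- by rewrite cop_bil.
exact/tpow_tprod/cop1_mult.
Qed.
End CopAt.

End Decomposition.

Section CopAtMap.
Variables (K : fieldType) (C : cooperad_maps K) (n m : nat) (i : 'I_n.+1).

(** The i-th letter is consumed by its decomposition, so g i may differ from f as long as it matches
    f after decomposing. [defect_contract] and [core_reduction] use this freedom with g i the
    identity and with f the identity, respectively. *)
Lemma cop_at_nat (V W : int -> lmodType K) (f : forall k, V k -> W k)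
    (g : 'I_n.+1 -> forall k, V k -> W k)
    (DV : forall k, V k -> tens (C m) (tpow V m))
    (DW : forall k, W k -> tens (C m) (tpow W m)) x :
  (forall k, linear (f k)) -> (forall j k, linear (g j k)) ->
  (forall k, linear (DV k)) -> (forall k, linear (DW k)) ->
  (forall j k v, j != i -> g j k v = f k v) ->
  (forall k v, DW k (g i k v) = idt (tpow_map f m) (DV k v)) ->
  cop_at i DW (idt (tpow_fam g) x) = idt (tpow_map f (n + m)) (cop_at i DV x).
Proof.
move=> fl gl DVl DWl gf gD.
have fml k := @tpow_map_linear _ _ _ _ k fl.
have gml := tpow_fam_linear gl.
move: x; apply: tens_tpow_ext => [||a t].
- exact (lin_comp (cop_at_linear i DWl) (idt_linear gml)).
- exact (lin_comp (idt_linear (fml _)) (cop_at_linear i DVl)).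
rewrite idt_pure // tpow_fam_tprod // !cop_at_pure // tnth_mktuple /= gD.
move: (DV _ _); apply: tens_tpow_ext => [||b w].
- exact (lin_comp (ins_linear i a _) (idt_linear (fml _))).
- exact (lin_comp (idt_linear (fml _)) (ins_linear i a _)).
rewrite idt_pure // tpow_map_tprod // !ins_pure idt_pure // tpow_map_tprod //.
congr (pure _ (tprod _)).
have iin := ltn_ord i; have x0 : hel W := helem (0 : W 0).
apply: eq_from_tnth => j; have jnm := ltn_ord j.
rewrite tnth_map !(tnth_nth (helem (0 : V 0))) !(tnth_nth x0) !nth_tins.
have outE l : (l < n.+1)%N -> l != i ->
    nth x0 [tuple helem (g j _ (tagged (tnth t j))) | j < n.+1] l =
    helem (f _ (tagged (nth (helem (0 : V 0)) t l))).
  move=> ln li; rewrite -(tnth_nth x0 _ (Ordinal ln)) tnth_mktuple.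
  rewrite gf ?(tnth_nth (helem (0 : V 0))) //.
case: ifP => [ji|ji]; first by rewrite outE //; lia.
case: ifP => [jm|jm]; last by rewrite outE //; lia.
by rewrite (nth_map (helem (0 : V 0))) // size_tuple; lia.
Qed.

End CopAtMap.

(** * Homogeneous tensors and contraction of inserted words *)

Section Homogeneous.
Variables (K : fieldType) (B : lmodType K).

Definition homog (V : int -> lmodType K) n (k : int) (q : tens B (tpow V n)) : Prop :=
  exists2 s : seq (K * (B * tpow V n)), q = cls s & forall p, p \in s -> tpow_deg k p.2.2.

Variables (V : int -> lmodType K) (n : nat) (k : int).
Implicit Type q : tens B (tpow V n).

Lemma homog_subspace : subspace (@homog V n k).
Proof.
split; first by exists [::].
move=> c _ _ [s -> Hs] [t -> Ht]; exists (scale_fs c s ++ t).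
  by rewrite clsD clsZ.
by move=> p; rewrite mem_cat => /orP[/mapP[p' /Hs ? ->]|/Ht].
Qed.

(** Restricting to words of one degree k fixes which component of E enters the formula
    [contract_pure]. *)
Lemma homog_ext (W : lmodType K) (g h : tens B (tpow V n) -> W) q :
  linear g -> linear h ->
  (forall b w, tdeg w = k -> g (pure b (tprod w)) = h (pure b (tprod w))) ->
  homog k q -> g q = h q.
Proof.
move=> gl hl gh [s -> Hs]; rewrite clsE (lin_sum gl) (lin_sum hl).
rewrite big_seq [RHS]big_seq; apply: eq_bigr => -[c [b y]] /Hs /= [s' -> Hs'].
rewrite (linZ gl) (linZ hl); congr (_ *: _).
have L (f : tens B (tpow V n) -> W) : linear f -> linear (fun y => f (pure b y)).
  by move=> fl c' u v; rewrite pure_r fl.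
rewrite -/(pure b _) clsE (lin_sum (L _ gl)) (lin_sum (L _ hl)).
rewrite big_seq [RHS]big_seq; apply: eq_bigr => -[c' w] /Hs' /= wk.
by rewrite (linZ (L _ gl)) (linZ (L _ hl)) gh.
Qed.

Lemma homog_map (W : int -> lmodType K) (f : forall k, V k -> W k) q :
  (forall k, linear (f k)) -> homog k q -> homog k (idt (tpow_map f n) q).
Proof.
move=> fl [s -> Hs].
exists [seq (p.1, (p.2.1, tpow_map f n p.2.2)) | p <- s].
  rewrite !clsE (lin_sum (idt_linear (tpow_map_linear fl))) big_map.
  apply: eq_bigr => -[c [b y]] _ /=.
  rewrite (linZ (idt_linear (tpow_map_linear fl))) -/(pure b y) idt_pure //.
  exact: tpow_map_linear.
move=> _ /mapP[p /Hs [s' E Hs'] ->] /=.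
exists [seq (p.1, map_tuple (fun x => helem (f _ (tagged x))) p.2) | p <- s'].
  rewrite E !clsE (lin_sum (tpow_map_linear fl)) big_map.
  by apply: eq_bigr => -[c w] _ /=; rewrite (linZ (tpow_map_linear fl)) -/(tprod w) tpow_map_tprod.
move=> _ /mapP[p' /Hs' + ->] /=; rewrite /tdeg => <-.
by apply: eq_bigr => j _; rewrite tnth_map.
Qed.

End Homogeneous.

Section Contraction.
Variables (K : fieldType) (A B : lmodType K) (V : int -> lmodType K).
Variables (n m : nat) (i : 'I_n.+1).
Variable E : forall k, tens B (tpow V m) -> V k.
Hypothesis El : forall k, linear (@E k).

(* The i-th entry must be homogeneous: the degree of the inserted word tells which [E k]
   to apply, which is correct as long as that word comes from a map of degree 0. *)
Let con0 (a : A) (b : B) (u : (n + m).-tuple (hel V)) : tens A (tpow V n.+1) :=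
  let w := in_word i u in
  pure a (tprod (out_word i u (helem (E (tdeg w) (pure b (tprod w)))))).

Let con0E a b (t : n.+1.-tuple (hel V)) (w : m.-tuple (hel V)) :
  con0 a b (tins i t w) = pure a (tprod (upd t i (helem (E (tdeg w) (pure b (tprod w)))))).
Proof. by rewrite /con0 in_word_tins out_word_tins. Qed.

Let con0_mult a b u p k c (x y : V k) :
  con0 a b (upd u p (helem (c *: x + y))) =
  c *: con0 a b (upd u p (helem x)) + con0 a b (upd u p (helem y)).
Proof.
have [t [w ->]] : exists t w, u = tins i t w.
  (* The letter forgotten by [tins i] is arbitrary; 0 is taken. *)
  by exists (out_word i u (helem (0 : V 0))), (in_word i u); apply: tins_surj.
have [[l lE]|[l li lE]] := tins_pos V i p.
  rewrite !lE !con0E.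
  have degE z : deg z = k -> tdeg (upd w l z) = tdeg (upd w l (helem x)).
    by move=> zk; apply: tdeg_upd.
  rewrite (degE (helem (c *: x + y))) // (degE (helem y)) //.
  by rewrite tprod_upd pure_r El tprod_upd pure_r.
by rewrite !lE !con0E !(upd_comm _ _ _ li) tprod_upd pure_r.
Qed.

Let con1 a b : tpow V (n + m) -> tens A (tpow V n.+1) := linext (con0 a b).

Let con1_lin a b : linear (con1 a b).
Proof. exact: tpow_linear (@con0_mult a b). Qed.

Let con1_tprod a b u : con1 a b (tprod u) = con0 a b u.
Proof. exact: (tpow_tprod (@con0_mult a b)). Qed.

Let lin_swap (U W : lmodType K) (f g : U -> W) c : linear f -> linear g ->
  linear (fun x => c *: f x + g x).
Proof. by move=> fl gl c' x y; rewrite fl gl !scalerDr !scalerA [c * c']mulrC addrACA. Qed.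

Let con1_bil :
  (forall c a a' b y, con1 (c *: a + a') b y = c *: con1 a b y + con1 a' b y) *
  (forall c a b b' y, con1 a (c *: b + b') y = c *: con1 a b y + con1 a b' y).
Proof.
split=> [c a a' b|c a b b'].
  apply: pres_ext => [||u]; [exact: con1_lin|by apply: lin_swap; exact: con1_lin|].
  by rewrite -/(tprod u) !con1_tprod /con0 pure_l.
apply: pres_ext => [||u]; [exact: con1_lin|by apply: lin_swap; exact: con1_lin|].
rewrite -/(tprod u) !con1_tprod.
have -> : u = tins i (out_word i u (helem (0 : V 0))) (in_word i u) by apply: tins_surj.
by rewrite !con0E pure_l El tprod_upd pure_r.
Qed.

Let con2 (y : tpow V (n + m)) : tens A B -> tens A (tpow V n.+1) :=
  linext (fun ab : A * B => con1 ab.1 ab.2 y).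

Let con2_lin y : linear (con2 y).
Proof. by apply: tens_linear => *; rewrite con1_bil. Qed.

Let con2_pure y a b : con2 y (pure a b) = con1 a b y.
Proof. by rewrite [LHS]tens_pure // => *; rewrite con1_bil. Qed.

Let con2_linr c y y' z : con2 (c *: y + y') z = c *: con2 y z + con2 y' z.
Proof.
move: z; apply: pres_ext => [||[a b]]; [exact: con2_lin|by apply: lin_swap; exact: con2_lin|].
by rewrite -/(pure a b) !con2_pure con1_lin.
Qed.

(** Collapses the m letters from position i on into the single letter that E assigns to them. It
    turns a statement on the decomposition of the i-th letter into one on that letter itself. *)
Definition contract : tens (tens A B) (tpow V (n + m)) -> tens A (tpow V n.+1) :=
  linext (fun p : tens A B * tpow V (n + m) => con2 p.2 p.1).

Lemma contract_linear : linear contract.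
Proof. by apply: tens_linear => [c z z' y|c z y y'] /=; [exact: con2_lin|exact: con2_linr]. Qed.

Lemma contract_pure a b t w : contract (pure (pure a b) (tprod (tins i t w))) =
  pure a (tprod (upd t i (helem (E (tdeg w) (pure b (tprod w)))))).
Proof.
rewrite [LHS]tens_pure => [|c z z' y|c z y y']; last 2 first.
- exact: con2_lin.
- exact: con2_linr.
by rewrite con2_pure con1_tprod con0E.
Qed.

End Contraction.

Section ContractCop.
Variables (K : fieldType) (C : cooperad_maps K) (V : int -> lmodType K).
Variables (n m : nat) (i : 'I_n.+1).
Variables (D : forall k, V k -> tens (C m) (tpow V m)).
Variables (E : forall k, tens (C m) (tpow V m) -> V k).
Hypotheses (Dl : forall k, linear (@D k)) (El : forall k, linear (@E k)).
Hypothesis Dh : forall k v, homog k (@D k v).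

Lemma contract_ins a t k q : homog k q ->
  contract i E (ins i a t q) = pure a (tprod (upd t i (helem (E k q)))).
Proof.
apply: (homog_ext (g := fun q => contract i E (ins i a t q))
  (h := fun q => pure a (tprod (upd t i (helem (E k q)))))).
- exact (lin_comp (contract_linear i El) (ins_linear i a t)).
- by move=> c y z; rewrite El tprod_upd pure_r.
by move=> b w <-; rewrite ins_pure contract_pure.
Qed.

(** Decomposing the i-th letter by D and collapsing the result by E is E D on this letter: D
    preserves degrees, so the degree read off the inserted word is that of the letter. *)
Lemma contract_cop_at x : contract i E (cop_at i D x) =
  idt (tpow_fam (at_pos i (fun k v => E k (D v)) (fun k v => v))) x.
Proof.
have fl j k : linear (at_pos i (fun k v => E k (D v)) (fun k v => v) j (k := k)).
  by rewrite /at_pos; case: eqP => // _ c u v; rewrite Dl El.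
move: x; apply: tens_tpow_ext => [||a t].
- exact (lin_comp (contract_linear i El) (cop_at_linear i Dl)).
- exact (idt_linear (tpow_fam_linear fl)).
rewrite cop_at_pure // (contract_ins _ _ (Dh _)) idt_pure ?tpow_fam_tprod //.
  congr (pure _ (tprod _)); apply: eq_from_tnth => j.
  rewrite tnth_upd tnth_mktuple /at_pos; case: eqP => [->|_] //.
  by rewrite helemK.
exact: tpow_fam_linear.
Qed.
End ContractCop.

Definition mk_linear (K : fieldType) (U W : lmodType K) (f : U -> W) (fl : linear f) :
    {linear U -> W} :=
  HB.pack_for {linear U -> W} f (GRing.isLinear.Build K U W *:%R f fl).

Section MapComp.
Variables (K : fieldType) (A : lmodType K) (U V W : int -> lmodType K) (n : nat).

Lemma idt_map_comp (f : forall k, U k -> V k) (g : forall k, V k -> W k)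
    (x : tens A (tpow U n)) :
  (forall k, linear (f k)) -> (forall k, linear (g k)) ->
  idt (tpow_map g n) (idt (tpow_map f n) x) = idt (tpow_map (fun k v => g k (f k v)) n) x.
Proof.
move=> fl gl; rewrite idt_comp; try exact: tpow_map_linear.
by congr (idt _ x); apply: funext; apply: tpow_map_comp.
Qed.

Lemma idt_map_id (f : forall k, U k -> U k) (x : tens A (tpow U n)) :
  (forall k v, f k v = v) -> idt (tpow_map f n) x = x.
Proof.
move=> fi; apply: idt_id => y.
have -> : f = fun k v => v.
  by apply: functional_extensionality_dep => k; apply: funext.
exact: tpow_map_id.
Qed.

Lemma eq_idt_map (f g : forall k, U k -> V k) (x : tens A (tpow U n)) :
  (forall k v, f k v = g k v) -> idt (tpow_map f n) x = idt (tpow_map g n) x.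
Proof.
move=> fg; congr (idt (tpow_map _ n) x).
by apply: functional_extensionality_dep => k; apply: funext.
Qed.

End MapComp.

(** * Transport of the coalgebra structure along linear maps *)

Section CopNat.
Variables (K : fieldType) (C : cooperad_maps K).

Lemma cop_at_map (V W : int -> lmodType K) n m (i : 'I_n.+1) (f : forall k, V k -> W k)
    (DV : forall k, V k -> tens (C m) (tpow V m))
    (DW : forall k, W k -> tens (C m) (tpow W m)) x :
  (forall k, linear (f k)) -> (forall k, linear (DV k)) -> (forall k, linear (DW k)) ->
  (forall k v, DW k (f k v) = idt (tpow_map f m) (DV k v)) ->
  cop_at i DW (idt (tpow_map f n.+1) x) = idt (tpow_map f (n + m)) (cop_at i DV x).
Proof.
move=> fl DVl DWl fD; rewrite -(@cop_at_nat _ _ _ _ _ _ _ f (fun _ => f) DV DW) //.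
by congr (cop_at i DW (idt _ x)); apply: funext; apply: tpow_mapE.
Qed.

Lemma tens_map_swap (A A' B B' : lmodType K) (f : A -> A') (g : B -> B') x :
  linear f -> linear g -> tens_map f id (idt g x) = idt g (tens_map f id x).
Proof.
move=> fl gl; rewrite /idt -[LHS]/((_ \o _) x) -[RHS]/((_ \o _) x).
by rewrite !tens_map_comp.
Qed.

Lemma perm_map_swap (V W : int -> lmodType K) n (s : 'S_n) (f : forall k, V k -> W k)
    (x : tens (C n) (tpow V n)) : (forall k, linear (f k)) ->
  tens_map (co_perm C s) (tpow_perm s) (idt (tpow_map f n) x) =
  idt (tpow_map f n) (tens_map (co_perm C s) (tpow_perm s) x).
Proof.
move=> fl; have sl : linear (co_perm C s) by exact: linearP.
have pl := @tpow_perm_linear K V _ s; have pl' := @tpow_perm_linear K W _ s.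
have ml := tpow_map_linear (n := n) fl.
rewrite /idt -[LHS]/((_ \o _) x) -[RHS]/((_ \o _) x).
rewrite !tens_map_comp //; congr (tens_map _ _ x).
by apply: funext => y; apply: tpow_perm_map.
Qed.

(* W carries structure maps that are not yet known to satisfy the axioms of a coalgebra;
   the axioms hold at the image of any map from a coalgebra that commutes with them. *)
Section Compat.
Variables (V : coalg C) (W : int -> lmodType K) (f : forall k, V k -> W k).
Variables (d : forall k, W k -> W (k - 1)) (c : forall n k, W k -> tens (C n) (tpow W n)).
Hypotheses (fl : forall k, linear (@f k)) (dl : forall k, linear (@d k)).
Hypothesis cl : forall n k, linear (@c n k).
Hypothesis fd : forall k (v : V k), d (f v) = f (coalg_d V k v).
Hypothesis fc : forall n k (v : V k), c n (f v) = idt (tpow_map f n) (coalg_cop V n k v).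

Let ml n := tpow_map_linear (n := n) fl.

Lemma compat_dd k (v : V k) : d (d (f v)) = 0.
Proof. by rewrite !fd cd_cd lin0. Qed.

Lemma compat_deg n k (v : V k) : homog k (c n (f v)).
Proof. by rewrite fc; apply: homog_map => //; apply: cop_deg. Qed.

Lemma compat_cd n k (v : V k) :
  c n (d (f v)) = tens_map id (tpow_d d) (c n (f v)).
Proof.
have cdl k' : linear (coalg_d V k') by exact: linearP.
rewrite fd !fc [coalg_cop _ _ _ _]cop_cd -!/(idt _ _) !idt_comp //.
- by congr (idt _ _); apply: funext => x /=; rewrite (tpow_d_map _ cdl dl fl).
- exact: tpow_d_linear.
- exact: tpow_d_linear.
Qed.

Lemma compat_inv n (s : 'S_n) k (v : V k) :
  tens_map (co_perm C s) (tpow_perm s) (c n (f v)) = c n (f v).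
Proof. by rewrite fc perm_map_swap // cop_inv. Qed.

Lemma compat_fin k (v : V k) : exists N, forall n, (N <= n)%N -> c n (f v) = 0.
Proof.
have [N NP] := cop_fin (car_coalg V) v; exists N => n /NP E.
by rewrite fc /coalg_cop E lin0 //; apply: idt_linear.
Qed.

Lemma compat_counit k (v : V k) :
  linext (fun p : C 1 * tpow W 1 => (co_counit C p.1 : K) *: p.2) (c 1 (f v)) =
  tprod [tuple helem (f v)].
Proof.
have el : linear (@co_counit _ C) by exact: linearP.
rewrite -/(counit_at _ _) fc counit_at_map //.
rewrite [counit_at _ _]cop_counit tpow_map_tprod //; congr tprod.
by apply: eq_from_tnth => j; rewrite tnth_map !(tnth_nth (helem (0 : W 0))) ord1.
Qed.

Lemma compat_coassoc n m (i : 'I_n.+1) k (v : V k) :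
  tens_map (co_dec C m i) id (c (n + m)%N (f v)) = cop_at i (c m) (c n.+1 (f v)).
Proof.
have dcl : linear (co_dec C m i) by exact: linearP.
have ccl k' : linear (coalg_cop V m k') by exact: linearP.
rewrite !fc tens_map_swap // [tens_map _ _ _]cop_coassoc.
by rewrite -(@cop_at_map _ _ _ _ _ _ (coalg_cop V m) (c m)).
Qed.

End Compat.

End CopNat.

(** * Finite dimensional sub-coalgebras *)

Section SubCoalgebra.
Variables (K : fieldType) (C : cooperad_maps K) (V : coalg C).
Variable S : forall k, submodClosed (V k).
Arguments S : clear implicits.

Lemma val_linear k : linear (val : subm (S k) -> V k).
Proof. by move=> c x y; rewrite linearP. Qed.

Lemma sub_retraction : exists r : forall k, V k -> subm (S k),
  (forall k, linear (r k)) /\ forall k s, r k (val s) = s.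
Proof.
have [r [rl rE]] := graded_pinv val_linear; exists r; split=> // k s.
exact/val_inj/rE.
Qed.

Hypothesis Sd : forall k (x : V k), x \in S k -> coalg_d V k x \in S (k - 1).
(** The decompositions of elements of S are tensors over S, expressed as invariance under
    projections onto S rather than by membership in a tensor power of S. *)
Hypothesis Scop : forall r : (forall k, V k -> subm (S k)),
  (forall k, linear (r k)) -> (forall k s, r k (val s) = s) ->
  forall n k (x : V k), x \in S k ->
  idt (tpow_map (fun k v => val (r k v)) n) (coalg_cop V n k x) = coalg_cop V n k x.
Hypothesis Sfd : finite_dim (fun k => subm (S k)).

(** The structure maps of V, followed by a retraction onto S, commute with the inclusion by [Sd] and
    [Scop]. The tensor powers of the inclusion are injective, so the axioms are inherited from V. *)
Lemma fd_sub_of : exists W : fd_sub V, fs_sub W = S.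
Proof.
have [r [rl rK]] := sub_retraction.
pose W k : lmodType K := subm (S k).
pose i k (s : W k) : V k := val s.
have il k : linear (i k) by exact: val_linear.
have iml n := tpow_map_linear (n := n) il.
have rml n := tpow_map_linear (n := n) rl.
have cdl k : linear (coalg_d V k) by exact: linearP.
have ccl n k : linear (coalg_cop V n k) by exact: linearP.
pose d k (s : W k) : W (k - 1) := r _ (coalg_d V k (val s)).
pose c n k (s : W k) : tens (C n) (tpow W n) := idt (tpow_map r n) (coalg_cop V n k (val s)).
have dl k : linear (d k) by move=> a x y; rewrite /d val_linear cdl rl.
have cl n k : linear (c n k) by move=> a x y; rewrite /c val_linear ccl (idt_linear (rml n)).
have id_ k (s : W k) : i _ (d k s) = coalg_d V k (i k s).
  rewrite /d /i; have sS := Sd (valP s).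
  exact: (congr1 (val : W _ -> _) (rK _ (exist (fun x => x \in S (k - 1)) _ sS))).
have ic n k (s : W k) : idt (tpow_map i n) (c n k s) = coalg_cop V n k (i k s).
  by rewrite /c idt_map_comp // -[RHS](Scop rl rK) //; apply: valP.
(* The retraction r induces a left inverse on tensor powers. *)
have injc (A : lmodType K) n (x y : tens A (tpow W n)) :
    idt (tpow_map i n) x = idt (tpow_map i n) y -> x = y.
  move=> /(congr1 (idt (tpow_map r n))); rewrite !idt_map_comp //.
  by rewrite !idt_map_id // => k s; apply: rK.
have iinj k (x y : W k) : i k x = i k y -> x = y by exact: val_inj.
unshelve epose (on := @CoalgOn K C W (fun k => mk_linear (dl k)) (fun n k => mk_linear (cl n k))
  _ _ _ _ _ _ _).
- move=> k s; apply: iinj; rewrite /mk_linear /= !id_ [LHS]cd_cd.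
  by rewrite /i linear0.
- move=> n k s; apply: homog_map => //; exact: cop_deg.
- move=> n k s /=; apply: injc.
  rewrite ic id_ [LHS]cop_cd (esym (ic n k s) : cop _ n k _ = _) -!/(idt _ _).
  rewrite (idt_comp (c n k s) (iml n) (tpow_d_linear cdl (n := n))).
  rewrite (idt_comp (c n k s) (tpow_d_linear dl (n := n)) (iml n)).
  by congr (idt _ _); apply: funext => x /=; rewrite (tpow_d_map _ dl cdl il).
- move=> n g k s /=; apply: injc; rewrite -perm_map_swap // ic.
  exact: cop_inv.
- move=> k s; have [N NP] := cop_fin (car_coalg V) (val s); exists N => n /NP E.
  by rewrite /mk_linear /= /c /coalg_cop E (lin0 (idt_linear (rml n))).
- move=> k s /=.
  have el : linear (@co_counit _ C) by exact: linearP.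
  have tinj (x y : tpow W 1) : tpow_map i 1 x = tpow_map i 1 y -> x = y.
    move=> /(congr1 (tpow_map r 1)); rewrite -![tpow_map r _ _]/((_ \o _) _) !tpow_map_comp //.
    have -> : (fun k => r k \o i k) = fun k v => v.
      by apply: functional_extensionality_dep => k'; apply: funext => v; apply: rK.
    by rewrite !tpow_map_id.
  apply: tinj; rewrite -/(counit_at _ _) -counit_at_map // ic [LHS]cop_counit tpow_map_tprod //.
  by congr tprod; apply: eq_from_tnth => j; rewrite tnth_map !(tnth_nth (helem (0 : V 0))) ord1.
- move=> n m j k s /=; apply: injc.
  have decl : linear (co_dec C m j) by exact: linearP.
  rewrite -(@cop_at_map _ _ _ _ _ _ _ i (c m) (coalg_cop V m)) // -tens_map_swap // !ic.
  exact: cop_coassoc.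
have hc n k (s : W k) : coalg_cop V n k (i k s) =
    tens_map id (tpow_map i n) (coalg_cop (Coalg on) n k s) by rewrite -ic.
pose inc : coalg_hom (Coalg on) V :=
  @CoalgHom _ _ (Coalg on) V i il (fun k s => id_ k s) hc.
by exists (@FdSub _ _ V S on inc (fun _ _ => erefl) Sfd).
Qed.

End SubCoalgebra.

Section Positionwise.
Variables (K : fieldType) (A : lmodType K) (V : int -> lmodType K).
Let idV := fun k (v : V k) => v.

Lemma at_pos_linear n (i : 'I_n) (f g : forall k, V k -> V k) :
  (forall k, linear (f k)) -> (forall k, linear (g k)) ->
  forall j k, linear (at_pos i f g j (k := k)).
Proof. by move=> fl gl j k; rewrite /at_pos; case: eqP. Qed.

Lemma idt_fam_comp n (f g : 'I_n -> forall k, V k -> V k) (x : tens A (tpow V n)) :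
  (forall j k, linear (f j k)) -> (forall j k, linear (g j k)) ->
  idt (tpow_fam g) (idt (tpow_fam f) x) = idt (tpow_fam (fun j k y => g j k (f j k y))) x.
Proof.
move=> fl gl; rewrite idt_comp; [|exact: tpow_fam_linear|exact: tpow_fam_linear].
by congr (idt _ x); apply: funext => y; apply: tpow_fam_comp.
Qed.

Lemma idt_fam_id n (f : 'I_n -> forall k, V k -> V k) (x : tens A (tpow V n)) :
  (forall j k v, f j k v = v) -> idt (tpow_fam f) x = x.
Proof.
move=> fi; rewrite (@eq_tpow_fam _ _ _ _ f (fun _ => idV)) //.
apply: idt_id => y; rewrite -tpow_mapE //; exact: tpow_map_id.
Qed.

(** Applying p everywhere is applying it in one position after the other; [g l] is the stage where
    the first l positions are done. *)
Lemma fixed_at_all n (p : forall k, V k -> V k) (x : tens A (tpow V n)) :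
  (forall k, linear (p k)) ->
  (forall i, idt (tpow_fam (at_pos i p idV)) x = x) -> idt (tpow_map p n) x = x.
Proof.
move=> pl px.
pose g l : 'I_n -> forall k, V k -> V k := fun j => if (j < l)%N then p else idV.
have gl l j k : linear (g l j k) by rewrite /g; case: ifP.
have al i := at_pos_linear i pl (fun k => lin_id (U := V k)).
have H l : (l <= n)%N -> idt (tpow_fam (g l)) x = x.
  elim: l => [|l IH] ln; first by apply: idt_fam_id.
  rewrite -[in RHS](px (Ordinal ln)) -[in RHS](IH (ltnW ln)) idt_fam_comp //.
  congr (idt _ x); apply: eq_tpow_fam => j k v.
  rewrite /g /at_pos -val_eqE /= ltnS leq_eqVlt.
  by case: eqP => [->|_] //=; rewrite ltnn.
rewrite -[RHS](H n) //; congr (idt _ x); apply: funext => y.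
rewrite tpow_mapE //; congr (_ y); apply: eq_tpow_fam => j k v.
by rewrite /g ltn_ord.
Qed.

End Positionwise.

(** * The sub-coalgebra inside the image of a projection *)

Section Largest.
Variables (K : fieldType) (C : cooperad_maps K) (V : coalg C).
Variable p : forall k, V k -> V k.
Arguments p : clear implicits.
Hypothesis pl : forall k, linear (p k).
Arguments pl : clear implicits.
Hypothesis pp : forall k v, p k (p k v) = p k v.
Hypothesis pd : forall k v, p (k - 1) (coalg_d V k (p k v)) = coalg_d V k (p k v).
Variable N : nat.
Hypothesis pN : forall m k v, (N <= m)%N -> coalg_cop V m k (p k v) = 0.

Let idV := fun k (v : V k) => v.
Let P m := @idt _ (C m) _ _ (tpow_map p m).
Arguments P : clear implicits.
Let ml n := tpow_map_linear (n := n) pl.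
Arguments ml : clear implicits.
Let Pl m : linear (P m) := idt_linear (ml m).
Arguments Pl : clear implicits.
Let cl n k : linear (coalg_cop V n k) := linearP _.
Let dl k : linear (coalg_d V k) := linearP _.
Arguments cl : clear implicits.
Arguments dl : clear implicits.

(* The elements of the image of p whose decompositions are tensors over the image of p.
   By coassociativity they form a sub-coalgebra, see [core_cop]. *)
Definition core k (v : V k) : Prop :=
  p k v = v /\ forall m, P m (coalg_cop V m k v) = coalg_cop V m k v.

(** The defect in arity m: an element fixed by p is in the core exactly when all its defects
    vanish. *)
Let D m k (v : V k) := coalg_cop V m k v - P m (coalg_cop V m k v).
Arguments D : clear implicits.
Let Dl m k : linear (D m k).
Proof.
by move=> c u v; rewrite /D cl Pl scalerBr opprD addrACA.
Qed.

Arguments Dl : clear implicits.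

(** By coassociativity, decomposing a letter in a decomposition of v amounts to applying [co_dec] to
    a decomposition of higher arity. The latter is a tensor over the image of p, so the letter
    contributes no defect. *)
Lemma defect_contract n m (i : 'I_n.+1) k (v : V k) : core v ->
  cop_at i (D m) (coalg_cop V n.+1 k v) = 0.
Proof.
move=> [_ cv]; set x := coalg_cop V n.+1 k v.
have Px : P n.+1 x = x by exact: cv.
pose g := at_pos i idV p.
have gl : forall j k, linear (g j k) by apply: at_pos_linear.
have gx : idt (tpow_fam g) x = x.
  rewrite -{1}Px /P (_ : tpow_map p n.+1 = tpow_fam (fun _ => p)); last first.
    by apply: funext; apply: tpow_mapE.
  rewrite idt_fam_comp // -[RHS]Px.
  rewrite (_ : P n.+1 = idt (tpow_fam (fun _ => p))); last first.
    by rewrite /P; congr idt; apply: funext; apply: tpow_mapE.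
  congr (idt _ x); apply: eq_tpow_fam => j l w.
  by rewrite /g /at_pos; case: eqP => _; rewrite // pp.
have Pcl l : linear (fun w => P m (coalg_cop V m l w)).
  by move=> c u w; rewrite cl Pl.
(* Applying p to every letter of the double decomposition changes nothing. By naturality it also
   amounts to [P m] after decomposing the i-th letter and p on the others, which p already fixes. *)
have E1 : cop_at i (fun l w => P m (coalg_cop V m l w)) x = cop_at i (coalg_cop V m) x.
  rewrite -{1}gx (@cop_at_nat _ _ _ _ _ _ _ p g (coalg_cop V m)) //.
  - have decl : linear (co_dec C m i) by exact: linearP.
    rewrite /x -[cop_at _ _ _](@cop_coassoc _ _ _ (car_coalg V)) -tens_map_swap //.
    by rewrite (cv _ : idt _ (cop _ _ _ _) = _).
  - by move=> j l w; rewrite /g /at_pos => /negPf->.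
  by move=> l w; rewrite /g /at_pos eqxx.
have -> : cop_at i (D m) x = cop_at i (coalg_cop V m) x -
    cop_at i (fun l w => P m (coalg_cop V m l w)) x.
  have Bl : linear (fun y => cop_at i (coalg_cop V m) y -
    cop_at i (fun l w => P m (coalg_cop V m l w)) y).
    move=> c y z; rewrite (cop_at_linear i (cl m) c) (cop_at_linear i Pcl c).
    by rewrite scalerBr opprD addrACA.
  move: (x); apply: tens_tpow_ext; [exact: cop_at_linear|exact: Bl|].
  move=> a t; rewrite (cop_at_pure _ (Dl m)) (cop_at_pure _ (cl m)) (cop_at_pure _ Pcl).
  by rewrite (linB (ins_linear i a t)).
by rewrite E1 subrr.
Qed.

(** The defects are removed one arity at a time, by induction on M. Each step composes rho with a
    projection onto the kernel of the next defect, and [defect_contract] shows that this projection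
    still fixes the i-th letter of x. *)
Lemma core_reduction n (i : 'I_n.+1) k (v : V k) M : core v ->
  exists rho : forall k, V k -> V k,
    [/\ forall k, linear (rho k), forall k w, p k (rho k w) = rho k w,
        forall m k w, (m < M)%N -> D m k (rho k w) = 0 &
        idt (tpow_fam (at_pos i rho idV)) (coalg_cop V n.+1 k v) = coalg_cop V n.+1 k v].
Proof.
move=> cv; set x := coalg_cop V n.+1 k v.
have idl k' : linear (@idV k') by [].
have al f (fl : forall k, linear (f k)) := at_pos_linear i fl idl.
elim: M => [|M [rho [rl rp rD rx]]].
  exists p; split=> //.
  have Px : P n.+1 x = x by exact: cv.2.
  rewrite -{1}Px /P (_ : tpow_map p n.+1 = tpow_fam (fun _ => p)); last first.
    by apply: funext; apply: tpow_mapE.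
  rewrite idt_fam_comp //; last exact: al.
  rewrite -[RHS]Px (_ : P n.+1 = idt (tpow_fam (fun _ => p))); last first.
    by rewrite /P; congr idt; apply: funext; apply: tpow_mapE.
  congr (idt _ x); apply: eq_tpow_fam => j l w.
  by rewrite /at_pos; case: eqP => _; rewrite // pp.
pose F k' (w : V k') := D M k' (rho k' w).
have Fl k' : linear (F k') by move=> c u w; rewrite /F rl Dl.
have [E [El FE]] := graded_pinv Fl.
have Fh k' w : homog k' (F k' w).
  rewrite /F /D; have h : homog k' (coalg_cop V M k' (rho k' w)) by exact: cop_deg.
  by apply: subspaceB (homog_map pl h) => //; apply: homog_subspace.
pose e k' (w : V k') := E k' (F k' w).
have el k' : linear (e k') by move=> c u w; rewrite /e Fl El.
(* Since F E F = F, the map q = id - E F takes its values in the kernel of F. *)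
pose q k' (w : V k') := w - e k' w.
have ql k' : linear (q k').
  by move=> c u w; rewrite /q el opprD addrACA scalerBr.
(* The map E F in position i is the contraction by E of F applied there; as rho fixes the i-th
   letter of x, F may be replaced by [D M], which gives 0. *)
have ex0 : idt (tpow_fam (at_pos i e idV)) x = 0.
  rewrite -(contract_cop_at i Fl El Fh).
  rewrite (_ : cop_at i F x = 0); first by rewrite (lin0 (contract_linear i El)).
  have := @cop_at_nat K C n M i V V idV (at_pos i rho idV) F (D M) x idl (al _ rl) Fl (Dl M).
  rewrite rx defect_contract // (idt_map_id _) // => <- //.
    by move=> j l w; rewrite /at_pos => /negPf->.
  by move=> l w; rewrite /at_pos eqxx idt_map_id.
have qx : idt (tpow_fam (at_pos i q idV)) x = x.
  rewrite -[RHS]subr0 -[in RHS]ex0.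
  have Bl : linear (fun y : tens (C n.+1) (tpow V n.+1) =>
      y - idt (tpow_fam (at_pos i e idV)) y).
    move=> c y z; rewrite (idt_linear (tpow_fam_linear (al _ el)) c).
    by rewrite scalerBr opprD addrACA.
  move: (x); apply: tens_tpow_ext; [exact: (idt_linear (tpow_fam_linear (al _ ql)))|exact: Bl|].
  move=> a t.
  rewrite (idt_pure _ _ (tpow_fam_linear (al _ ql))) (idt_pure _ _ (tpow_fam_linear (al _ el))).
  rewrite (tpow_fam_tprod (al _ ql)) (tpow_fam_tprod (al _ el)).
  have aE (f : forall k, V k -> V k) :
      [tuple helem (at_pos i f idV j (tagged (tnth t j))) | j < n.+1] =
      upd t i (helem (f _ (tagged (tnth t i)))).
    apply: eq_from_tnth => j; rewrite tnth_upd tnth_mktuple /at_pos.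
    by case: eqP => [->|_] //; rewrite helemK.
  rewrite !aE -[X in _ = pure a (tprod X) - _](upd_id t i) -[X in _ = pure a (tprod (upd _ _ X)) - _]helemK.
  by rewrite /q addrC -scaleN1r tprod_upd pure_r scaleN1r addrC.
exists (fun k' w => rho k' (q k' w)); split.
- by move=> k' c u w; rewrite ql rl.
- by move=> k' w; rewrite rp.
- move=> m k' w; rewrite ltnS leq_eqVlt => /orP[/eqP->|mM]; last exact: rD.
  by rewrite -/(F k' _) /q (linB (Fl k')) FE subrr.
rewrite -[RHS]rx -{2}qx idt_fam_comp //; try exact: al.
congr (idt _ x); apply: eq_tpow_fam => j l w.
by rewrite /at_pos; case: eqP.
Qed.

(** It suffices to treat one position i. [core_reduction] with M = N writes the i-th letter as a
    value of rho, and these values lie in the core, where r is the identity. *)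
Lemma core_cop (r : forall k, V k -> V k) n k (v : V k) :
  (forall k, linear (r k)) -> (forall k w, core w -> r k w = w) -> core v ->
  idt (tpow_map r n) (coalg_cop V n k v) = coalg_cop V n k v.
Proof.
move=> rl rE cv; apply: fixed_at_all => // i; case: n i => [[]//|n] i.
have [rho [rhol rp rD rx]] := core_reduction i N cv.
have idl k' : linear (@idV k') by [].
have al f (fl : forall k, linear (f k)) := at_pos_linear i fl idl.
rewrite -{1}rx idt_fam_comp; [|exact: al|exact: al]; rewrite -[RHS]rx.
congr (idt _ _); apply: eq_tpow_fam => j l w; rewrite /at_pos; case: eqP => // _.
apply: rE; split=> // m; have [mN|Nm] := ltnP m N.
  by have /eqP := rD m l w mN; rewrite subr_eq0 => /eqP.
(* From arity N on, the decompositions of elements of the image of p are zero, so the defect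
   vanishes without any reduction. *)
by rewrite -rp pN // (lin0 (Pl m)).
Qed.

Lemma core_subspace k : subspace (@core k).
Proof.
split; first by split=> [|m]; rewrite ?(lin0 (cl _ k)) ?(lin0 (Pl _)) ?(lin0 (pl k)).
move=> c u v [pu cu] [pv cv]; split=> [|m]; first by rewrite pl pu pv.
by rewrite cl Pl cu cv.
Qed.

Lemma core_d k (v : V k) : core v -> core (coalg_d V k v).
Proof.
move=> [pv cv]; split=> [|m]; first by rewrite -pv pd.
rewrite /coalg_cop cop_cd -/(coalg_cop V m k v) -cv.
have tl := tpow_d_linear dl (n := m).
rewrite /P -!/(idt _ _) !(idt_comp (coalg_cop V m k v) (ml m) tl).
rewrite idt_comp //; last exact: (lin_comp tl (ml m)).
congr (idt _ _); apply: funext => y /=.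
exact: (tpow_d_proj _ dl pl pp pd).
Qed.

End Largest.

Definition submod_of (K : fieldType) (V : lmodType K) (P : V -> Prop) (sP : subspace P) :
  {S : submodClosed V | forall x, x \in S <-> P x}.
Proof.
have cl : GRing.subsemimod_closed (fun x : V => `[< P x >]).
  have [P0 Pl] := sP; split; first split.
  - exact/asboolP.
  - by move=> x y /asboolP Px /asboolP Py; apply/asboolP; have := Pl 1 x y Px Py; rewrite scale1r.
  - by move=> c x /asboolP Px; apply/asboolP; have := Pl c x 0 Px P0; rewrite addr0.
exists (HB.pack_for (submodClosed V) (fun x : V => `[< P x >])
  (GRing.isSubmodClosed.Build K V (fun x : V => `[< P x >]) cl)).
by move=> x; split=> [/asboolP|?]; [|apply/asboolP].
Qed.

(** * Finite sets of vectors and tensors over their span *)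

Section FiniteSpan.
Variables (K : fieldType) (V : int -> lmodType K).

Definition hcomp k (x : hel V) : V k :=
  if tag x =P k is ReflectT e then eq_rect _ V (tagged x) _ e else 0.

Lemma hcomp_helem k (v : V k) : hcomp k (helem v) = v.
Proof. by rewrite /hcomp; case: eqP => // e; rewrite (eq_axiomK e). Qed.

Lemma hcomp_tagged (x : hel V) : hcomp (tag x) x = tagged x.
Proof. by case: x => k v; apply: hcomp_helem. Qed.

Lemma hcomp_neq k (x : hel V) : tag x <> k -> hcomp k x = 0.
Proof. by rewrite /hcomp; case: eqP. Qed.

(** If s sends coefficients to linear combinations of L and s E s = s, then s E is a projection onto
    the span of L, degree by degree. *)
Lemma span_projection (L : seq (hel V)) : exists p : forall k, V k -> V k,
  [/\ forall k, linear (p k), forall k v, p k (p k v) = p k v,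
      forall x, x \in L -> p _ (tagged x) = tagged x &
      forall k v, exists c : 'I_(size L) -> K,
        p k v = \sum_a c a *: hcomp k (tnth (in_tuple L) a)].
Proof.
pose s k (c : 'rV[K]_(size L)) := \sum_a c 0 a *: hcomp k (tnth (in_tuple L) a).
have sl k : linear (s k).
  move=> b c c'; rewrite /s scaler_sumr -big_split; apply: eq_bigr => a _ /=.
  by rewrite !mxE scalerDl scalerA.
have [E [El sE]] := graded_pinv sl; exists (fun k v => s k (E k v)); split.
- by move=> k c u v; rewrite El sl.
- by move=> k v; rewrite sE.
- move=> x xL; have iL : (index x L < size L)%N by rewrite index_mem.
  have -> : tagged x = s (tag x) (delta_mx 0 (Ordinal iL)).
    rewrite /s (bigD1 (Ordinal iL)) //= big1 => [|a /negPf an]; last first.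
      by rewrite mxE an andbF scale0r.
    rewrite mxE !eqxx scale1r addr0 (tnth_nth x) /= nth_index //.
    by rewrite hcomp_tagged.
  by rewrite sE.
by move=> k v; exists (E k v 0).
Qed.

(** A representative of z involves finitely many letters. The list is chosen before p, so that p can
    later be built from it. *)
Lemma tensor_entries (A : lmodType K) n (z : tens A (tpow V n)) :
  exists L : seq (hel V), forall p : (forall k, V k -> V k), (forall k, linear (p k)) ->
    (forall x, x \in L -> p _ (tagged x) = tagged x) -> idt (tpow_map p n) z = z.
Proof.
have H (y : tpow V n) : exists L : seq (hel V), forall p : (forall k, V k -> V k),
    (forall k, linear (p k)) -> (forall x, x \in L -> p _ (tagged x) = tagged x) ->
    tpow_map p n y = y.
  exists (flatten [seq tval q.2 | q <- rep y]) => p pl pL.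
  have ml := tpow_map_linear (n := n) pl.
  rewrite -(repK y) clsE (lin_sum ml) big_seq [RHS]big_seq.
  apply: eq_bigr => q qy; rewrite (linZ ml) -/(tprod q.2) tpow_map_tprod //.
  congr (_ *: tprod _); apply: eq_from_tnth => j; rewrite tnth_map pL ?helemK //.
  by apply/flattenP; exists (tval q.2); [apply/mapP; exists q|exact: mem_tnth].
have [L LP] := choice H.
exists (flatten [seq L q.2.2 | q <- rep z]) => p pl pL.
have il := idt_linear (A := A) (tpow_map_linear (n := n) pl).
rewrite -(repK z) clsE (lin_sum il) big_seq [RHS]big_seq.
apply: eq_bigr => -[c [a y]] qz; rewrite (linZ il) -/(pure a y) idt_pure; last first.
  exact: tpow_map_linear.
rewrite (LP y) // => x xL; apply: pL.
by apply/flattenP; exists (L y) => //; apply/mapP; exists (c, (a, y)).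
Qed.

End FiniteSpan.

Section FundamentalTheorem.
Variables (K : fieldType) (C : cooperad_maps K) (V : coalg C).

(** Conilpotence leaves finitely many non-zero decompositions, whose lists of entries are
    concatenated. *)
Lemma cop_entries (x : hel V) :
  exists L : seq (hel V), forall p : (forall k, V k -> V k), (forall k, linear (p k)) ->
    (forall y, y \in L -> p _ (tagged y) = tagged y) ->
    forall m, idt (tpow_map p m) (coalg_cop V m _ (tagged x)) = coalg_cop V m _ (tagged x).
Proof.
have [L LP] := choice (fun m => tensor_entries (coalg_cop V m _ (tagged x))).
have [N NP] := cop_fin (car_coalg V) (tagged x).
exists (flatten [seq L m | m <- iota 0 N]) => p pl pL m.
have [mN|Nm] := ltnP m N.
  apply: LP => // y yL; apply: pL; apply/flattenP; exists (L m) => //.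
  by apply/mapP; exists m; rewrite ?mem_iota.
rewrite /coalg_cop NP // lin0 //.
exact: idt_linear (tpow_map_linear pl).
Qed.

Lemma seq_bound (T : eqType) (L : seq T) (P : T -> nat -> Prop) :
  (forall x, exists N, forall n, (N <= n)%N -> P x n) ->
  exists N, forall x n, x \in L -> (N <= n)%N -> P x n.
Proof.
move=> H; elim: L => [|x L [N NP]]; first by exists 0%N.
have [M MP] := H x; exists (maxn N M) => y n; rewrite inE geq_max.
by move=> /orP[/eqP->|yL] /andP[Nn Mn]; [apply: MP|apply: NP].
Qed.

Lemma fd_sub_ex (l : seq (hel V)) : exists W : fd_sub V,
  forall x, x \in l -> tagged x \in fs_sub W (tag x).
Proof.
have [Le LeP] := choice cop_entries.
pose L0 := l ++ flatten [seq Le x | x <- l].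
(* One round of differentials makes the span stable under d, because d squares to zero. *)
pose L := L0 ++ [seq helem (coalg_d V _ (tagged x)) | x <- L0].
have [p [pl pp pL pE]] := span_projection L.
have dl k : linear (coalg_d V k) by exact: linearP.
have cl n k : linear (coalg_cop V n k) by exact: linearP.
have pd0 x : x \in L -> p _ (coalg_d V _ (tagged x)) = coalg_d V _ (tagged x).
  rewrite mem_cat => /orP[xL0|/mapP[y _ ->]].
    apply: (pL (helem (coalg_d V _ (tagged x)))); rewrite mem_cat; apply/orP; right.
    by apply/mapP; exists x.
  by rewrite /= (cd_cd (car_coalg V)) (lin0 (pl _)).
have pd1 k x : x \in L -> p _ (coalg_d V k (hcomp k x)) = coalg_d V k (hcomp k x).
  move=> xL; have [<-|kx] := eqVneq (tag x) k; first by rewrite hcomp_tagged pd0.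
  by rewrite hcomp_neq ?(lin0 (dl k)) ?(lin0 (pl _)) //; apply/eqP.
have pd k v : p (k - 1) (coalg_d V k (p k v)) = coalg_d V k (p k v).
  have [c ->] := pE k v; rewrite (lin_sum (dl k)) (lin_sum (pl _)).
  apply: eq_bigr => a _; rewrite (linZ (dl k)) (linZ (pl _)) pd1 //.
  exact: (mem_tnth a (in_tuple L)).
have [N NP] := seq_bound L (fun x : hel V => cop_fin (car_coalg V) (tagged x)).
have pN m k v : (N <= m)%N -> coalg_cop V m k (p k v) = 0.
  move=> Nm; have [c ->] := pE k v; rewrite (lin_sum (cl m k)) big1 // => a _.
  rewrite (linZ (cl m k)); have := mem_tnth a (in_tuple L).
  move: (tnth _ _) => x /= xL.
  have [<-|kx] := eqVneq (tag x) k; last first.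
    by rewrite hcomp_neq ?(lin0 (cl m k)) ?scaler0 //; apply/eqP.
  by rewrite hcomp_tagged [coalg_cop _ _ _ _]NP // scaler0.
pose S k := sval (submod_of (core_subspace pl k)).
have SP k x : x \in S k <-> core p x by exact: svalP (submod_of (core_subspace pl k)) x.
have corel x : x \in l -> core p (tagged x).
  move=> xl; split; first by apply: pL; rewrite !mem_cat xl.
  apply: LeP => // y yx; apply: pL; rewrite !mem_cat.
  apply/orP; left; apply/orP; right; apply/flattenP; exists (Le x) => //.
  exact: map_f.
have [|r rl rK n k x /SP cx||W WE] := @fd_sub_of _ _ V S.
- by move=> k x /SP cx; apply/SP/(core_d pl pp pd).
- apply: (@core_cop _ _ _ _ pl pp _ pN _ n k x _ _ cx).
    by move=> k'; apply: lin_comp (rl k'); exact: val_linear.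
  move=> k' w /SP wS.
  exact: (congr1 (val : subm (S k') -> V k') (rK _ (exist (fun x => x \in S k') _ wS))).
- split.
    (* Elements of S k are fixed by p, hence combinations of the degree k components of L; these are
       zero beyond the largest absolute degree in L. *)
    have [|M MP] := @seq_bound _ L (fun x m => forall k, (m < `|k|)%N -> hcomp k x = 0).
      move=> x; exists `|tag x|%N => n xn k nk; apply: hcomp_neq => xk.
      by move: xn; rewrite xk leqNgt nk.
    exists M => k Mk v; apply: val_inj.
    have /SP [<- _] := valP v; have [c ->] := pE k (val v).
    rewrite big1 // => a _; rewrite (MP _ M) ?scaler0 //.
    exact: (mem_tnth a (in_tuple L)).
  move=> k; have [r [rl rK]] := sub_retraction S.
  exists (size L), (fun a => r k (hcomp k (tnth (in_tuple L) a))) => v.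
  have [c cE] := pE k (val v); exists c.
  have /SP [pv _] := valP v.
  rewrite -[LHS]rK -pv cE (lin_sum (rl k)).
  by apply: eq_bigr => a _; rewrite (linZ (rl k)).
by exists W => x xl; rewrite WE; apply/SP/corel.
Qed.

End FundamentalTheorem.

Section FiniteDim.
Variables (K : fieldType) (W : int -> lmodType K).
Hypothesis Wfd : finite_dim W.

(** A finite homogeneous generating list for all degrees together, in the form of an induction
    principle: a graded subspace containing it is everything. *)
Lemma finite_dim_list : exists l : seq (hel W), forall P : (forall k, W k -> Prop),
  (forall k, subspace (P k)) -> (forall x, x \in l -> P _ (tagged x)) -> forall k w, P k w.
Proof.
have [[N WN] Wsp] := Wfd.
have H k : exists l : seq (W k), forall P : W k -> Prop, subspace P ->
    (forall x, x \in l -> P x) -> forall w, P w.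
  have [d [e eP]] := Wsp k; exists [seq e a | a <- enum 'I_d] => P [P0 Pl] Pe w.
  have [c ->] := eP w; elim/big_ind: _ => //.
    by move=> x y Px Py; have := Pl 1 x y Px Py; rewrite scale1r.
  move=> a _; have Pea : P (e a) by apply/Pe/map_f; rewrite mem_enum.
  by have := Pl (c a) _ 0 Pea P0; rewrite addr0.
pose l k := sval (cid (H k)).
have lP k : forall P : W k -> Prop, subspace P -> (forall x, x \in l k -> P x) -> forall w, P w.
  exact: svalP (cid (H k)).
(* As [Negz j] is -(j+1), the list runs through all degrees from -N to N. *)
pose ks : seq int := [seq Posz j | j <- iota 0 N.+1] ++ [seq Negz j | j <- iota 0 N].
exists (flatten [seq [seq helem x | x <- l k] | k <- ks]) => P Ps Pl k w.
have [kN|Nk] := leqP `|k| N; last by rewrite (WN k Nk w); exact: (Ps k).1.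
apply: lP => // x xl; apply: (Pl (helem x)); apply/flattenP.
exists [seq helem x | x <- l k]; last exact: map_f.
apply/mapP; exists k => //; rewrite mem_cat.
case: k kN {w x xl} => j kN; apply/orP; [left|right]; apply/map_f; rewrite mem_iota //.
Qed.

End FiniteDim.

(** * The directed diagram of sub-coalgebras and the functor delta *)

Section SubObjects.
Variables (K : fieldType) (C : cooperad_maps K).
Implicit Types U V : coalg C.

Lemma fs_incl_inj V (W : fd_sub V) k : injective (fs_incl W k).
Proof. by move=> x y; rewrite !fs_inclE => /val_inj. Qed.

Lemma fs_incl_ex V (W : fd_sub V) k v : v \in fs_sub W k -> exists w, fs_incl W k w = v.
Proof. by move=> vW; exists (exist (fun x => x \in fs_sub W k) v vW); rewrite fs_inclE. Qed.

Lemma fs_incl_monic U V (W : fd_sub V) (g h : coalg_hom U (Coalg (fs_on W))) :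
  coalg_comp (fs_incl W) g = coalg_comp (fs_incl W) h -> g = h.
Proof.
move=> E; apply: coalg_hom_ext => k v; apply: (@fs_incl_inj _ W).
by have := congr1 (fun f : coalg_hom U V => f k v) E.
Qed.

(** The lifted maps commute with the structure because they do after the inclusion, whose tensor
    powers are injective by means of a linear retraction. *)
Lemma fs_lift U V (W : fd_sub V) (f : coalg_hom U V) :
  (forall k u, f k u \in fs_sub W k) ->
  exists g : coalg_hom U (Coalg (fs_on W)), coalg_comp (fs_incl W) g = f.
Proof.
move=> fW; pose WW := Coalg (fs_on W).
have [g gE] : exists g : forall k, U k -> WW k, forall k u, fs_incl W k (g k u) = f k u.
  exists (fun k u => projT1 (cid (fs_incl_ex (fW k u)))) => k u.
  by case: (cid _).
have il := @hfun_linear _ _ _ _ (fs_incl W); have fl := @hfun_linear _ _ _ _ f.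
have gl k : linear (g k).
  by move=> c x y; apply: (@fs_incl_inj _ W); rewrite (il k) !gE (fl k).
have gd k u : g _ (coalg_d U k u) = coalg_d WW k (g k u).
  by apply: (@fs_incl_inj _ W); rewrite gE !hfun_cd gE.
have [r [rl rE]] := graded_pinv il.
have rK k w : r k (fs_incl W k w) = w by apply: (@fs_incl_inj _ W); apply: rE.
have gc n k u : coalg_cop WW n k (g k u) = tens_map id (tpow_map g n) (coalg_cop U n k u).
  have inj (x y : tens (C n) (tpow WW n)) :
      idt (tpow_map (fs_incl W) n) x = idt (tpow_map (fs_incl W) n) y -> x = y.
    move=> /(congr1 (idt (tpow_map r n))); rewrite !idt_map_comp //.
    by rewrite !idt_map_id // => k' w; apply: rK.
  apply: inj; rewrite -/(idt _ _) idt_map_comp // {1}/idt -hfun_cop gE hfun_cop.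
  by apply: eq_idt_map => k' w; rewrite gE.
exists (CoalgHom gl gd gc); apply: coalg_hom_ext => k u; exact: gE.
Qed.

(** A sub-coalgebra containing the images of two finite generating lists contains both images. This
    gives upper bounds of pairs as well as targets for restricted morphisms. *)
Lemma fd_images V (U U' : coalg C) (f : coalg_hom U V) (f' : coalg_hom U' V) :
  finite_dim U -> finite_dim U' -> exists W : fd_sub V,
  (forall k u, f k u \in fs_sub W k) /\ (forall k u, f' k u \in fs_sub W k).
Proof.
move=> /finite_dim_list[l lP] /finite_dim_list[l' lP'].
have [W WP] := fd_sub_ex ([seq helem (f _ (tagged x)) | x <- l] ++
  [seq helem (f' _ (tagged x)) | x <- l']).
have sub (X : coalg C) (g : coalg_hom X V) k : subspace (fun u => g k u \in fs_sub W k).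
  split=> [|c x y gx gy]; first by rewrite (lin0 (@hfun_linear _ _ _ _ g k)) rpred0.
  by rewrite (@hfun_linear _ _ _ _ g k); apply: rpredD => //; apply: rpredZ.
exists W; split.
  apply: lP => [k|x xl]; first exact: sub.
  apply: (WP (helem (f _ (tagged x)))); rewrite mem_cat; apply/orP; left.
  by apply/mapP; exists x.
apply: lP' => [k|x xl]; first exact: sub.
apply: (WP (helem (f' _ (tagged x)))); rewrite mem_cat; apply/orP; right.
by apply/mapP; exists x.
Qed.

Lemma fs_hom_ex V (W W' : fd_sub V) :
  (forall k w, fs_incl W k w \in fs_sub W' k) -> inhabited (fs_hom W W').
Proof. by move=> /fs_lift[g gE]; constructor; exists g. Qed.

Lemma fs_upper V (W W' : fd_sub V) : exists W'' : fd_sub V,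
  inhabited (fs_hom W W'') /\ inhabited (fs_hom W' W'').
Proof.
have [W'' [WW WW']] := fd_images (fs_incl W) (fs_incl W') (fs_fd W) (fs_fd W').
by exists W''; split; apply: fs_hom_ex.
Qed.

Lemma fs_hom_uniq V (W W' : fd_sub V) (f g : fs_hom W W') : f = g.
Proof.
apply: fs_hom_ext; apply: fs_incl_monic.
by case: f => f fE; case: g => g gE /=; rewrite fE gE.
Qed.

Lemma fs_filtered V : filtered (fs_cat V).
Proof.
split.
- by have [W _] := fd_sub_ex (V := V) [::]; constructor; exact: W.
- move=> W W'; exact: fs_upper.
- by move=> W W' f g; exists W', (@sidm (fs_cat V) W'); apply: fs_hom_uniq.
Qed.

Lemma fs_cover V k (v : V k) : exists (W : fd_sub V) w, fs_incl W k w = v.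
Proof.
have [W WP] := fd_sub_ex [:: helem v]; exists W; apply: fs_incl_ex.
by apply: (WP (helem v)); rewrite inE.
Qed.

(** V is the directed union of its finite dimensional sub-coalgebras, so a cocone glues to one map
    and each identity is checked inside one sub-coalgebra. *)
Lemma fs_colimit (Hf : forall V : coalg C, filtered (fs_cat V)) V :
  is_colimit (J := fd_incl C) (F := delta_obj Hf V)
  (X := V : conil_cat C) (fun W : fs_cat V => fs_incl W).
Proof.
split=> [W W' u|Y t tc]; first exact: (svalP u).
(* The two elements become equal in a common upper bound, through which both values factor. *)
have tE (W W' : fd_sub V) k w w' : fs_incl W k w = fs_incl W' k w' ->
    (t W : coalg_hom _ _) k w = (t W' : coalg_hom _ _) k w'.
  move=> ww; have [W'' [[j] [j']]] := fs_upper W W'.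
  rewrite -(tc _ _ j) -(tc _ _ j') /=.
  congr ((t W'' : coalg_hom _ _) k _); apply: (@fs_incl_inj _ W'').
  have := congr1 (fun f : coalg_hom _ _ => f k w) (svalP j); rewrite /= => ->.
  by have := congr1 (fun f : coalg_hom _ _ => f k w') (svalP j'); rewrite /= => ->.
have H k (v : V k) : exists y, forall (W : fd_sub V) w, fs_incl W k w = v ->
    (t W : coalg_hom _ _) k w = y.
  have [W [w wv]] := fs_cover v; exists ((t W : coalg_hom _ _) k w) => W' w' wv'.
  by apply: tE; rewrite wv.
pose h k v := projT1 (cid (H k v)).
have hE (W : fd_sub V) k w : h k (fs_incl W k w) = (t W : coalg_hom _ _) k w.
  by rewrite /h; case: (cid _) => y /= yE; rewrite (yE W w).
have tl (W : fd_sub V) := @hfun_linear _ _ _ _ (t W : coalg_hom (fs_val W) Y).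
have il (W : fd_sub V) := @hfun_linear _ _ _ _ (fs_incl W).
have hl k : linear (h k).
  move=> c x y; have [W [w <-]] := fs_cover x; have [W' [w' <-]] := fs_cover y.
  have [W'' [[j] [j']]] := fs_upper W W'.
  rewrite -(svalP j) -(svalP j') /= -(il W'' k) !hE; exact: tl.
have hd k v : h _ (coalg_d V k v) = coalg_d Y k (h k v).
  by have [W [w <-]] := fs_cover v; rewrite -hfun_cd !hE hfun_cd.
have hc n k v : coalg_cop Y n k (h k v) = tens_map id (tpow_map h n) (coalg_cop V n k v).
  have [W [w <-]] := fs_cover v; rewrite hE !hfun_cop -!/(idt _ _) (idt_map_comp _ (il W) hl).
  by apply: eq_idt_map => k' w'; rewrite hE.
exists (CoalgHom hl hd hc); split=> [W|h' h'E].
  by apply: coalg_hom_ext => k w; exact: hE.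
apply: coalg_hom_ext => k v; have [W [w <-]] := fs_cover v.
by rewrite /= hE -(h'E W).
Qed.

Section DeltaMap.
Variables (V V' : coalg C) (f : coalg_hom V V').

Lemma delta_map_ex (W : fd_sub V) : exists (W' : fd_sub V') (g : coalg_hom (fs_val W) (fs_val W')),
  coalg_comp (fs_incl W') g = coalg_comp f (fs_incl W).
Proof.
have fW : finite_dim (fs_val W) := fs_fd W.
have [W' [W'P _]] := fd_images (coalg_comp f (fs_incl W)) (coalg_comp f (fs_incl W)) fW fW.
by exists W'; apply: fs_lift.
Qed.

(** In a sub-coalgebra containing both targets the two restrictions coincide, since the inclusion
    into V' is injective. Hence the class is independent of the chosen target. *)
Lemma delta_map_uniq Hf (W : fd_sub V) (W1 W2 : fd_sub V')
    (g1 : coalg_hom (fs_val W) (fs_val W1)) (g2 : coalg_hom (fs_val W) (fs_val W2)) :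
  coalg_comp (fs_incl W1) g1 = coalg_comp (fs_incl W2) g2 ->
  colim_cls (G := delta_obj Hf V') (e := W1) g1 =
  colim_cls (G := delta_obj Hf V') (e := W2) g2.
Proof.
move=> gg; have [W3 [[j1] [j2]]] := fs_upper W1 W2.
rewrite -(@colim_cls_step (fd_conil_cat C) (fs_val W) (delta_obj Hf V') _ _ j1 g1).
rewrite -(@colim_cls_step (fd_conil_cat C) (fs_val W) (delta_obj Hf V') _ _ j2 g2).
congr colim_cls; apply: fs_incl_monic => /=.
by rewrite !coalg_compA (svalP j1) (svalP j2).
Qed.

End DeltaMap.

Lemma delta_ex : inhabited (delta_functor C).
Proof.
pose Hf := fs_filtered.
have ex V V' (f : coalg_hom V V') : exists a : ind_hom (delta_obj Hf V) (delta_obj Hf V'),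
    forall (W : fd_sub V) (W' : fd_sub V') (g : coalg_hom (fs_val W) (fs_val W')),
    coalg_comp (fs_incl W') g = coalg_comp f (fs_incl W) ->
    a W = colim_cls (G := delta_obj Hf V') (e := W') g.
  pose W' W := projT1 (cid (delta_map_ex f W)).
  pose g W := projT1 (cid (projT2 (cid (delta_map_ex f W)))).
  have gE W : coalg_comp (fs_incl (W' W)) (g W) = coalg_comp f (fs_incl W).
    exact: projT2 (cid (projT2 (cid (delta_map_ex f W)))).
  pose a (W : idx (delta_obj Hf V)) : colim_hom (diag (delta_obj Hf V) W) (delta_obj Hf V') :=
    colim_cls (G := delta_obj Hf V') (e := W' W) (g W).
  have ac (d d' : idx (delta_obj Hf V)) (u : Defs.hom d d') e
      (h : Defs.hom (diag (delta_obj Hf V) d') (diag (delta_obj Hf V') e)) :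
      a d' = colim_cls h -> a d = colim_cls (cmp h (fmap (diag (delta_obj Hf V)) u)).
    move/(colim_cls_precomp (fmap (diag (delta_obj Hf V)) u)) => <-.
    apply: (@delta_map_uniq V V').
    by rewrite [RHS]coalg_compA !gE -coalg_compA; congr coalg_comp; rewrite [RHS](svalP u).
  exists (IndHom ac) => W W1 g1 g1E; apply: (@delta_map_uniq V V').
  by rewrite gE.
pose m V V' f := projT1 (cid (@ex V V' f)).
have mE V V' f (W : fd_sub V) (W' : fd_sub V') (g : coalg_hom (fs_val W) (fs_val W')) :
    coalg_comp (fs_incl W') g = coalg_comp f (fs_incl W) ->
    m V V' f W = colim_cls (G := delta_obj Hf V') (e := W') g.
  exact: (projT2 (cid (@ex V V' f))).
constructor; apply: (@DeltaFunctor _ _ Hf m) => //.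
- move=> V; apply: ind_hom_ext => W; apply: mE.
  by rewrite coalg_id_r coalg_id_l.
- move=> V V' V'' g f; apply: ind_hom_ext => W.
  have [W' [f1 f1E]] := delta_map_ex f W; have [W'' [g1 g1E]] := delta_map_ex g W'.
  rewrite [RHS]/= (mE _ _ _ _ _ _ f1E) (colim_post_cls _ (mE _ _ _ _ _ _ g1E)).
  by apply: mE; rewrite /= coalg_compA g1E -coalg_compA f1E coalg_compA.
Qed.

End SubObjects.

(** * Colimits and ind-objects *)

Section AbstractColimits.
Variables (A B : category) (J : functor A B).

Lemma cocone_cls (G : ind_obj A) (Y : B) (t : forall e : idx G, hom (J (diag G e)) Y)
    x e e' (g : hom x (diag G e)) (g' : hom x (diag G e')) :
  is_cocone t -> colim_cls g = colim_cls g' ->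
  cmp (t e) (fmap J g) = cmp (t e') (fmap J g').
Proof.
move=> tc /colim_clsP; set p := existT _ e g; set p' := existT _ e' g' => pp'.
rewrite -[LHS]/(cmp (t (projT1 p)) (fmap J (projT2 p))).
rewrite -[RHS]/(cmp (t (projT1 p')) (fmap J (projT2 p'))).
elim: pp' => {p p' e e' g g'} [p p' []|p|p p' _ ->|p q r _ -> _ ->] //=.
by move=> e e' u g; rewrite fmap_cmp cmpA tc.
Qed.

Section ColimitMap.
Variables (F G : ind_obj A) (X Y : B).
Variables (c : forall d : idx F, hom (J (diag F d)) X) (t : forall e : idx G, hom (J (diag G e)) Y).
Hypotheses (cP : is_colimit c) (tc : is_cocone t).

Lemma colimit_map_ex (a : ind_hom F G) : exists h : hom X Y,
  forall d e (g : hom (diag F d) (diag G e)), a d = colim_cls g ->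
  cmp h (c d) = cmp (t e) (fmap J g).
Proof.
have H (d : idx F) : exists y : hom (J (diag F d)) Y, forall e (g : hom (diag F d) (diag G e)),
    a d = colim_cls g -> y = cmp (t e) (fmap J g).
  have [e [g ag]] := colim_cls_surj (a d).
  by exists (cmp (t e) (fmap J g)) => e' g'; rewrite ag; apply: cocone_cls.
pose s d := projT1 (cid (H d)).
have sE d e (g : hom (diag F d) (diag G e)) : a d = colim_cls g -> s d = cmp (t e) (fmap J g).
  exact: (projT2 (cid (H d))).
have [|h [hE _]] := cP.2 Y s.
  move=> d d' u; have [e [g ag]] := colim_cls_surj (a d').
  by rewrite (sE _ _ _ ag) -cmpA -fmap_cmp (sE _ _ _ (ih_compat u ag)).
by exists h => d e g /sE <-.
Qed.

End ColimitMap.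

Lemma colimit_ext (F : ind_obj A) (X Y : B) (c : forall d : idx F, hom (J (diag F d)) X)
    (h h' : hom X Y) :
  is_colimit c -> (forall d, cmp h (c d) = cmp h' (c d)) -> h = h'.
Proof.
move=> [cc cP] hh'.
have [|x [_ xE]] := cP Y (fun d => cmp h (c d)).
  by move=> d d' u; rewrite -cmpA cc.
by rewrite -(xE h) // -(xE h') // => d; rewrite hh'.
Qed.

Variables (X : ind_obj A -> B) (c : forall F (d : idx F), hom (J (diag F d)) (X F)).
Hypothesis cP : forall F, is_colimit (c (F := F)).

(** A choice of colimits object by object is functorial, because induced maps are determined on the
    cocone. *)
Lemma colim_functor_ex : inhabited (colim_functor J).
Proof.
pose m F G a := projT1 (cid (colimit_map_ex (cP F) (cP G).1 a)).
have mE F G (a : ind_hom F G) d e (g : hom (diag F d) (diag G e)) :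
    a d = colim_cls g -> cmp (m F G a) (c d) = cmp (c e) (fmap J g).
  exact: (projT2 (cid (colimit_map_ex (cP F) (cP G).1 a))).
have m_id F : m F F (ind_id F) = idm (X F).
  apply: (colimit_ext (cP F)) => d.
  by rewrite (mE _ _ _ d d (idm _)) // fmap_id cmp_id_l cmp_id_r.
have m_cmp F G H (b : ind_hom G H) (a : ind_hom F G) :
    m F H (ind_comp b a) = cmp (m G H b) (m F G a).
  apply: (colimit_ext (cP F)) => d; have [e [g ag]] := colim_cls_surj (a d).
  have [i [h bh]] := colim_cls_surj (b e).
  rewrite -cmpA (mE _ _ _ _ _ _ ag) cmpA (mE _ _ _ _ _ _ bh) -cmpA -fmap_cmp.
  by apply: mE; rewrite /= ag (colim_post_cls _ bh).
constructor; apply: (@ColimFunctor _ _ _ (@Functor (ind A) B X m m_id m_cmp) c) => //.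
Qed.

End AbstractColimits.

Section Equivalence.
Variables (A B : category).

(** The component of F G -> id at F x lifts along F to G F x -> x; the required identities hold
    after F, hence before it. *)
Lemma nat_iso_of_full_faithful (F : functor A B) (G : functor B A) :
  (forall x y (h : hom (F x) (F y)), exists f, fmap F f = h) ->
  (forall x y (f g : hom x y), fmap F f = fmap F g -> f = g) ->
  nat_iso (functor_comp F G) (functor_id B) -> nat_iso (functor_comp G F) (functor_id A).
Proof.
move=> full faithful [a [b [anat ba ab]]].
pose a' x := projT1 (cid (full _ _ (a (F x)))).
pose b' x := projT1 (cid (full _ _ (b (F x)))).
have a'E x : fmap F (a' x) = a (F x) by exact: projT2 (cid (full _ _ _)).
have b'E x : fmap F (b' x) = b (F x) by exact: projT2 (cid (full _ _ _)).
exists a', b'; split=> [x y f|x|x]; apply: faithful.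
- by rewrite !fmap_cmp !a'E; exact: (anat _ _ (fmap F f)).
- by rewrite fmap_cmp fmap_id a'E b'E; exact: ba.
- by rewrite fmap_cmp fmap_id a'E b'E; exact: ab.
Qed.

Variables (J : functor A B) (T : colim_functor J).
(** Together with [factor_uniq] this is compactness: hom (W, colim G) is the colimit of the hom (W,
    G e). *)
Hypothesis factor : forall (W : A) (G : ind_obj A) (h : hom (J W) (T G)),
  exists e (g : hom W (diag G e)), h = cmp (cf_cocone T (F := G) e) (fmap J g).
Hypothesis factor_uniq : forall (W : A) (G : ind_obj A) e e'
  (g : hom W (diag G e)) (g' : hom W (diag G e')),
  cmp (cf_cocone T (F := G) e) (fmap J g) = cmp (cf_cocone T (F := G) e') (fmap J g') ->
  colim_cls g = colim_cls g'.

(** The restriction of h to each stage of F factors through a stage of G, and [factor_uniq] makes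
    the resulting classes compatible. *)
Lemma colim_full (F G : ind A) (h : hom (T F) (T G)) : exists a, fmap T a = h.
Proof.
pose c F d := @cf_cocone _ _ _ T F d.
have cc (G' : ind A) : is_cocone (c G') by exact: (cf_colimit T G').1.
pose e d := projT1 (cid (factor (cmp h (c F d)))).
pose g d := projT1 (cid (projT2 (cid (factor (cmp h (c F d)))))).
have gE d : cmp h (c F d) = cmp (c G (e d)) (fmap J (g d)).
  exact: projT2 (cid (projT2 (cid (factor (cmp h (c F d)))))).
pose a (d : idx F) := colim_cls (g d).
have ac d d' (u : hom d d') i (k : hom (diag F d') (diag G i)) :
    a d' = colim_cls k -> a d = colim_cls (cmp k (fmap (diag F) u)).
  move=> /(cocone_cls (cc G)) E; apply: factor_uniq.
  rewrite -[LHS]gE -(cc F _ _ u) cmpA gE fmap_cmp cmpA.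
  by rewrite [X in cmp X _ = _]E.
exists (IndHom ac); apply: (colimit_ext (cf_colimit T F)) => d.
by rewrite (@cf_map _ _ _ _ _ _ (IndHom ac) d _ (g d)) // -gE.
Qed.

Lemma colim_faithful (F G : ind A) (a b : hom F G) : fmap T a = fmap T b -> a = b.
Proof.
move=> ab; apply: ind_hom_ext => d.
have [e [g ag]] := colim_cls_surj (ih_comp a d).
have [e' [g' bg]] := colim_cls_surj (ih_comp b d).
rewrite ag bg; apply: factor_uniq.
by rewrite -(cf_map _ ag) -(cf_map _ bg) ab.
Qed.

End Equivalence.

(** * Filtered colimits of coalgebras *)

Section PresInduction.
Variables (K : fieldType) (X : choiceType) (R : seq (K * X) -> Prop).

Lemma pres_ind (P : pres R -> Prop) :
  subspace P -> (forall x, P (gen x)) -> forall y, P y.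
Proof.
move=> [P0 Pl] Pg y; rewrite -(repK y) clsE; elim: (rep y) => [|p s IH].
  by rewrite big_nil.
by rewrite big_cons; apply: Pl.
Qed.

(* The list l is what makes the filtered argument of [iota_eq0] finite: the function f has
   to respect the relations in l only. *)
Lemma cls0_relations (s : seq (K * X)) : cls s = 0 :> pres R ->
  exists2 l : seq (seq (K * X)), forall r, r \in l -> R r &
    forall (W : lmodType K) (f : X -> W),
      (forall r, r \in l -> \sum_(p <- r) p.1 *: f p.2 = 0) ->
      \sum_(p <- s) p.1 *: f p.2 = 0.
Proof.
rewrite -[0]/(cls [::]) => /clsP /=; rewrite cats0 => -[l Rl sE].
exists [seq a.2 | a <- l] => [r /mapP[a /Rl Ra ->] //|W f fl].
pose u := undup ([seq p.2 | p <- s] ++ flatten [seq [seq p.2 | p <- a.2] | a <- l]).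
have uu : uniq u by exact: undup_uniq.
rewrite (fs_sumE _ uu) => [|x xs]; last by rewrite mem_undup mem_cat xs.
under eq_bigr do rewrite sE scaler_suml.
rewrite exchange_big /= big1_seq // => a /andP[_ al].
under eq_bigr do rewrite -scalerA.
rewrite -scaler_sumr -fs_sumE ?fl ?scaler0 //; first exact: map_f.
move=> x xa; rewrite mem_undup mem_cat; apply/orP; right.
by apply/flattenP; exists [seq p.2 | p <- a.2] => //; apply/mapP; exists a.
Qed.

End PresInduction.

(** * Partial cocones in a filtered category *)

Section FiniteCocones.
Variable D : small_category.
Hypothesis Df : filtered D.

(** An apex with at most one arrow from each object. Filteredness allows such a family to be
    enlarged so that any finite number of arrows commute with it. *)
Definition pcocone : Type := {e : sobj D & forall d : sobj D, option (shom d e)}.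
Implicit Types U : pcocone.

Definition pcocone_le U U' : Prop := exists v : shom (projT1 U) (projT1 U'),
  forall d u, projT2 U d = Some u -> projT2 U' d = Some (scmp v u).

Lemma pcocone_le_refl U : pcocone_le U U.
Proof. by exists (sidm _) => d u ->; rewrite scmp_id_l. Qed.

Lemma pcocone_le_trans U U' U'' : pcocone_le U U' -> pcocone_le U' U'' -> pcocone_le U U''.
Proof.
move=> [v vE] [v' v'E]; exists (scmp v' v) => d u /vE /v'E ->.
by rewrite scmpA.
Qed.

Lemma pcocone_extend U d : exists U', pcocone_le U U' /\ exists u, projT2 U' d = Some u.
Proof.
have [_ up _] := Df; have [e' [[v] [w]]] := up (projT1 U) d.
(* Where no arrow was chosen yet, any arrow to the new apex is taken if there is one; this avoids
   testing whether x is d. *)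
pose any x : option (shom x e') :=
  if pselect (inhabited (shom x e')) is left i then Some (inhabited_witness i) else None.
exists (existT _ e' (fun x => if projT2 U x is Some u then Some (scmp v u) else any x)).
split; first by exists v => x u /= ->.
rewrite /=; case: (projT2 U d) => [u|]; first by exists (scmp v u).
rewrite /any; case: pselect => [i|[]]; last exact: inhabits.
by exists (inhabited_witness i).
Qed.

(** First both ends of f get an arrow to the apex; then the two arrows from d are coequalized. *)
Lemma pcocone_arrow U d d' (f : shom d d') : exists U', pcocone_le U U' /\
  exists u u', [/\ projT2 U' d = Some u, projT2 U' d' = Some u' & scmp u' f = u].
Proof.
have [U1 [le1 [u1 u1E]]] := pcocone_extend U d.
have [U2 [[v vE] [u' u'E]]] := pcocone_extend U1 d'.
have [_ _ co] := Df.
have [e [h hE]] := co d (projT1 U2) (scmp u' f) (scmp v u1).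
exists (existT _ e (fun x => omap (scmp h) (projT2 U2 x))); split.
  apply: pcocone_le_trans le1 _; exists (scmp h v) => x u /vE /= ->.
  by rewrite /= scmpA.
exists (scmp h (scmp v u1)), (scmp h u'); split.
- by rewrite /= (vE _ _ u1E).
- by rewrite /= u'E.
by rewrite -scmpA; exact: hE.
Qed.

End FiniteCocones.

(** * The colimit of a filtered diagram, with its coalgebra structure *)

Section ColimitCoalgebra.
Variables (K : fieldType) (C : cooperad_maps K) (F : ind_obj (fd_conil_cat C)).
Let D := idx F.
Let X (d : sobj D) : coalg C := fd_val (diag F d).
Let tr (d d' : sobj D) (u : shom d d') : coalg_hom (X d) (X d') := fmap (diag F) (u : @hom D d d').

Lemma tr_comp d d' d'' (g : shom d' d'') (f : shom d d') k a :
  tr (scmp g f) k a = tr g k (tr f k a).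
Proof. by rewrite /tr [fmap _ _](@fmap_cmp _ _ (diag F) _ _ _ (g : @hom D _ _) f). Qed.

Definition cgen (k : int) : Type := {d : sobj D & X d k}.
HB.instance Definition _ k := gen_eqMixin (cgen k).
HB.instance Definition _ k := gen_choiceMixin (cgen k).

Definition cgen_in k (d : sobj D) (a : X d k) : cgen k := existT (fun d => X d k : Type) d a.

Inductive colim_rel k : seq (K * cgen k) -> Prop :=
| ColimLin d c (a b : X d k) :
    colim_rel [:: (1, cgen_in (c *: a + b)); (- c, cgen_in a); (-1, cgen_in b)]
| ColimArr d d' (u : shom d d') (a : X d k) :
    colim_rel [:: (1, cgen_in (tr u k a)); (-1, cgen_in a)].

Definition colim_mod (k : int) : lmodType K := pres (@colim_rel k).

Definition iota k d (a : X d k) : colim_mod k := gen (cgen_in a).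

Lemma iota_linear k d : linear (@iota k d).
Proof.
move=> c a b; have := cls_rel (ColimLin c a b).
rewrite clsE !big_cons big_nil /= scale1r scaleN1r scaleNr addr0 -opprD.
by move/eqP; rewrite subr_eq0 => /eqP.
Qed.

Lemma iota_tr k d d' (u : shom d d') (a : X d k) : iota (tr u k a) = iota a.
Proof.
have := cls_rel (ColimArr u a).
rewrite clsE !big_cons big_nil /= scale1r scaleN1r addr0.
by move/eqP; rewrite subr_eq0 => /eqP.
Qed.

Section Descent.
Variables (k : int) (W : lmodType K) (f : forall d, X d k -> W).
Hypothesis fl : forall d, linear (@f d).
Hypothesis ftr : forall d d' (u : shom d d') a, f (tr u k a) = f a.

Definition desc : colim_mod k -> W := linext (fun x : cgen k => f (projT2 x)).

Lemma desc_rel r : colim_rel r -> \sum_(p <- r) p.1 *: f (projT2 p.2) = 0.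
Proof.
case=> *; rewrite !big_cons big_nil /= ?fl ?ftr scale1r scaleN1r ?scaleNr addr0.
  by rewrite -opprD subrr.
by rewrite subrr.
Qed.

Lemma desc_linear : linear desc.
Proof. exact/linext_linear/desc_rel. Qed.

Lemma desc_iota d (a : X d k) : desc (iota a) = f a.
Proof. exact/(linext_gen desc_rel). Qed.
End Descent.

Lemma colim_ind k (P : colim_mod k -> Prop) :
  subspace P -> (forall d (a : X d k), P (iota a)) -> forall y, P y.
Proof. by move=> Ps Pi; apply: pres_ind => // -[d a]; exact: Pi. Qed.

Lemma eq_subspace (U W : lmodType K) (g h : U -> W) : linear g -> linear h ->
  subspace (fun x => g x = h x).
Proof.
move=> gl hl; split=> [|c x y gx gy]; first by rewrite (lin0 gl) (lin0 hl).
by rewrite gl hl gx gy.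
Qed.

Hypothesis Df : filtered D.

Lemma iota_cover k (x : colim_mod k) : exists d (a : X d k), iota a = x.
Proof.
have [[d0] up _] := Df; move: x; apply: colim_ind => [|d a]; last by exists d, a.
split; first by exists d0, 0; rewrite (lin0 (@iota_linear k d0)).
move=> c _ _ [d [a <-]] [d' [b <-]]; have [e [[u] [v]]] := up d d'.
exists e, (c *: tr u k a + tr v k b).
by rewrite iota_linear !iota_tr.
Qed.

(** Only finitely many relations are responsible for the vanishing. A large enough partial cocone
    under d makes all of them hold in a single stage, and there the image of a is zero. *)
Lemma iota_eq0 k d (a : X d k) : iota a = 0 -> exists d' (u : shom d d'), tr u k a = 0.
Proof.
move=> a0; have {a0} [l lR lP] := @cls0_relations _ _ _ [:: (1, cgen_in a)] a0.
(* Generators are evaluated in the apex, with value 0 for those whose object has no arrow to it. *)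
pose ev (U : pcocone D) (x : cgen k) : X (projT1 U) k :=
  if projT2 U (projT1 x) is Some u then tr u k (projT2 x) else 0.
pose U0 : pcocone D := existT _ d (fun x =>
  if pselect (x = d) is left e then Some (eq_rect _ (fun y => shom x y) (sidm x) _ e) else None).
have U0d : projT2 U0 d = Some (sidm d).
  rewrite /=; case: pselect => [e|[]//]; by rewrite (Prop_irrelevance e erefl).
(* Each relation is required for all U' above U, so that it survives the enlargements made for the
   others. *)
have [U [leU UP]] : exists U, pcocone_le U0 U /\ forall r, r \in l -> forall U', pcocone_le U U' ->
    \sum_(p <- r) p.1 *: ev U' p.2 = 0.
  elim: l lR {lP} => [|r l IH] lR.
    by exists U0; split=> //; exact: pcocone_le_refl.
  have [|U [leU UP]] := IH; first by move=> r' r'l; apply: lR; rewrite inE r'l orbT.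
  have [U1 [le1 U1P]] : exists U1, pcocone_le U U1 /\ forall U', pcocone_le U1 U' ->
      \sum_(p <- r) p.1 *: ev U' p.2 = 0.
    have : colim_rel r by apply: lR; rewrite inE eqxx.
    case=> [x c b b'|x y f b].
      exists U; split; first exact: pcocone_le_refl.
      move=> U' _; rewrite !big_cons big_nil /= /ev /=.
      (* A linearity relation involves one object only: without an arrow from it, all three terms
         are 0. *)
      case: (projT2 U' x) => [u|]; last by rewrite !scaler0 !addr0.
      rewrite (hfun_linear (tr u)) scale1r scaleN1r scaleNr addr0 -opprD subrr //.
    have [U1 [le1 [u [u' [uE u'E fE]]]]] := pcocone_arrow Df U f.
    exists U1; split=> // U' [v vE]; rewrite !big_cons big_nil /= /ev /=.
    rewrite (vE _ _ uE) (vE _ _ u'E) scale1r scaleN1r addr0 -fE !tr_comp.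
    by rewrite subrr.
  exists U1; split; first exact: pcocone_le_trans leU le1.
  move=> r'; rewrite inE => /orP[/eqP->|r'l] U' leU'; first exact: U1P.
  by apply: UP => //; apply: pcocone_le_trans le1 leU'.
have := lP _ (ev U) (fun r rl => UP r rl _ (pcocone_le_refl _)).
rewrite big_seq1 scale1r /ev /=; have [v /(_ _ _ U0d) ->] := leU.
by exists (projT1 U), (scmp v (sidm d)).
Qed.

(** The structure maps descend from the stages. Each axiom defines a subspace of elements and holds
    on the images of the stages by the [compat] lemmas, hence everywhere. *)
Lemma colim_coalg_ex : exists (V : coalg C) (i : forall d, coalg_hom (X d) V),
  [/\ is_colimit (J := fd_incl C) (F := F) (X := V : conil_cat C) i,
      forall k (v : V k), exists d a, i d k a = v &
      forall k d (a : X d k), i d k a = 0 -> exists d' (u : shom d d'), tr u k a = 0].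
Proof.
pose d0 k d (a : X d k) := iota (coalg_d (X d) k a).
have il d k := @iota_linear k d.
have iml d n := tpow_map_linear (n := n) (il d).
have dl0 k d : linear (@d0 k d).
  by move=> c a b; rewrite /d0 linearP iota_linear.
have dt0 k d d' (u : shom d d') a : @d0 k d' (tr u k a) = d0 k d a.
  by rewrite /d0 -hfun_cd iota_tr.
pose dd k := desc (@d0 k).
have dl k : linear (dd k) by exact: desc_linear (@dl0 k) (@dt0 k).
have dE k d (a : X d k) : dd k (iota a) = iota (coalg_d (X d) k a).
  exact: (desc_iota (@dl0 k) (@dt0 k)).
pose c0 n k d (a : X d k) : tens (C n) (tpow colim_mod n) :=
  idt (tpow_map (fun k => @iota k d) n) (coalg_cop (X d) n k a).
have cl0 n k d : linear (@c0 n k d).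
  by move=> c a b; rewrite /c0 linearP (idt_linear (iml d n)).
have ct0 n k d d' (u : shom d d') a : @c0 n k d' (tr u k a) = c0 n k d a.
  rewrite /c0 hfun_cop -/(idt _ _) idt_map_comp //; last exact: hfun_linear.
  by apply: eq_idt_map => k' v; apply: iota_tr.
pose c n k := desc (@c0 n k).
have cl n k : linear (c n k) by exact: desc_linear (@cl0 n k) (@ct0 n k).
have cE n k d (a : X d k) : c n k (iota a) =
    idt (tpow_map (fun k => @iota k d) n) (coalg_cop (X d) n k a).
  exact: (desc_iota (@cl0 n k) (@ct0 n k)).
unshelve epose (on := @CoalgOn K C colim_mod (fun k => mk_linear (dl k))
  (fun n k => mk_linear (cl n k)) _ _ _ _ _ _ _).
- move=> k; apply: colim_ind => [|d a /=].
    split=> [|b x y /= dx dy]; first by rewrite !linear0.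
    by rewrite /= !dl dx dy scaler0 addr0.
  exact: (compat_dd (f := fun k => @iota k d)).
- move=> n k; apply: colim_ind => [|d a /=]; last first.
    exact: (compat_deg (f := fun k => @iota k d)).
  split=> [|b x y]; first by rewrite linear0; exact: (homog_subspace _ _ _ _).1.
  rewrite /= cl; exact: (homog_subspace _ _ _ _).2.
- move=> n k; apply: colim_ind => [|d a /=]; last first.
    exact: (compat_cd (f := fun k => @iota k d)).
  apply: eq_subspace => b x y /=; first by rewrite dl cl.
  by rewrite cl [LHS](idt_linear (tpow_d_linear dl (n := n))).
- move=> n s k; apply: colim_ind => [|d a /=]; last first.
    exact: (compat_inv (f := fun k => @iota k d)).
  apply: eq_subspace => b x y /=; last exact: cl.
  rewrite cl [LHS]tens_map_linear //; [exact: linearP|exact: tpow_perm_linear].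
- move=> k; apply: colim_ind => [|d a /=]; last first.
    exact: (compat_fin (f := fun k => @iota k d)).
  split=> [|b x y [M MP] [N NP]]; first by exists 0%N => n _; rewrite linear0.
  exists (maxn M N) => n; rewrite geq_max => /andP[Mn Nn].
  by rewrite /= cl [c n k x]MP // [c n k y]NP // scaler0 addr0.
- move=> k; apply: colim_ind => [|d a /=]; last first.
    exact: (compat_counit (f := fun k => @iota k d)).
  have el : linear (@co_counit _ C) by exact: linearP.
  apply: eq_subspace => b x y /=; first by rewrite cl [LHS](counit_at_linear el).
  (* A word of one letter is written as an update, so that multilinearity gives its linearity in
     v. *)
  have E (v : colim_mod k) : [tuple helem v] = upd [tuple helem (0 : colim_mod k)] ord0 (helem v).
    by apply: eq_from_tnth => j; rewrite tnth_upd !(tnth_nth (helem v)) ord1.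
  by rewrite (E (b *: x + y)) (E x) (E y) tprod_upd.
- move=> n m i k; apply: colim_ind => [|d a /=]; last first.
    exact: (compat_coassoc (f := fun k => @iota k d)).
  apply: eq_subspace => b x y /=.
    by rewrite cl [LHS]tens_map_linear //; exact: linearP.
  by rewrite cl [LHS](cop_at_linear i (cl m)).
pose V := Coalg on.
pose i d := @CoalgHom _ _ (X d) V (fun k => @iota k d) (il d)
  (fun k a => esym (dE k d a)) (fun n k a => cE n k d a).
exists V, i; split; [|exact: iota_cover|exact: iota_eq0].
split=> [d d' u|Y t tc].
  by apply: coalg_hom_ext => k a; exact: iota_tr.
have tE k d d' (u : shom d d') a : t d' k (tr u k a) = t d k a.
  by rewrite -(tc _ _ u).
have tl k d : linear (t d k) by exact: hfun_linear.
pose h k := desc (fun d => t d k).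
have hl k : linear (h k) by exact: desc_linear (tl k) (tE k).
have hE k d a : h k (@iota k d a) = t d k a by exact: (desc_iota (tl k) (tE k)).
have hd k (v : V k) : h _ (coalg_d V k v) = coalg_d Y k (h k v).
  have [d [a <-]] := iota_cover v; rewrite -[iota a]/(i d k a) -hfun_cd.
  by rewrite [LHS]hE [h k _]hE hfun_cd.
have hc n k (v : V k) : coalg_cop Y n k (h k v) = tens_map id (tpow_map h n) (coalg_cop V n k v).
  have [d [a <-]] := iota_cover v; rewrite -[iota a]/(i d k a) [h k _]hE !hfun_cop.
  rewrite -!/(idt _ _) (idt_map_comp _ (il d) hl).
  by apply: eq_idt_map => k' w; rewrite hE.
exists (@CoalgHom _ _ V Y h hl hd hc); split=> [d|h' h'E].
  by apply: coalg_hom_ext => k a; exact: hE.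
apply: coalg_hom_ext => k v; have [d [a <-]] := iota_cover v.
by rewrite [LHS]hE -(h'E d).
Qed.
End ColimitCoalgebra.

(** * The equivalence *)

Section Compactness.
Variables (K : fieldType) (C : cooperad_maps K).

Section Colimit.
Variables (G : ind_obj (fd_conil_cat C)) (X : coalg C).
Let D := idx G.
Let Y (d : sobj D) : coalg C := fd_val (diag G d).
Let tr (d d' : sobj D) (u : shom d d') : coalg_hom (Y d) (Y d') := fmap (diag G) (u : @hom D d d').
Variable c : forall d : sobj D, coalg_hom (Y d) X.
Hypothesis cP : is_colimit (J := fd_incl C) (F := G) (X := X : conil_cat C) c.

Let c_lin d k : linear (c d k) := @hfun_linear _ _ _ _ (c d) k.
Let tr_lin d d' (u : shom d d') k : linear (tr u k) := @hfun_linear _ _ _ _ (tr u) k.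
Arguments c_lin : clear implicits.
Arguments tr_lin : clear implicits.

Let c_tr d d' (u : shom d d') k a : c d' k (tr u k a) = c d k a.
Proof. by have := congr1 (fun f : coalg_hom _ _ => f k a) (cP.1 d d' u). Qed.

Let tr_comp d d' d'' (g : shom d' d'') (f : shom d d') k a :
  tr (scmp g f) k a = tr g k (tr f k a).
Proof. by rewrite /tr [fmap _ _](@fmap_cmp _ _ (diag G) _ _ _ (g : @hom D _ _) f). Qed.

(** Both properties hold for the colimit of [colim_coalg_ex] and pass to X along the comparison maps
    phi and psi. *)
Lemma colimit_cover_vanish : (forall k (x : X k), exists d a, c d k a = x) /\
  (forall k d (a : Y d k), c d k a = 0 -> exists d' (u : shom d d'), tr u k a = 0).
Proof.
have [V [i [iP cover vanish]]] := colim_coalg_ex (idx_filtered G).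
have [phi [phiE _]] := iP.2 X c cP.1; have [psi [psiE _]] := cP.2 V i iP.1.
have pp : coalg_comp phi psi = coalg_id X.
  apply: (colimit_ext cP) => d; rewrite [RHS]coalg_id_l -[LHS]coalg_compA.
  by rewrite [coalg_comp psi _]psiE; exact: phiE.
split=> [k x|k d a ca].
  have [d [a ax]] := cover k (psi k x); exists d, a.
  rewrite -[RHS](congr1 (fun f : coalg_hom _ _ => f k x) pp) /= -ax.
  by rewrite -(phiE d).
apply: vanish; rewrite -(psiE d) /= ca.
exact: lin0 (@hfun_linear _ _ _ _ psi k).
Qed.

Lemma ker_stable d : exists e (u : shom d e), forall k a, c d k a = 0 -> tr u k a = 0.
Proof.
have [_ vanish] := colimit_cover_vanish.
have [q [ql qE]] := graded_pinv (c_lin d).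
(* [z] projects onto the kernel of c_d, so the images under z of a finite generating list generate
   this kernel; a transition map is composed for each of them in turn. *)
pose z k (a : Y d k) := a - q k (c d k a).
have zl k : linear (z k).
  by move=> b x y; rewrite /z c_lin ql opprD addrACA scalerBr.
have cz k a : c d k (z k a) = 0 by rewrite /z (linB (c_lin d k)) qE subrr.
have [l lP] := finite_dim_list (fd_valP (diag G d)).
have [e [u uP]] : exists e (u : shom d e), forall x, x \in l -> tr u _ (z _ (tagged x)) = 0.
  elim: l {lP} => [|x l [e [u uP]]]; first by exists d, (sidm d).
  have [|e' [v vE]] := vanish _ e (tr u _ (z _ (tagged x))); first by rewrite c_tr cz.
  exists e', (scmp v u) => y; rewrite inE tr_comp => /orP[/eqP->//|/uP->].
  exact: lin0 (tr_lin _ _ v _).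
exists e, u => k a ca.
have zu : forall k a, tr u k (z k a) = 0.
  by apply: lP => // k'; split=> [|b x y zx zy];
    rewrite ?zl ?tr_lin ?zx ?zy ?scaler0 ?addr0 // (lin0 (zl k')) (lin0 (tr_lin _ _ u k')).
by have := zu k a; rewrite /z ca (lin0 (ql k)) subr0.
Qed.

Variable W : coalg C.
Hypothesis Wfd : finite_dim W.

(** The image of each vector of a finite generating list comes from some stage, and finitely many
    stages have a common successor. *)
Lemma image_stage (h : coalg_hom W X) : exists d, forall k w, exists a, c d k a = h k w.
Proof.
have [cover _] := colimit_cover_vanish; have [[d0] up _] := idx_filtered G.
have [l lP] := finite_dim_list Wfd.
have [d dP] : exists d, forall x, x \in l -> exists a, c d _ a = h _ (tagged x).
  elim: l {lP} => [|x l [d dP]]; first by exists d0.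
  have [d' [a' a'E]] := cover _ (h _ (tagged x)).
  have [e [[u] [u']]] := up d d'; exists e => y; rewrite inE => /orP[/eqP->|/dP[a aE]].
    by exists (tr u' _ a'); rewrite c_tr.
  by exists (tr u _ a); rewrite c_tr.
exists d; apply: lP => // k; have hl := @hfun_linear _ _ _ _ h k.
split=> [|b x y [a aE] [a' a'E]]; first by exists 0; rewrite (lin0 (c_lin d k)) (lin0 hl).
by exists (b *: a + a'); rewrite c_lin hl aE a'E.
Qed.

Lemma compact_factor (h : coalg_hom W X) :
  exists e (g : coalg_hom W (Y e)), h = coalg_comp (c e) g.
Proof.
have [d hd] := image_stage h; have [e [u uP]] := ker_stable d.
have [q [ql qE]] := graded_pinv (c_lin d).
pose rho k (x : X k) := tr u k (q k x).
have rl k : linear (rho k) by move=> b x y; rewrite /rho ql tr_lin.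
have hl k := @hfun_linear _ _ _ _ h k.
(* The difference a - q (c_d a) is in the kernel of c_d, hence killed by u. So on the image of c_d,
   where h takes its values, rho acts as the morphism u. *)
have rc k a : rho k (c d k a) = tr u k a.
  apply/eqP; rewrite -subr_eq0 -(linB (tr_lin _ _ u k)); apply/eqP/uP.
  by rewrite (linB (c_lin d k)) qE subrr.
pose g k w := rho k (h k w).
have gl k : linear (g k) by move=> b x y; rewrite /g hl rl.
have gd k w : g _ (coalg_d W k w) = coalg_d (Y e) k (g k w).
  by have [a aE] := hd k w; rewrite /g hfun_cd -aE -hfun_cd !rc hfun_cd.
(* The decomposition of h w = c_d a is pushed forward from that of a, so only rho on the image of
   c_d enters. *)
have gc n k w : coalg_cop (Y e) n k (g k w) = tens_map id (tpow_map g n) (coalg_cop W n k w).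
  have [a aE] := hd k w.
  rewrite -/(idt _ _) -(idt_map_comp _ hl rl) {2}/idt -hfun_cop -aE hfun_cop.
  rewrite -!/(idt _ _) (idt_map_comp _ (c_lin d) rl) /g -aE rc hfun_cop.
  by apply: eq_idt_map => k' y; rewrite rc.
exists e, (@CoalgHom _ _ W (Y e) g gl gd gc); apply: coalg_hom_ext => k w /=.
by have [a aE] := hd k w; rewrite /g /rho c_tr -aE qE.
Qed.

(** At a common stage e the two maps differ by values in the kernel of c_e, which a single
    transition map kills entirely. *)
Lemma compact_uniq d d' (g : coalg_hom W (Y d)) (g' : coalg_hom W (Y d')) :
  coalg_comp (c d) g = coalg_comp (c d') g' ->
  exists e (u : shom d e) (u' : shom d' e), coalg_comp (tr u) g = coalg_comp (tr u') g'.
Proof.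
move=> gg; have [_ up _] := idx_filtered G; have [e [[u] [u']]] := up d d'.
have [e' [v vP]] := ker_stable e; exists e', (scmp v u), (scmp v u').
apply: coalg_hom_ext => k w /=; rewrite !tr_comp.
apply/eqP; rewrite -subr_eq0 -(linB (tr_lin _ _ v k)); apply/eqP/vP.
rewrite (linB (c_lin e k)) !c_tr.
by have := congr1 (fun f : coalg_hom _ _ => f k w) gg; rewrite /= => ->; rewrite subrr.
Qed.

End Colimit.

Lemma conil_ind_equivalence :
  inhabited (colim_functor (fd_incl C)) /\ inhabited (delta_functor C) /\
  forall (T : colim_functor (fd_incl C)) (D : delta_functor C), cat_equivalence T (delta D).
Proof.
split; last split; last move=> T D.
- pose X (G : ind_obj (fd_conil_cat C)) := projT1 (cid (colim_coalg_ex (idx_filtered G))).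
  pose c (G : ind_obj (fd_conil_cat C)) :=
    projT1 (cid (projT2 (cid (colim_coalg_ex (idx_filtered G))))).
  apply: (@colim_functor_ex _ _ (fd_incl C) X c) => G.
  by have [] := projT2 (cid (projT2 (cid (colim_coalg_ex (idx_filtered G))))).
- exact: delta_ex.
have factor (W : fd_conil_cat C) (G : ind_obj (fd_conil_cat C)) (h : hom (fd_incl C W) (T G)) :
    exists e (g : hom W (diag G e)), h = cmp (cf_cocone T (F := G) e) (fmap (fd_incl C) g).
  exact: (compact_factor (cf_colimit T G) (fd_valP W)).
have factor_uniq (W : fd_conil_cat C) (G : ind_obj (fd_conil_cat C)) e e'
    (g : hom W (diag G e)) (g' : hom W (diag G e')) :
    cmp (cf_cocone T (F := G) e) (fmap (fd_incl C) g) =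
    cmp (cf_cocone T (F := G) e') (fmap (fd_incl C) g') -> colim_cls g = colim_cls g'.
  move=> gg; have [i [u [u' E]]] := compact_uniq (cf_colimit T G) gg.
  by rewrite -(colim_cls_step u g) -(colim_cls_step u' g'); congr colim_cls.
(* V and the chosen colimit of its sub-coalgebras are colimits of the same diagram; the comparison
   maps are inverse and natural because this can be tested on each sub-coalgebra. *)
have TD : nat_iso (functor_comp T (delta D)) (functor_id (conil_cat C)).
  pose Hf := @df_filtered _ _ D.
  pose dV (V : coalg C) : ind_obj (fd_conil_cat C) := delta_obj Hf V.
  have TP V := cf_colimit T (dV V); have VP V := fs_colimit Hf V.
  pose a V := projT1 (cid ((TP V).2 _ _ (VP V).1)).
  pose b V := projT1 (cid ((VP V).2 _ _ (TP V).1)).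
  have aE V W : cmp (a V) (cf_cocone T (F := dV V) W) = fs_incl W.
    exact: (projT2 (cid ((TP V).2 _ _ (VP V).1))).1.
  have bE V W : cmp (b V) (fs_incl W : @hom (conil_cat C) _ V) = cf_cocone T (F := dV V) W.
    exact: (projT2 (cid ((VP V).2 _ _ (TP V).1))).1.
  exists a, b; split=> [V V' f|V|V].
  - apply: (colimit_ext (TP V)) => W.
    have [W' [g gE]] := delta_map_ex f W.
    rewrite -!cmpA aE (cf_map T (df_mapE D gE)) cmpA aE.
    exact: gE.
  - apply: (colimit_ext (TP V)) => W.
    by rewrite -cmpA aE bE cmp_id_l.
  - apply: (colimit_ext (VP V)) => W.
    by rewrite -cmpA bE aE cmp_id_l.
split=> //; apply: nat_iso_of_full_faithful TD.
- exact: (colim_full factor factor_uniq).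
- exact: (colim_faithful factor_uniq).
Qed.

End Compactness.

Theorem corollary5p2 (K : fieldType) (charK0 : [pchar K] =i pred0) :
  inhabited (colim_functor (fd_incl (coLie K))) /\
  inhabited (delta_functor (coLie K)) /\
  forall (colim : colim_functor (fd_incl (coLie K)))
         (D : delta_functor (coLie K)),
    cat_equivalence colim (delta D).
Proof. exact: conil_ind_equivalence. Qed.
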